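(* Let $\pi:M\to B$ be a fiber bundle with $M$ a 5-dimensional manifold with volume form $\Omega$ and $B$ an oriented 2-manifold with area form $\omega$. Let $\Pi=\kappa\,\mathrm{hor}^\gamma\psi+P_\beta$ be the almost coupling Poisson tensor on $M$ associated with a Poisson triple $(\gamma,\kappa,\beta)$, and let $\mathcal Z(\kappa)=\{\kappa=0\}$. Then: (i) in the open subset $M^\Pi=M\setminus\mathcal Z(\kappa)$, $\Pi$ is a coupling Poisson tensor associated to the geometric data $(\gamma,\sigma,P_\beta)$, where the Poisson connection $\gamma$ is uniquely determined by $\mathbb H=\Pi^\sharp(\mathbb V^\circ)$ and the coupling form is $\sigma=\tfrac1\kappa\,\pi^*\omega$; (ii) in the open subset $\mathrm{Int}(\mathcal Z(\kappa))$, $\Pi$ coincides with the vertical Poisson tensor, $\Pi=P_\beta$; (iii) at the points of the boundary $\partial(\mathcal Z(\kappa))$, the linear part of $\kappa$ is compatible with $\beta$ by the condition $(d_{0,1}\kappa)_p\wedge\beta_p=0$ for all $p\in\partial(\mathcal Z(\kappa))$.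
   Context: All objects are smooth. A fiber bundle $\pi:M\to B$ is a surjective submersion; $\mathbb V=\ker d\pi\subset TM$ is the vertical subbundle (rank 3 here). An Ehresmann connection is a bundle morphism $\gamma:TM\to\mathbb V$ with $\gamma|_{\mathbb V}=\mathrm{id}$; $\mathbb H=\ker\gamma$ is the horizontal subbundle, so $TM=\mathbb H\oplus\mathbb V$ and $T^*M=\mathbb V^\circ\oplus\mathbb H^\circ$ (annihilators). These splittings bigrade multivector fields and forms: a multivector field has bidegree $(p,q)$ if it is a section of $\wedge^p\mathbb H\otimes\wedge^q\mathbb V$, and a form has bidegree $(p,q)$ if it is a section of $\wedge^p\mathbb V^\circ\otimes\wedge^q\mathbb H^\circ$. The exterior differential splits as $d=d_{1,0}+d_{0,1}+d_{2,-1}$, where for a $(p,q)$-form $\alpha$, $d_{i,j}\alpha$ is the bidegree $(p+i,q+j)$ component of $d\alpha$. For a multivector field $\psi$ on $B$, $\mathrm{hor}^\gamma\psi$ is its $\gamma$-horizontal lift. $\Pi^\sharp:T^*M\to TM$, $\alpha\mapsto\mathbf i_\alpha\Pi$. Interior products: $\mathbf i_{X\wedge Y}=\mathbf i_X\circ\mathbf i_Y$ for vector fields acting on forms; similarly $\mathbf i_{\alpha\wedge\alpha'}=\mathbf i_\alpha\circ\mathbf i_{\alpha'}$ for 1-forms acting on multivector fields, with $\mathbf i_\alpha$ inserting $\alpha$ in the first slot. Let $\Omega^{\mathrm H}=\pi^*\omega$ and let $\Omega^{\mathrm V}\in\Gamma\wedge^3\mathbb H^\circ$ be the unique form with $\Omega=\Omega^{\mathrm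 H}\wedge\Omega^{\mathrm V}$. Let $Q_{\mathrm H}\in\Gamma\wedge^2\mathbb H$, $Q_{\mathrm V}\in\Gamma\wedge^3\mathbb V$ be determined by $\mathbf i_{Q_{\mathrm H}}\Omega^{\mathrm H}=1$, $\mathbf i_{Q_{\mathrm V}}\Omega^{\mathrm V}=1$, and let $\psi\in\Gamma\wedge^2TB$ satisfy $\mathbf i_\psi\omega=-1$. Put $P_\beta=-\mathbf i_\beta Q_{\mathrm V}$, $\theta=-\mathbf i_{Q_{\mathrm V}}d_{1,0}\Omega^{\mathrm V}$, $\varrho=\mathbf i_{Q_{\mathrm H}}d_{2,-1}\Omega^{\mathrm V}$. A triple $(\gamma,\kappa,\beta)$, consisting of an Ehresmann connection $\gamma$, $\kappa\in C^\infty(M)$ and $\beta\in\Gamma\mathbb H^\circ$, is a Poisson triple (relative to $(\Omega,\omega)$) if $$d_{0,1}\beta\wedge\beta=0,\quad \kappa\,(d_{1,0}\beta-\theta\wedge\beta)=0,\quad d_{0,1}\kappa\wedge\beta-\kappa^2\varrho=0.$$ In that case $\Pi=\kappa\,\mathrm{hor}^\gamma\psi+P_\beta$ is a Poisson tensor. A bivector field $\Pi$ is coupling on an open set $U$ if $\Pi^\sharp(\mathbb V^\circ)$ is a subbundle complementary to $\mathbb V$ over $U$; it is associated to geometric data $(\gamma,\sigma,\Pi_{0,2})$ when $\ker\gamma=\Pi^\sharp(\mathbb V^\circ)$, $\Pi_{0,2}$ is the vertical component of $\Pi$, and $\sigma\in\Gamma\wedge^2\mathbb V^\circ$ (the coupling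 form) is determined by $\mathbf i_{\mathbf i_\alpha\Pi_{2,0}}\sigma=-\alpha$ for all $\alpha\in\mathbb V^\circ$. The connection $\gamma$ is a Poisson connection on an open set $U$ (relative to $P_\beta$) if $\mathcal L_{\mathrm{hor}^\gamma u}P_\beta=0$ on $U$ for all vector fields $u$ on $B$. *)

(* Defs.v *)
From HB Require Import structures.
From mathcomp Require Import all_boot all_order all_algebra all_fingroup.
From mathcomp Require Import all_classical all_reals all_analysis.

Set Implicit Arguments.
Unset Strict Implicit.
Unset Printing Implicit Defensive.

Import Order.TTheory GRing.Theory Num.Theory.
Import numFieldNormedType.Exports.
Local Open Scope classical_set_scope.
Local Open Scope ring_scope.

(* Tangent vectors are row vectors 'rV_n, covectors are column vectors 'cV_n,
   and the pairing is the matrix product.  A k-covector is an alternating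
   k-linear form on 'rV_n, a k-vector is an alternating k-linear form
   on 'cV_n; thus (X /\ Y)(a, b) = a(X) b(Y) - a(Y) b(X). *)

Definition kform (R : realType) (V : lmodType R) (k : nat) : Type :=
  ('I_k -> V) -> R.

Section Forms.
Variables (R : realType) (V : lmodType R).

Definition upd k (v : 'I_k -> V) (i : 'I_k) (x : V) : 'I_k -> V :=
  fun j => if j == i then x else v j.

Definition alternating k (a : kform V k) : Prop :=
  (forall v i c x y,
     a (upd v i (c *: x + y)) = c * a (upd v i x) + a (upd v i y)) /\
  (forall v i j, i != j -> v i = v j -> a v = 0).

Definition ins k (x : V) (a : kform V k.+1) : kform V k :=
  fun v => a (fun i => if unlift ord0 i is Some j then v j else x).

Definition wedge k l (a : kform V k) (b : kform V l) : kform V (k + l) :=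
  fun v => ((k`! * l`!)%:R)^-1 *
    \sum_(s : 'S_(k + l)) (-1) ^+ (s : bool) *
      (a (fun i => v (s (lshift l i))) * b (fun i => v (s (rshift k i)))).

(* Given complementary projections A and B, the part of a that has p arguments
   in the image of A and q arguments in the image of B. *)
Definition component (A B : V -> V) p q (a : kform V (p + q)) :
    kform V (p + q) :=
  fun v => \sum_(S : {set 'I_(p + q)} | #|S| == p)
    a (fun i => if i \in S then A (v i) else B (v i)).

Definition pair2 (x y : V) : 'I_2 -> V := fun i => if i == ord0 then x else y.

End Forms.

Section Tensors.
Variables (R : realType) (n : nat).

Definition pairing (v : 'rV[R]_n) (xi : 'cV[R]_n) : R := (v *m xi) 0 0.

Definition evec (i : 'I_n) : 'rV[R]_n := delta_mx 0 i.
Definition ecovec (i : 'I_n) : 'cV[R]_n := delta_mx i 0.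

Definition covec (a : kform 'rV[R]_n 1) : 'cV[R]_n := \col_i a (fun=> evec i).
Definition vec (x : kform 'cV[R]_n 1) : 'rV[R]_n := \row_i x (fun=> ecovec i).

(* The interior product i_Q a of a k-vector Q with a form a, for the convention
   i_(X1 /\ ... /\ Xk) = i_X1 \o ... \o i_Xk.  Since i_Xk acts first, Xk goes
   into the first slot of a, which is why the indices are reversed. *)
Definition contract k m (Q : kform 'cV[R]_n k) (a : kform 'rV[R]_n (k + m)) :
    kform 'rV[R]_n m :=
  fun w => (k`!%:R)^-1 *
    \sum_(s : {ffun 'I_k -> 'I_n}) Q (fun i => ecovec (s i)) *
      a (fun j => match fintype.split j with
                  | inl i => evec (s (rev_ord i))
                  | inr i => w i
                  end).

(* Bigrading by a projection g onto the vertical space (acting on row vectors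
   from the right), the horizontal space being the kernel of g.  On covectors
   the dual projections are xi |-> g *m xi, onto the annihilator of the
   horizontal space, and xi |-> (1 - g) *m xi, onto that of the vertical one. *)
Definition form_comp (g : 'M[R]_n) p q (a : kform 'rV[R]_n (p + q)) :=
  component (fun v => v *m (1%:M - g)) (fun v => v *m g) a.

Definition mvec_comp (g : 'M[R]_n) p q (Q : kform 'cV[R]_n (p + q)) :=
  component (fun xi => (1%:M - g) *m xi) (fun xi => g *m xi) Q.

End Tensors.

Arguments contract {R n k} m Q a _.
Arguments form_comp {R n} g p q a _.
Arguments mvec_comp {R n} g p q Q _.

Fixpoint Ck (R : realType) n (k : nat) (U : set 'rV[R]_n)
    (f : 'rV[R]_n -> R) : Prop :=
  if k is k'.+1 then
    (forall x, U x -> differentiable f x) /\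
    (forall i, Ck k' U (fun x => 'D_(evec R i) f x))
  else forall x, U x -> {for x, continuous f}.

Definition Csmooth (R : realType) n (U : set 'rV[R]_n) (f : 'rV[R]_n -> R) :=
  forall k, Ck k U f.

Definition Csmooth_map (R : realType) n m (U : set 'rV[R]_n)
    (f : 'rV[R]_n -> 'rV[R]_m) :=
  forall j, Csmooth U (fun x => f x 0 j).

Record chart (R : realType) (T : topologicalType) (n : nat) := Chart {
  cdom : set T;
  cfun : T -> 'rV[R]_n;
  cinv : 'rV[R]_n -> T;
  cdom_open : open cdom;
  cimg_open : open (cfun @` cdom);
  cfunK : forall p, cdom p -> cinv (cfun p) = p;
  cfun_cont : forall p, cdom p -> {for p, continuous cfun};
  cinv_cont : forall x, (cfun @` cdom) x -> {for x, continuous cinv}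
}.

Record manifold (R : realType) (n : nat) := Manifold {
  space :> topologicalType;
  atlas : set (chart R space n);
  space_hausdorff : hausdorff_space space;
  space_second_countable : @second_countable space;
  atlas_cover : forall p, exists c, atlas c /\ cdom c p;
  atlas_compat : forall c c', atlas c -> atlas c' ->
    Csmooth_map (cfun c @` (cdom c `&` cdom c')) (cfun c' \o cinv c)
}.

Section Calculus.
Variables (R : realType) (n : nat) (M : manifold R n).

(* The tangent space at p is 'rV_n, read in the distinguished chart at p. *)
Definition chart_at (p : M) : chart R M n := sval (cid (atlas_cover p)).
Definition coord (p : M) : 'rV[R]_n := cfun (chart_at p) p.

(* jac c p is the change of coordinates from c to chart_at p on tangent vectors
   at p. *)
Definition jac (c : chart R M n) (p : M) : 'M[R]_n :=
  jacobian (cfun (chart_at p) \o cinv c) (cfun c p).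

Definition dform k := M -> kform 'rV[R]_n k.
Definition mvec k := M -> kform 'cV[R]_n k.
Definition vfield := M -> 'rV[R]_n.
Definition endo := M -> 'M[R]_n.

Definition form_in k (c : chart R M n) (a : dform k) v (x : 'rV[R]_n) : R :=
  a (cinv c x) (fun i => v i *m jac c (cinv c x)).
Definition mvec_in k (c : chart R M n) (Q : mvec k) xi (x : 'rV[R]_n) : R :=
  Q (cinv c x) (fun i => invmx (jac c (cinv c x)) *m xi i).
Definition vfield_in (c : chart R M n) (X : vfield) (x : 'rV[R]_n) : 'rV[R]_n :=
  X (cinv c x) *m invmx (jac c (cinv c x)).
Definition endo_in (c : chart R M n) (g : endo) (x : 'rV[R]_n) : 'M[R]_n :=
  jac c (cinv c x) *m g (cinv c x) *m invmx (jac c (cinv c x)).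

Definition smooth_fun (U : set M) (f : M -> R) := forall c, atlas c ->
  Csmooth (cfun c @` (cdom c `&` U)) (f \o cinv c).
Definition smooth_vfield (U : set M) (X : vfield) := forall c, atlas c ->
  Csmooth_map (cfun c @` (cdom c `&` U)) (vfield_in c X).
Definition smooth_endo (U : set M) (g : endo) := forall c, atlas c ->
  forall i j, Csmooth (cfun c @` (cdom c `&` U)) (fun x => endo_in c g x i j).

Definition is_form (U : set M) k (a : dform k) : Prop :=
  (forall p, U p -> alternating (a p)) /\
  (forall c, atlas c ->
     forall v, Csmooth (cfun c @` (cdom c `&` U)) (form_in c a v)).
Definition is_mvec (U : set M) k (Q : mvec k) : Prop :=
  (forall p, U p -> alternating (Q p)) /\
  (forall c, atlas c ->
     forall xi, Csmooth (cfun c @` (cdom c `&` U)) (mvec_in c Q xi)).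

Definition volume_form (a : dform n) : Prop :=
  is_form setT a /\ forall p, exists v, a p v != 0.

Definition ext_d k (a : dform k) : dform k.+1 :=
  fun p v => \sum_(i < k.+1) (-1) ^+ i *
    'D_(v i) (form_in (chart_at p) a (fun j => v (lift i j))) (coord p).

Definition fun_form (f : M -> R) : dform 0 := fun p _ => f p.

Definition grad (f : M -> R) (p : M) : 'cV[R]_n :=
  covec (ext_d (fun_form f) p).

(* L_X Q evaluated on constant covector fields xi_1, ..., xi_k in coordinates:
   X(Q(xi_1, ..., xi_k)) - sum_i Q(xi_1, ..., L_X xi_i, ..., xi_k), where
   L_X xi_i = d(xi_i(X)). *)
Definition lie k (X : vfield) (Q : mvec k) : mvec k :=
  fun p xi =>
    'D_(X p) (mvec_in (chart_at p) Q xi) (coord p) -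
    \sum_(i < k) Q p (upd xi i
      (\col_l 'D_(evec R l)
         (fun x => pairing (vfield_in (chart_at p) X x) (xi i)) (coord p))).

Definition bracket (P : mvec 2) (f g : M -> R) : M -> R :=
  fun p => P p (pair2 (grad f p) (grad g p)).

Definition poisson_tensor (U : set M) (P : mvec 2) : Prop :=
  is_mvec U P /\
  forall (W : set M) (f g h : M -> R), open W -> W `<=` U ->
    smooth_fun W f -> smooth_fun W g -> smooth_fun W h ->
    forall p, W p ->
      bracket P f (bracket P g h) p + bracket P g (bracket P h f) p +
      bracket P h (bracket P f g) p = 0.

Definition sharp (P : mvec 2) (p : M) (xi : 'cV[R]_n) : 'rV[R]_n :=
  vec (ins xi (P p)).

Definition subbundle (U : set M) (E : forall p : M, set 'rV[R]_n) : Prop :=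
  exists r : nat, forall p, U p ->
  exists W : set M, [/\ open W, W p, W `<=` U &
  exists X : 'I_r -> vfield,
    (forall i, smooth_vfield W (X i)) /\
    (forall q, W q ->
       row_free (\matrix_i X i q) /\
       forall w, E q w <-> (w <= \matrix_i X i q)%MS)].

Definition complementary (E F : set 'rV[R]_n) : Prop :=
  (forall w, E w -> F w -> w = 0) /\
  (forall w, exists e f, [/\ E e, F f & w = e + f]).

End Calculus.

Section Bundle.
Variables (R : realType) (n m : nat) (M : manifold R n) (B : manifold R m).
Variable pi : M -> B.

Definition smooth_map : Prop :=
  continuous pi /\
  forall c c', atlas c -> atlas c' ->
    Csmooth_map (cfun c @` (cdom c `&` pi @^-1` (cdom c')))
      (cfun c' \o pi \o cinv c).

Definition tangent (p : M) : 'M[R]_(n, m) :=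
  jacobian (cfun (chart_at (pi p)) \o pi \o cinv (chart_at p)) (coord p).

Definition fiber_bundle : Prop :=
  [/\ smooth_map, forall b, exists p, pi p = b &
      forall p, row_full (tangent p)].

Definition vertical (p : M) : set 'rV[R]_n := [set v | v *m tangent p = 0].
Definition ann_vertical (p : M) : set 'cV[R]_n :=
  [set xi | forall v, vertical p v -> pairing v xi = 0].

Definition pullback k (a : dform B k) : dform M k :=
  fun p v => a (pi p) (fun i => v i *m tangent p).

Definition connection (U : set M) (g : endo M) : Prop :=
  smooth_endo U g /\
  forall p, U p -> (forall w, vertical p (w *m g p)) /\
                   (forall v, vertical p v -> v *m g p = v).

(* The horizontal lift T_(pi p) B -> T_p M: any right inverse of d pi followed
   by the horizontal projection. *)
Definition hor (g : endo M) (p : M) : 'M[R]_(m, n) :=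
  pinvmx (tangent p) *m (1%:M - g p).

Definition hor_vfield (g : endo M) (u : vfield B) : vfield M :=
  fun p => u (pi p) *m hor g p.

Definition hor_mvec (g : endo M) k (Q : mvec B k) : mvec M k :=
  fun p xi => Q (pi p) (fun i => hor g p *m xi i).

Definition form_bideg (U : set M) (g : endo M) p q (a : dform M (p + q)) :=
  is_form U a /\ forall x, U x -> form_comp (g x) p q (a x) = a x.
Definition mvec_bideg (U : set M) (g : endo M) p q (Q : mvec M (p + q)) :=
  is_mvec U Q /\ forall x, U x -> mvec_comp (g x) p q (Q x) = Q x.

Definition image_ann (P : mvec M 2) (p : M) : set 'rV[R]_n :=
  [set sharp P p xi | xi in ann_vertical p].

Definition coupling (U : set M) (P : mvec M 2) : Prop :=
  subbundle U (image_ann P) /\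
  forall p, U p -> complementary (image_ann P p) (vertical p).

Definition ker_is_image (U : set M) (g : endo M) (P : mvec M 2) : Prop :=
  forall p, U p -> forall w, w *m g p = 0 <-> image_ann P p w.

Definition coupling_form (U : set M) (g : endo M) (P : mvec M 2)
    (sigma : dform M 2) : Prop :=
  form_bideg U g (p := 2) (q := 0) sigma /\
  forall p, U p -> forall xi, ann_vertical p xi ->
    covec (ins (vec (ins xi (mvec_comp (g p) 2 0 (P p)))) (sigma p)) = - xi.

Definition geometric_data (U : set M) (P : mvec M 2)
    (g : endo M) (sigma : dform M 2) (P02 : mvec M 2) : Prop :=
  [/\ connection U g, ker_is_image U g P,
      forall p, U p -> mvec_comp (g p) 0 2 (P p) = P02 p &
      coupling_form U g P sigma].

Definition poisson_connection (U : set M) (g : endo M) (P : mvec M 2) : Prop :=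
  connection U g /\
  forall u : vfield B, smooth_vfield setT u ->
    forall p, U p -> forall xi, lie (hor_vfield g u) P p xi = 0.

End Bundle.

Arguments form_bideg {R n M} U g p q a.
Arguments mvec_bideg {R n M} U g p q Q.

Section Triple.
Variables (R : realType) (M : manifold R 5) (B : manifold R 2) (pi : M -> B).
Variables (Omega : dform M 5) (omega : dform B 2).

Record splitting (g : endo M) (OmegaV : dform M 3) (QH : mvec M 2)
    (QV : mvec M 3) (psi : mvec B 2) : Prop := Splitting {
  OmegaV_bideg : form_bideg setT g 0 3 OmegaV;
  OmegaV_eq : forall p, Omega p = wedge (pullback pi omega p) (OmegaV p);
  QH_bideg : mvec_bideg setT g 2 0 QH;
  QH_eq : forall p, contract 0 (QH p) (pullback pi omega p) = (fun=> 1);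
  QV_bideg : mvec_bideg setT g 0 3 QV;
  QV_eq : forall p, contract 0 (QV p) (OmegaV p) = (fun=> 1);
  psi_mvec : is_mvec setT psi;
  psi_eq : forall b, contract 0 (psi b) (omega b) = (fun=> -1)
}.

Definition P_ (QV : mvec M 3) (beta : dform M 1) : mvec M 2 :=
  fun p xi => - ins (covec (beta p)) (QV p) xi.

(* For a of bidegree (p, q), d_(i,j) a is the component of bidegree
   (p + i, q + j) of d a; OmegaV has bidegree (0, 3), beta has bidegree (0, 1)
   and kappa has bidegree (0, 0). *)
Definition theta (g : endo M) (OmegaV : dform M 3) (QV : mvec M 3) : dform M 1 :=
  fun p v =>
    - contract 1 (QV p) (form_comp (g p) 1 3 (ext_d OmegaV p)) v.

Definition rho (g : endo M) (OmegaV : dform M 3) (QH : mvec M 2) : dform M 2 :=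
  fun p => contract 2 (QH p) (form_comp (g p) 2 2 (ext_d OmegaV p)).

Definition d01_beta (g : endo M) (beta : dform M 1) : dform M 2 :=
  fun p => form_comp (g p) 0 2 (ext_d beta p).
Definition d10_beta (g : endo M) (beta : dform M 1) : dform M 2 :=
  fun p => form_comp (g p) 1 1 (ext_d beta p).
Definition d01_fun (g : endo M) (kappa : M -> R) : dform M 1 :=
  fun p => form_comp (g p) 0 1 (ext_d (fun_form kappa) p).

Record poisson_triple (OmegaV : dform M 3) (QH : mvec M 2) (QV : mvec M 3)
    (g : endo M) (kappa : M -> R) (beta : dform M 1) : Prop := PoissonTriple {
  triple_connection : connection pi setT g;
  triple_smooth : smooth_fun setT kappa;
  triple_bideg : form_bideg setT g 0 1 beta;
  triple_03 : forall p v, wedge (d01_beta g beta p) (beta p) v = 0;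
  triple_12 : forall p v,
    kappa p * (d10_beta g beta p v -
               wedge (theta g OmegaV QV p) (beta p) v) = 0;
  triple_21 : forall p v,
    wedge (d01_fun g kappa p) (beta p) v - kappa p ^+ 2 * rho g OmegaV QH p v
    = 0
}.

Definition triple_tensor (QV : mvec M 3) (psi : mvec B 2)
    (g : endo M) (kappa : M -> R) (beta : dform M 1) : mvec M 2 :=
  fun p xi => kappa p * hor_mvec pi g psi p xi + P_ QV beta p xi.

End Triple.

(* Main.v *)
(* Fix a point p0, let y_1, y_2 be the coordinates of a chart of B pulled back to
   M, and let z_1, z_2, z_3 be linear functions in the chart of p0 whose
   differentials at p0 annihilate the horizontal space.  Write h_1, h_2 for the
   horizontal lifts of the coordinate fields, F = Q_H(dy_1, dy_2),
   A^k_j = dz_k(h_j) (zero at p0), q = Q_V(dz_1, dz_2, dz_3), and b_k for the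
   components of beta in the vertical coframe dz_k - sum_j A^k_j dy_j.  As
   hor psi = - Q_H, near p0
     {y_1, y_2} = - kappa F,  {y_1, z_k} = - kappa F A^k_2,
     {y_2, z_k} = kappa F A^k_1,
     {z_k, z_l} = - kappa F (A^k_1 A^l_2 - A^l_1 A^k_2) - q eps_(klm) b_m.
   The Jacobi identity at p0 for the triples (z, z, z), (y, z, z) and (y, y, z) is
   then, in this order, the first, second and third equation of a Poisson triple;
   since the Jacobiator is a derivation in each argument on C^2 functions, these
   triples suffice.  Where kappa does not vanish, it can be cancelled in the second
   equation, which becomes the invariance of P_beta under horizontal lifts.
   Everything else is linear algebra in the splitting TM = H + V, apart from (ii),
   which uses that the Jacobi identity is local, and (iii), which is the third
   equation at a zero of kappa. *)
Require Import Defs.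
From HB Require Import structures.
From mathcomp Require Import all_boot all_order all_algebra all_fingroup.
From mathcomp Require Import all_classical all_reals all_analysis.
From mathcomp Require Import ring.
Set Implicit Arguments.
Unset Strict Implicit.
Unset Printing Implicit Defensive.
Import Order.TTheory GRing.Theory Num.Theory.
Import numFieldNormedType.Exports.
Local Open Scope classical_set_scope.
Local Open Scope ring_scope.

(* These names are shadowed by MathComp-Analysis and by [vector]. *)
Local Notation alternating := Defs.alternating.
Local Notation contract := Defs.contract.
Local Notation coord := Defs.coord.

(** * Functions of class C^k *)

Section Calc.
Variable R : realType.
Implicit Types n m k : nat.

(** Tangent vectors at p are read in the chart chosen at p, and this choice need not be continuous
    in p; a tensor can therefore be differentiated only after passage to one fixed chart. The
    horizontal lift is moreover given pointwise through [pinvmx], which hides its smoothness. Hence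
    F, A, q and b are assembled from coefficients that are smooth by hypothesis, those of Q_H, Q_V,
    beta and omega and the chart expression of pi: A^k_j is a quotient of Q_H(dz_k, dy_i), up to
    order, by F, and b_m one of Q_V(beta, dz_k, dz_l) by q. As directions of differentiation, h_i
    and v_k are frozen at p0. Near p0, Omega_V is -1/q times the product of the three covectors of
    the vertical coframe. Since A vanishes at p0, its exterior derivative there involves only first
    derivatives of A and q: the divergence of A along the v_k, with the derivative of q, gives
    theta, and the skew derivative of A along h_1, h_2, which is the curvature, gives rho. The signs
    come from [contract], whose reversal of two or three vectors is odd: F is minus the inverse of
    the coefficient of omega. As F is pulled back from B, only kappa contributes to vertical
    derivatives of kappa F. *)

Lemma differentiable_rowP n m (f : 'rV[R]_n -> 'rV[R]_m) a :
  (forall j, differentiable (fun x => f x 0 j) a) -> differentiable f a.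
Proof.
move=> df.
have -> : f = \sum_(j < m) (fun x => f x 0 j *: evec R j).
  by apply/funext => x; rewrite fct_sumE {1}(row_sum_delta (f x)).
apply: differentiable_sum => j.
exact: (@differentiableZl _ _ _ (fun x => f x 0 j) (evec R j)).
Qed.

Lemma derive_entry n m (f : 'rV[R]_n -> 'rV[R]_m) a v j :
  differentiable f a -> 'D_v f a 0 j = 'D_v (fun x => f x 0 j) a.
Proof. by move=> df; rewrite derive_mx ?mxE//; exact: diff_derivable. Qed.

Lemma derive_basis n (W : normedModType R) (f : 'rV[R]_n -> W) a v :
  differentiable f a -> 'D_v f a = \sum_i v 0 i *: 'D_(evec R i) f a.
Proof.
move=> df; rewrite deriveE// {1}(row_sum_delta v) linear_sum.
by apply: eq_bigr => i _; rewrite linearZ (deriveE _ df).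
Qed.

Lemma derive_comp (U V W : normedModType R) (p : U -> V) (f : V -> W) a v :
  differentiable p a -> differentiable f (p a) ->
  'D_v (f \o p) a = 'D_('D_v p a) f (p a).
Proof.
move=> dp df.
rewrite (deriveE _ (differentiable_comp dp df)) (diff_comp dp df) /=.
by rewrite (deriveE _ df) (deriveE _ dp).
Qed.

Lemma derive_comp_sum n m (p : 'rV[R]_n -> 'rV[R]_m) (f : 'rV[R]_m -> R) a v :
  differentiable p a -> differentiable f (p a) ->
  'D_v (f \o p) a =
  \sum_j 'D_v (fun x => p x 0 j) a * 'D_(evec R j) f (p a).
Proof.
move=> dp df; rewrite derive_comp// derive_basis//.
by apply: eq_bigr => j _; rewrite derive_entry.
Qed.

Lemma jacobianE n m (f : 'rV[R]_n -> 'rV[R]_m) a i j :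
  differentiable f a -> jacobian f a i j = 'D_(evec R i) (fun x => f x 0 j) a.
Proof.
move=> df; rewrite -(derive_entry _ _ df) (deriveEjacobian _ df).
by rewrite -rowE [RHS]mxE.
Qed.

Lemma jacobian_comp n m l (p : 'rV[R]_n -> 'rV[R]_m) (f : 'rV[R]_m -> 'rV[R]_l) a :
  differentiable p a -> differentiable f (p a) ->
  jacobian (f \o p) a = jacobian p a *m jacobian f (p a).
Proof.
move=> dp df; apply/row_matrixP => i; rewrite row_mul !rowE.
rewrite -(deriveEjacobian _ dp) -(deriveEjacobian _ df).
by rewrite -(deriveEjacobian _ (differentiable_comp dp df)) (derive_comp _ dp df).
Qed.

(** The little-o expansion of [f] at [a] only sees values near [a], so it is also one of [h];
    uniqueness of the differential then identifies the two differentials. *)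
Lemma near_eq_differentiable (V W : normedModType R) (f h : V -> W) a :
  {near a, f =1 h} -> differentiable f a -> differentiable h a.
Proof.
move=> fh df; have cf := diff_continuous df.
have ha : h a = f a by rewrite (nbhs_singleton fh).
have dl : h \o shift a = cst (h a) + 'd f a +o_ (0 : V) id.
  apply/eqaddoP => e e0; have /eqaddoP/(_ e e0) := diff_locally df.
  have : \forall u \near (0 : V), f (u + a) = h (u + a).
    have := fh; rewrite (near_shift 0 a) /=.
    by apply: filterS => u; rewrite /= subr0.
  by apply: filterS2 => u H; rewrite /= !fctE /= H ha.
have e : 'd h a = 'd f a :> (V -> W) by apply: diff_unique.
by apply/diff_locallyP; rewrite e.
Unshelve. all: by end_near. Qed.

Lemma Ck_sub n k (U W : set 'rV[R]_n) f : W `<=` U -> Ck k U f -> Ck k W f.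
Proof.
move=> WU; elim: k f => [|k IH] f /=; first by move=> h x /WU/h.
by move=> [h1 h2]; split=> [x /WU/h1//|i]; exact/IH.
Qed.

Lemma Ck_pred n k (U : set 'rV[R]_n) f : Ck k.+1 U f -> Ck k U f.
Proof.
elim: k f => [|k IH] f /= [h1 h2]; first by move=> x /h1/differentiable_continuous.
by split=> // i; apply: IH.
Qed.

Lemma open_near (T : topologicalType) (W : set T) x : open W -> W x ->
  \forall z \near x, W z.
Proof. by move=> oW Wx; apply: open_nbhs_nbhs. Qed.

Lemma near_eq_continuous (S T : topologicalType) (f h : S -> T) a :
  {near a, f =1 h} -> {for a, continuous f} -> {for a, continuous h}.
Proof.
move=> fh cf; rewrite /prop_for /continuous_at -(nbhs_singleton fh).
by apply: cvg_trans cf; apply: near_eq_cvg.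
Qed.

(** The derivatives in [Ck] are those of the ambient space, so near each point [f] may be replaced
    by any formula that agrees with it there. The formula may change with the point, as happens for
    the coupling form, whose expression needs a chart of the base. *)
Lemma Ck_local n k (U : set 'rV[R]_n) f :
  (forall x, U x -> exists W f', [/\ open W, W x,
     (forall z, W z -> f' z = f z) & Ck k W f']) -> Ck k U f.
Proof.
elim: k f => [|k IH] f /= h.
  move=> x /h[W [f' [oW Wx e c]]].
  by apply: near_eq_continuous (c x Wx); apply: filterS (open_near oW Wx).
split=> [x /h[W [f' [oW Wx e [c _]]]]|i].
  apply: near_eq_differentiable (c x Wx).
  by apply: filterS (open_near oW Wx).
apply: IH => x /h[W [f' [oW Wx e [_ c]]]].
exists W, (fun z => 'D_(evec R i) f' z); split => // z Wz.
apply: near_eq_derive; by apply: filterS (open_near oW Wz).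
Qed.

Lemma Ck_ext n k (U : set 'rV[R]_n) f f' : open U ->
  (forall z, U z -> f' z = f z) -> Ck k U f' -> Ck k U f.
Proof. by move=> oU e c; apply: Ck_local => x Ux; exists U, f'; split. Qed.

Lemma Ck_cst n k (U : set 'rV[R]_n) (c : R) : Ck k U (fun=> c).
Proof.
elim: k c => [|k IH] c /=; first by move=> x _; apply: cst_continuous.
split=> [x _|i]; first exact: differentiable_cst.
have -> : (fun x => 'D_(evec R i) (fun=> c) x) = fun=> 0.
  by apply/funext => x; exact: derive_cst.
exact: IH.
Qed.

Lemma Ck_add n k (U : set 'rV[R]_n) f f' : open U -> Ck k U f -> Ck k U f' ->
  Ck k U (fun x => f x + f' x).
Proof.
move=> oU; elim: k f f' => [|k IH] f f' /=.
  by move=> h h' x Ux; apply: continuousD; [exact: h|exact: h'].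
move=> [d h] [d' h']; split=> [x Ux|i].
  by apply: differentiableD; [exact: d|exact: d'].
apply: Ck_ext (IH _ _ (h i) (h' i)) => // z Uz.
by rewrite deriveD//; apply: diff_derivable; [exact: d|exact: d'].
Qed.

Lemma Ck_mul n k (U : set 'rV[R]_n) f f' : open U -> Ck k U f -> Ck k U f' ->
  Ck k U (fun x => f x * f' x).
Proof.
move=> oU; elim: k f f' => [|k IH] f f'.
  by move=> h h' x Ux; apply: continuousM; [exact: h|exact: h'].
move=> c c'; have [d h] := c; have [d' h'] := c'; split=> [x Ux|i].
  by apply: differentiableM; [exact: d|exact: d'].
have := Ck_add oU (IH _ _ (Ck_pred c) (h' i)) (IH _ _ (Ck_pred c') (h i)).
apply: Ck_ext => // z Uz.
by rewrite deriveM//; apply: diff_derivable; [exact: d|exact: d'].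
Qed.

Lemma Ck_inv n k (U : set 'rV[R]_n) f : open U -> (forall x, U x -> f x != 0) ->
  Ck k U f -> Ck k U (fun x => (f x)^-1).
Proof.
move=> oU nz; elim: k => [|k IH].
  by move=> h x Ux; apply: continuousV; [exact: nz|exact: h].
move=> c; have [d h] := c; split=> [x Ux|i].
  by apply: differentiableV; [exact: d|exact: nz].
have ck := IH (Ck_pred c).
have := Ck_mul oU (@Ck_cst _ k U (-1)) (Ck_mul oU (Ck_mul oU ck ck) (h i)).
apply: Ck_ext => // z Uz.
rewrite deriveV; [|exact: nz|exact/diff_derivable/d].
by rewrite -exprVn expr2 scaleNr mulN1r.
Qed.

Lemma Ck_sum n k (U : set 'rV[R]_n) (I : Type) (r : seq I) (P : pred I) F :
  open U -> (forall i, P i -> Ck k U (F i)) ->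
  Ck k U (fun x => \sum_(i <- r | P i) F i x).
Proof.
move=> oU h; elim: r => [|a r IH].
  by apply: (Ck_ext oU _ (@Ck_cst n k U 0)) => z _; rewrite big_nil.
case Pa: (P a); last by apply: (Ck_ext oU _ IH) => z _; rewrite big_cons Pa.
by apply: (Ck_ext oU _ (Ck_add oU (h a Pa) IH)) => z _; rewrite big_cons Pa.
Qed.

Lemma Ck_comp n m k (U : set 'rV[R]_n) (W : set 'rV[R]_m) p f :
  open U -> (forall x, U x -> W (p x)) ->
  (forall k' j, Ck k' U (fun x => p x 0 j)) -> Ck k W f -> Ck k U (f \o p).
Proof.
move=> oU UW cp.
have dp x : U x -> differentiable p x.
  by move=> Ux; apply: differentiable_rowP => j; have [d _] := cp 1%N j; exact: d.
elim: k f => [|k IH] f.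
  move=> h x Ux; apply: continuous_comp; last by apply: h; exact: UW.
  exact/differentiable_continuous/dp.
move=> [d h]; split=> [x Ux|i].
  by apply: differentiable_comp; [exact: dp|apply: d; exact: UW].
have : Ck k U (fun x => \sum_j 'D_(evec R i) (fun x => p x 0 j) x *
                          ('D_(evec R j) f (p x))).
  apply: Ck_sum => // j _; apply: Ck_mul => //; last exact: (IH _ (h j)).
  by have [_] := cp k.+1 j; exact.
apply: Ck_ext => // z Uz; rewrite derive_comp_sum//; [exact: dp|apply: d; exact: UW].
Qed.

Lemma derive_coord n (u a : 'rV[R]_n) j : 'D_u (fun x : 'rV[R]_n => x 0 j) a = u 0 j.
Proof.
have d : differentiable (id : 'rV[R]_n -> 'rV[R]_n) a by case: (is_diff_id a).
by rewrite -(derive_entry u j d) derive_id. Qed.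

End Calc.

(** * Symmetry of second derivatives *)

Section Schwarz.
Variable R : realType.

Lemma is_derive_line (V : normedModType R) (f : V -> R) (a u : V) (s : R) :
  differentiable f (a + s *: u) ->
  is_derive s 1 (fun s : R => f (a + s *: u)) ('D_u f (a + s *: u)).
Proof.
move=> df.
have dp : is_derive s 1 (fun s : R => a + s *: u) u.
  have := @is_deriveD R R V (cst a) (fun s : R => s *: u) s 1 0 u.
  rewrite add0r; apply => //.
  have := @is_diff_scalel R V s u => -[d e].
  apply: DeriveDef; first exact: diff_derivable.
  by rewrite (deriveE _ d) e scale1r.
have ddp : differentiable (fun s : R => a + s *: u) s.
  by apply/derivable1_diffP; case: dp.
have dc := @differentiable_comp _ _ _ _ (fun s : R => a + s *: u) f s ddp df.
apply: DeriveDef; first exact: diff_derivable dc.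
have := @derive_comp _ _ _ _ (fun s : R => a + s *: u) f s _ ddp df.
by move=> ->; case: dp => _ ->.
Qed.

Lemma mvt_line (V : normedModType R) (f : V -> R) (a u : V) (h : R) :
  0 < h -> (forall s, 0 <= s <= h -> differentiable f (a + s *: u)) ->
  exists2 c, 0 <= c <= h & f (a + h *: u) - f a = 'D_u f (a + c *: u) * h.
Proof.
move=> h0 df; pose p (s : R) := f (a + s *: u).
have [||c] := @MVT R p (fun s => 'D_u f (a + s *: u)) 0 h h0.
- move=> x; rewrite in_itv /= => /andP[x0 xh]; apply: is_derive_line.
  by apply: df; rewrite !ltW.
- apply: derivable_within_continuous => x; rewrite in_itv /= => xh.
  by case: (is_derive_line (df x xh)).
rewrite in_itv /= => /andP[c0 ch]; rewrite /p scale0r addr0 subr0 => e.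
by exists c => //; rewrite !ltW.
Qed.

(** The mean value theorem twice: along [u] for the increment of [f] by [h *: v], then along [v] for
    ['D_u f]. *)
Lemma second_difference (V : normedModType R) (f : V -> R) (a u v : V) (h : R) :
  0 < h ->
  (forall s t, 0 <= s <= h -> 0 <= t <= h ->
    differentiable f (a + s *: u + t *: v) /\
    differentiable ('D_u f) (a + s *: u + t *: v)) ->
  exists s t, [/\ 0 <= s <= h, 0 <= t <= h &
    f (a + h *: u + h *: v) - f (a + h *: u) - (f (a + h *: v) - f a) =
    'D_v ('D_u f) (a + s *: u + t *: v) * h * h].
Proof.
move=> h0 df.
have hh : 0 <= h <= h by rewrite lexx ltW.
have h00 : (0 : R) <= 0 <= h by rewrite lexx ltW.
pose p z := f (z + h *: v) - f z.
have dsh z : differentiable (fun z : V => z + h *: v) z.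
  by apply: differentiableD; [case: (is_diff_id z)|exact: differentiable_cst].
have D1 s : 0 <= s <= h ->
    differentiable (fun z : V => f (z + h *: v)) (a + s *: u) /\
    'D_u (fun z : V => f (z + h *: v)) (a + s *: u) =
    'D_u f (a + s *: u + h *: v).
  move=> hs; have [d _] := df s h hs hh.
  split; first exact: (differentiable_comp (dsh _) d).
  rewrite (derive_comp _ (dsh _) d); congr ('D_ _ f _).
  rewrite deriveD ?derive_id.
  - by rewrite derive_cst addr0.
  - by apply: diff_derivable; case: (is_diff_id (a + s *: u)).
  - exact: derivable_cst.
have D0 s : 0 <= s <= h -> differentiable f (a + s *: u).
  by move=> hs; have [] := df s 0 hs h00; rewrite scale0r addr0.
have [|s hs es] := @mvt_line V p a u h h0.
  by move=> s hs; apply: differentiableB; [case: (D1 s hs)|exact: D0].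
have [|t ht et] := @mvt_line V ('D_u f) (a + s *: u) v h h0.
  by move=> t ht; case: (df s t hs ht).
exists s, t; split => //.
rewrite -et; have -> : f (a + h *: u + h *: v) - f (a + h *: u) - (f (a + h *: v) - f a) = p (a + h *: u) - p a by [].
rewrite es; congr (_ * _).
have [d e] := D1 s hs; rewrite -e /p deriveB //; apply: diff_derivable => //; exact: D0.
Qed.

Lemma diff_swap (x y z t : R) : x - y - (z - t) = x - z - (y - t).
Proof. by ring. Qed.

Lemma dist_half (x y z z' e : R) :
  z = z' -> `|x - z| < e / 2 -> `|y - z'| < e / 2 -> `|x - y| <= e.
Proof.
move=> <- B1 B2; rewrite -(subrKA z) (le_trans (ler_normD _ _))//.
by rewrite [leRHS]splitr lerD ?ltW// distrC.
Qed.

(* The second difference f(a+hu+hv) - f(a+hu) - f(a+hv) + f(a) is symmetric in u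
   and v, and divided by h^2 it tends to each of the two mixed derivatives. *)
Lemma schwarz (V : normedModType R) (f : V -> R) (U : set V) (a u v : V) :
  open U -> U a ->
  (forall z, U z -> differentiable f z) ->
  (forall z, U z -> differentiable ('D_u f) z) ->
  (forall z, U z -> differentiable ('D_v f) z) ->
  {for a, continuous ('D_v ('D_u f))} -> {for a, continuous ('D_u ('D_v f))} ->
  'D_v ('D_u f) a = 'D_u ('D_v f) a.
Proof.
move=> oU Ua df du dv cu cv.
apply/eqP; rewrite -subr_eq0 -normr_le0; apply/ler_addgt0Pl => e e0; rewrite addr0.
have e2 : 0 < e / 2 by rewrite divr_gt0.
have h1 : nbhs a U by exact: open_near.
have h2 : nbhs a [set z | `|'D_v ('D_u f) a - 'D_v ('D_u f) z| < e / 2].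
  by move/cvgrPdist_lt : cu => /(_ _ e2).
have h3 : nbhs a [set z | `|'D_u ('D_v f) a - 'D_u ('D_v f) z| < e / 2].
  by move/cvgrPdist_lt : cv => /(_ _ e2).
have /nbhs_ballP[r /= r0] :
    nbhs a (U `&` ([set z | `|'D_v ('D_u f) a - 'D_v ('D_u f) z| < e / 2] `&`
                   [set z | `|'D_u ('D_v f) a - 'D_u ('D_v f) z| < e / 2])).
  by apply: filterI => //; apply: filterI.
rewrite -ball_normE => hr.
(* The summand 1 makes the denominator positive even for u = v = 0, and makes s|u| + t|v| strictly
   smaller than r. *)
pose h := r / (`|u| + `|v| + 1).
have k0 : 0 < `|u| + `|v| + 1 by rewrite ltr_wpDl ?addr_ge0.
have h0 : 0 < h by rewrite divr_gt0.
have inb s t : 0 <= s <= h -> 0 <= t <= h -> `|a - (a + s *: u + t *: v)| < r.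
  move=> /andP[s0 sh] /andP[t0 th].
  rewrite -addrA opprD addrA subrr add0r normrN (le_lt_trans (ler_normD _ _))//.
  rewrite !normrZ !ger0_norm//.
  have : s * `|u| + t * `|v| <= h * (`|u| + `|v|).
    by rewrite mulrDr lerD// ler_wpM2r.
  move=> /le_lt_trans; apply; rewrite /h mulrAC ltr_pdivrMr// ltr_pM2l//.
  by rewrite ltrDl.
have [|s [t [hs ht e1]]] := @second_difference V f a u v h h0.
  by move=> s t hs ht; have [Uz _] := hr _ (inb s t hs ht); split; [exact: df|exact: du].
have inb' s' t' : 0 <= s' <= h -> 0 <= t' <= h -> `|a - (a + s' *: v + t' *: u)| < r.
  by move=> hs' ht'; rewrite addrAC; exact: inb.
have [|s' [t' [hs' ht' e1']]] := @second_difference V f a v u h h0.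
  by move=> s' t' hs' ht'; have [Uz _] := hr _ (inb' s' t' hs' ht'); split; [exact: df|exact: dv].
have [_ [B1 _]] := hr _ (inb s t hs ht).
have [_ [_ B2]] := hr _ (inb' s' t' hs' ht').
have E : 'D_v ('D_u f) (a + s *: u + t *: v) = 'D_u ('D_v f) (a + s' *: v + t' *: u).
  apply: (mulIf (lt0r_neq0 h0)); apply: (mulIf (lt0r_neq0 h0)).
  apply: etrans (esym e1) _; apply: etrans _ e1'.
  rewrite (addrAC a); exact: diff_swap.
exact: dist_half E B1 B2.
Qed.

End Schwarz.

(** * Brackets of functions on R^n *)

Section LocalBrackets.
Variables (R : realType) (n : nat).
Local Notation V := 'rV[R]_n.
Implicit Types (f g h : V -> R) (a : V).

Definition pd (i : 'I_n) f : V -> R := 'D_(evec R i) f.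

(** Weaker than C^2 and stated at a single point: this is what the cancellation of second
    derivatives at [a] needs. Smooth functions satisfy it by [schwarz]. *)
Definition twice_diff f a :=
  (forall i, differentiable (pd i f) a) /\
  (forall i j, pd i (pd j f) a = pd j (pd i f) a).

Lemma derD f g a u : differentiable f a -> differentiable g a ->
  'D_u (fun x => f x + g x) a = 'D_u f a + 'D_u g a.
Proof. by move=> df dg; apply: deriveD; exact: diff_derivable. Qed.

Lemma derM f g a u : differentiable f a -> differentiable g a ->
  'D_u (fun x => f x * g x) a = 'D_u f a * g a + f a * 'D_u g a.
Proof.
move=> df dg; rewrite addrC [X in _ + X]mulrC.
by apply: deriveM; exact: diff_derivable.
Qed.

Lemma derN f a u : differentiable f a ->
  'D_u (fun x => - f x) a = - 'D_u f a.
Proof. by move=> df; apply: deriveN; exact: diff_derivable. Qed.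

Lemma diff_sum (I : Type) (r : seq I) (P : pred I) (F : I -> V -> R) a :
  (forall i, P i -> differentiable (F i) a) ->
  differentiable (fun x => \sum_(i <- r | P i) F i x) a.
Proof.
move=> dF; elim: r => [|i r IH].
  rewrite (_ : (fun x => _) = cst 0); first exact: differentiable_cst.
  by apply/funext => x; rewrite big_nil.
case Pi : (P i).
  rewrite (_ : (fun x => _) = (fun x => F i x + \sum_(i <- r | P i) F i x)).
    by apply: differentiableD => //; exact: dF.
  by apply/funext => x; rewrite big_cons Pi.
rewrite (_ : (fun x => _) = (fun x => \sum_(i <- r | P i) F i x)) //.
by apply/funext => x; rewrite big_cons Pi.
Qed.

Lemma der_sum (I : Type) (r : seq I) (P : pred I) (F : I -> V -> R) a u :
  (forall i, P i -> differentiable (F i) a) ->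
  'D_u (fun x => \sum_(i <- r | P i) F i x) a = \sum_(i <- r | P i) 'D_u (F i) a.
Proof.
move=> dF; elim: r => [|i r IH].
  rewrite (_ : (fun x => _) = cst 0); last by apply/funext => x; rewrite big_nil.
  by rewrite big_nil derive_cst.
rewrite big_cons; case Pi : (P i).
  rewrite (_ : (fun x => _) = (fun x => F i x + \sum_(i <- r | P i) F i x)).
    by rewrite derD ?IH//; [exact: dF|exact: diff_sum].
  by apply/funext => x; rewrite big_cons Pi.
rewrite (_ : (fun x => _) = (fun x => \sum_(i <- r | P i) F i x)) //.
by apply/funext => x; rewrite big_cons Pi.
Qed.

Lemma Csmooth_twice_diff (U : set V) f a : open U -> U a -> Csmooth U f ->
  twice_diff f a.
Proof.
move=> oU Ua cf; split=> [i|i j].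
  by have [_ c] := cf 2%N; have [d _] := c i; exact: d.
have [d c] := cf 2%N.
apply: (schwarz oU Ua) => [z Uz|z Uz|z Uz||]; first exact: d.
- by have [d' _] := c j; exact: d'.
- by have [d' _] := c i; exact: d'.
- by have [_ c'] := c j; exact: c'.
- by have [_ c'] := c i; exact: c'.
Qed.

Lemma pairingE (v : V) (xi : 'cV[R]_n) : pairing v xi = \sum_i v 0 i * xi i 0.
Proof. by rewrite /pairing mxE. Qed.

Lemma derive_pairing (xi : 'cV[R]_n) a u :
  'D_u (fun x => pairing x xi) a = pairing u xi.
Proof.
rewrite (_ : (fun x => _) = (fun x : V => \sum_i x 0 i * xi i 0)); last first.
  by apply/funext => x; rewrite pairingE.
rewrite der_sum => [|i _]; last first.
  apply: differentiableM; last exact: differentiable_cst.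
  exact: differentiable_coord.
rewrite pairingE; apply: eq_bigr => i _.
rewrite derM; [|exact: differentiable_coord|exact: differentiable_cst].
by rewrite derive_coord derive_cst mulr0 addr0.
Qed.

Lemma pairing_evec i (xi : 'cV[R]_n) : pairing (evec R i) xi = xi i 0.
Proof. by rewrite /pairing -rowE mxE. Qed.

Lemma pd_pairing i (xi : 'cV[R]_n) : pd i (fun x => pairing x xi) = fun=> xi i 0.
Proof. by apply/funext => x; rewrite /pd derive_pairing pairing_evec. Qed.

Lemma twice_diff_pairing (xi : 'cV[R]_n) a : twice_diff (fun x => pairing x xi) a.
Proof.
split=> [i|i j]; rewrite !pd_pairing; first exact: differentiable_cst.
by rewrite /pd !derive_cst.
Qed.

Definition brk (P : 'I_n -> 'I_n -> V -> R) f g : V -> R :=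
  fun x => \sum_i \sum_j P i j x * pd i f x * pd j g x.

Definition vder (X : 'I_n -> V -> R) f : V -> R := fun x => \sum_k X k x * pd k f x.

(** The Leibniz expansion of (L_X P)(df, dg) at a point, with the values of all derivatives as free
    variables. Each Hessian arises twice, from differentiating the bracket along X and from the
    gradient of X f or X g, with its indices exchanged; by symmetry it cancels, and a tensor
    remains. *)
Lemma lie_algebraic (X f g : 'I_n -> R) (dX P Hf Hg : 'I_n -> 'I_n -> R)
    (dP : 'I_n -> 'I_n -> 'I_n -> R) :
  (forall i j, Hf i j = Hf j i) -> (forall i j, Hg i j = Hg j i) ->
  \sum_k X k * (\sum_i \sum_j (dP k i j * f i * g j + P i j * Hf k i * g j
                                + P i j * f i * Hg k j))
  - \sum_i \sum_j P i j * (\sum_l (dX i l * f l + X l * Hf i l)) * g j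
  - \sum_i \sum_j P i j * f i * (\sum_l (dX j l * g l + X l * Hg j l))
  = \sum_i \sum_j (\sum_k (X k * dP k i j - P k j * dX k i - P i k * dX k j)) *
      f i * g j.
Proof.
move=> sf sg.
have -> : \sum_k X k * (\sum_i \sum_j (dP k i j * f i * g j + P i j * Hf k i * g j
                                + P i j * f i * Hg k j)) =
  \sum_i \sum_j \sum_k (X k * dP k i j * f i * g j + P i j * X k * Hf i k * g j
      + P i j * f i * X k * Hg j k).
  under eq_bigr do rewrite mulr_sumr.
  rewrite exchange_big; apply: eq_bigr => i _.
  under eq_bigr do rewrite mulr_sumr.
  rewrite exchange_big; apply: eq_bigr => j _.
  by apply: eq_bigr => k _; rewrite (sf i) (sg j); ring.
have -> : \sum_i \sum_j P i j * (\sum_l (dX i l * f l + X l * Hf i l)) * g j =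
  \sum_i \sum_j \sum_k (P k j * dX k i * f i * g j) +
  \sum_i \sum_j \sum_k P i j * X k * Hf i k * g j.
  have -> : \sum_i \sum_j \sum_k (P k j * dX k i * f i * g j) =
    \sum_k \sum_j \sum_i (P k j * dX k i * f i * g j).
    rewrite exchange_big [RHS]exchange_big; apply: eq_bigr => j _.
    by rewrite exchange_big.
  rewrite -big_split; apply: eq_bigr => i _; rewrite -big_split.
  apply: eq_bigr => j _; rewrite -big_split mulr_sumr mulr_suml.
  by apply: eq_bigr => k _ /=; ring.
have -> : \sum_i \sum_j P i j * f i * (\sum_l (dX j l * g l + X l * Hg j l)) =
  \sum_i \sum_j \sum_k (P i k * dX k j * f i * g j) +
  \sum_i \sum_j \sum_k P i j * f i * X k * Hg j k.
  have -> : \sum_i \sum_j \sum_k (P i k * dX k j * f i * g j) =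
    \sum_i \sum_k \sum_j (P i k * dX k j * f i * g j).
    by apply: eq_bigr => i _; rewrite exchange_big.
  rewrite -big_split; apply: eq_bigr => i _; rewrite -big_split.
  apply: eq_bigr => j _; rewrite -big_split mulr_sumr.
  by apply: eq_bigr => k _ /=; ring.
rewrite -!big_split -!sumrB; apply: eq_bigr => i _.
rewrite -!big_split -!sumrB; apply: eq_bigr => j _.
rewrite -!big_split -!sumrB !mulr_suml; apply: eq_bigr => k _ /=.
by ring.
Qed.

Lemma lie_tensorial (X : 'I_n -> V -> R) (P : 'I_n -> 'I_n -> V -> R) a :
  (forall i, differentiable (X i) a) -> (forall i j, differentiable (P i j) a) ->
  forall f g, twice_diff f a -> twice_diff g a ->
  vder X (brk P f g) a - brk P (vder X f) g a - brk P f (vder X g) a =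
  \sum_i \sum_j (\sum_k (X k a * pd k (P i j) a - P k j a * pd k (X i) a
                          - P i k a * pd k (X j) a)) * pd i f a * pd j g a.
Proof.
move=> dX dP f g [df sf] [dg sg].
rewrite -(@lie_algebraic (X^~ a) (pd^~ f ^~ a) (pd^~ g ^~ a)
   (fun k i => pd k (X i) a) (fun i j => P i j a)
   (fun i j => pd i (pd j f) a) (fun i j => pd i (pd j g) a)
   (fun k i j => pd k (P i j) a)) //.
have vd h i : (forall i, differentiable (pd i h) a) ->
  pd i (vder X h) a = \sum_l (pd i (X l) a * pd l h a + X l a * pd i (pd l h) a).
  move=> dh; rewrite [LHS]der_sum => [|l _]; last exact: differentiableM.
  by apply: eq_bigr => l _; rewrite derM.
congr (_ - _ - _).
- apply: eq_bigr => k _; congr (_ * _).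
  rewrite [LHS]der_sum => [|i _]; last first.
    by apply: diff_sum => j _; do 2! apply: differentiableM => //.
  apply: eq_bigr => i _; rewrite der_sum => [|j _]; last first.
    by do 2! apply: differentiableM => //.
  apply: eq_bigr => j _; rewrite derM //; last exact: differentiableM.
  by rewrite derM // mulrDl.
- by apply: eq_bigr => i _; apply: eq_bigr => j _; rewrite vd.
- by apply: eq_bigr => i _; apply: eq_bigr => j _; rewrite vd.
Qed.

(** In matrix form the hypothesis reads E^T L E = 0 with E the invertible Jacobian of [c]. *)
Lemma bilinear_zero (L : 'I_n -> 'I_n -> R) (c : 'I_n -> V -> R) a :
  (\matrix_(i, j) pd i (c j) a) \in unitmx ->
  (forall s t, \sum_i \sum_j L i j * pd i (c s) a * pd j (c t) a = 0) ->
  forall i j, L i j = 0.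
Proof.
set E := \matrix_(i, j) _ => uE h.
pose M := \matrix_(i, j) L i j.
have e : E^T *m M *m E = 0.
  apply/matrixP => s t; rewrite mxE [RHS]mxE; apply: etrans (h s t).
  rewrite [RHS]exchange_big /=.
   apply: eq_bigr => j _; rewrite !mxE mulr_suml; apply: eq_bigr => i _.
  by rewrite !mxE [pd i _ _ * _]mulrC.
have M0 : M = 0.
  have := congr1 (mulmx (invmx E^T)) (congr1 (mulmxr (invmx E)) e).
  by rewrite /= mulmxK// mul0mx mulmx0 mulKmx ?unitmx_tr.
by move=> i j; have := congr1 (fun A : 'M[R]_n => A i j) M0; rewrite !mxE.
Qed.

(** Since L_X P is a tensor, it suffices to test it on functions whose differentials form a basis.
    This serves twice: with X a Hamiltonian field for the Jacobi identity, and with X a horizontal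
    lift for the Poisson connection. *)
Lemma lie_zero (X : 'I_n -> V -> R) (P : 'I_n -> 'I_n -> V -> R)
    (c : 'I_n -> V -> R) a :
  (forall i, differentiable (X i) a) -> (forall i j, differentiable (P i j) a) ->
  (forall i, twice_diff (c i) a) ->
  (\matrix_(i, j) pd i (c j) a) \in unitmx ->
  (forall s t, vder X (brk P (c s) (c t)) a - brk P (vder X (c s)) (c t) a -
     brk P (c s) (vder X (c t)) a = 0) ->
  forall f g, twice_diff f a -> twice_diff g a ->
  vder X (brk P f g) a - brk P (vder X f) g a - brk P f (vder X g) a = 0.
Proof.
move=> dX dP dc uE h f g df dg; rewrite lie_tensorial//.
rewrite big1 // => i _; rewrite big1 // => j _.
pose L i j := \sum_k (X k a * pd k (P i j) a - P k j a * pd k (X i) a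
                      - P i k a * pd k (X j) a).
rewrite -/(L i j) (bilinear_zero (L := L) uE) ?mul0r// => s t.
exact: etrans (esym (lie_tensorial dX dP (dc s) (dc t))) (h s t).
Qed.

Lemma vder_near X f g a : {near a, f =1 g} -> vder X f a = vder X g a.
Proof. by move=> e; apply: eq_bigr => i _; congr (_ * _); exact: near_eq_derive. Qed.

Definition jacobiator P f g h a :=
  brk P f (brk P g h) a + brk P g (brk P h f) a + brk P h (brk P f g) a.

Lemma jacobiator_rot P f g h a : jacobiator P f g h a = jacobiator P g h f a.
Proof.
rewrite /jacobiator; move: (brk P f _ a) (brk P g _ a) (brk P h _ a) => x y z.
by rewrite -addrA addrC.
Qed.

Section Antisymmetric.
Variables (P : 'I_n -> 'I_n -> V -> R) (a : V).
Hypothesis dP : forall i j, differentiable (P i j) a.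
Hypothesis antiP : \forall x \near a, forall i j, P i j x = - P j i x.

Lemma brk_antisym f g : \forall x \near a, brk P f g x = - brk P g f x.
Proof.
apply: filterS antiP => x aP; rewrite /brk exchange_big -sumrN.
apply: eq_bigr => j _; rewrite -sumrN; apply: eq_bigr => i _.
by rewrite aP; ring.
Qed.

Lemma brk_near g h k : {near a, g =1 h} -> brk P k g a = brk P k h a.
Proof.
move=> e; apply: eq_bigr => i _; apply: eq_bigr => j _; congr (_ * _).
exact: near_eq_derive.
Qed.

Lemma brk_oppr f g : differentiable g a ->
  brk P f (fun x => - g x) a = - brk P f g a.
Proof.
move=> dg; rewrite -sumrN; apply: eq_bigr => i _; rewrite -sumrN.
by apply: eq_bigr => j _; rewrite /pd derN// mulrN.
Qed.

Lemma differentiable_brk f g : twice_diff f a -> twice_diff g a ->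
  differentiable (brk P f g) a.
Proof.
move=> [df _] [dg _]; apply: diff_sum => i _; apply: diff_sum => j _.
by do 2! apply: differentiableM => //.
Qed.

Lemma brk_flip f g h : twice_diff g a -> twice_diff h a ->
  brk P f (brk P g h) a = - brk P f (brk P h g) a.
Proof.
move=> dg dh; rewrite -brk_oppr; last exact: differentiable_brk.
exact/brk_near/brk_antisym.
Qed.

Lemma jacobiator_swap f g h : twice_diff f a -> twice_diff g a -> twice_diff h a ->
  jacobiator P g f h a = - jacobiator P f g h a.
Proof.
move=> df dg dh; rewrite /jacobiator (brk_flip _ df dh) (brk_flip _ dh dg).
rewrite (brk_flip _ dg df).
move: (brk P f _ a) (brk P g _ a) (brk P h _ a) => x y z; ring.
Qed.

Lemma jacobiator_diag f h : twice_diff f a -> twice_diff h a ->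
  jacobiator P f f h a = 0.
Proof.
move=> df dh; apply/eqP; have := jacobiator_swap df df dh => /eqP.
by rewrite -addr_eq0 -mulr2n mulrn_eq0.
Qed.

Lemma jacobiator_lie f g h : twice_diff f a -> twice_diff g a -> twice_diff h a ->
  let X k x := \sum_i P i k x * pd i f x in
  jacobiator P f g h a =
  vder X (brk P g h) a - brk P (vder X g) h a - brk P g (vder X h) a.
Proof.
move=> df dg dh X.
have XE k x : vder X k x = brk P f k x.
  rewrite /vder /brk exchange_big; apply: eq_bigr => j _.
  by rewrite /X mulr_suml.
have XE' k : vder X k = brk P f k by apply/funext => x.
rewrite !XE' /jacobiator (brk_flip _ dh df).
have -> : brk P (brk P f g) h a = - brk P h (brk P f g) a.
  exact: (nbhs_singleton (brk_antisym _ _)).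
move: (brk P f _ a) (brk P g _ a) (brk P h _ a) => x y z; ring.
Qed.

(* With two arguments fixed the Jacobiator is the Lie derivative of P along the
   Hamiltonian field of the third, hence tensorial by [lie_zero]. *)
Lemma jacobi_from_coordinates (c : 'I_n -> V -> R) :
  (forall i, twice_diff (c i) a) ->
  (\matrix_(i, j) pd i (c j) a) \in unitmx ->
  (forall i j k : 'I_n, (i < j)%N -> (j < k)%N ->
     jacobiator P (c i) (c j) (c k) a = 0) ->
  forall f g h, twice_diff f a -> twice_diff g a -> twice_diff h a ->
  jacobiator P f g h a = 0.
Proof.
move=> dc uE hlt.
have dX f i : twice_diff f a -> differentiable (fun x => \sum_j P j i x * pd j f x) a.
  by move=> [df _]; apply: diff_sum => j _; exact: differentiableM.
have red f : twice_diff f a ->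
    (forall s t, jacobiator P f (c s) (c t) a = 0) ->
    forall g h, twice_diff g a -> twice_diff h a -> jacobiator P f g h a = 0.
  move=> df hf g h dg dh; rewrite jacobiator_lie//; apply: (lie_zero (c := c)) => //.
    by move=> i; exact: dX.
  by move=> s t; exact: etrans (esym (jacobiator_lie df (dc s) (dc t))) (hf s t).
(* Rotations and swaps sort the indices, and [jacobiator_diag] covers coinciding ones. *)
have h1 (i j k : 'I_n) : (i < j)%N -> jacobiator P (c i) (c j) (c k) a = 0.
  move=> ij; have [jk|kj|/val_inj <-] := ltngtP j k; first exact: hlt.
    rewrite (jacobiator_rot P (c i)) (jacobiator_rot P (c j)).
    have [ik|ki|/val_inj <-] := ltngtP i k; last exact: jacobiator_diag.
      by rewrite jacobiator_swap// hlt// oppr0.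
    exact: hlt.
  by rewrite jacobiator_rot jacobiator_diag.
have h2 i j k : jacobiator P (c i) (c j) (c k) a = 0.
  have [ij|ji|/val_inj <-] := ltngtP i j; first exact: h1.
    by rewrite jacobiator_swap// h1// oppr0.
  exact: jacobiator_diag.
(* With [c s] frozen, [red] frees the last slot; a rotation moves the freed function to the front,
   where [red] freezes it and frees the other two. *)
move=> f g h df dg dh; apply: (red f df) => // s t; rewrite jacobiator_rot.
exact: (red (c s) (dc s) (h2 s) (c t) f (dc t) df).
Qed.

End Antisymmetric.

End LocalBrackets.

(** * Alternating forms *)

Section Multilinear.
Variable R : realType.

(** Tuples of vectors as lists, so that low-degree evaluations compute. The default 0 is not read
    when [l] has length k. *)
Definition args (V : lmodType R) k (l : seq V) : 'I_k -> V := fun i => nth 0 l i.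

Section Space.
Variable V : lmodType R.
Implicit Types (k m : nat) (x y : V).

Lemma funord k (v w : 'I_k -> V) : v =1 w -> v = w.
Proof. by move=> e; apply/funext. Qed.

Lemma args_cons k x (l : seq V) :
  (fun i : 'I_k.+1 => if unlift ord0 i is Some j then @args V k l j else x) =
  args (x :: l).
Proof.
apply: funord => i; case: (unliftP ord0 i) => [j ->|->] //=.
Qed.

Lemma ins_args k x (a : kform V k.+1) l : ins x a (args l) = a (args (x :: l)).
Proof. by rewrite /ins args_cons. Qed.

Lemma unlift_cons k (v : 'I_k.+1 -> V) :
  (fun i => if unlift ord0 i is Some j then v (lift ord0 j) else v ord0) = v.
Proof. by apply: funord => i; case: (unliftP ord0 i) => [j ->|->]. Qed.

Lemma unlift_upd k (v : 'I_k -> V) x (i : 'I_k) y :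
  (fun j => if unlift ord0 j is Some j' then upd v i y j' else x) =
  upd (fun j => if unlift ord0 j is Some j' then v j' else x) (lift ord0 i) y.
Proof.
apply: funord => j; rewrite /upd.
case: (unliftP ord0 j) => [j' ->|->]; last by rewrite (negPf (neq_lift _ _)).
by rewrite (inj_eq lift_inj) .
Qed.

Lemma ins_alternating k x (a : kform V k.+1) : alternating a -> alternating (ins x a).
Proof.
move=> [lin alt]; split=> [v i c y z|v i j ij e].
  by rewrite /ins !unlift_upd lin.
rewrite /ins (alt _ (lift ord0 i) (lift ord0 j)) ?(inj_eq lift_inj)//.
by rewrite !liftK.
Qed.

Lemma upd_ord0 k (v : 'I_k -> V) x y :
  upd (fun j => if unlift ord0 j is Some j' then v j' else x) ord0 y =
  (fun j => if unlift ord0 j is Some j' then v j' else y).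
Proof.
apply: funord => j; rewrite /upd.
by case: (unliftP ord0 j) => [j' ->|->]; rewrite ?eqxx// eq_sym (negPf (neq_lift _ _)).
Qed.

Lemma upd_id k (v : 'I_k -> V) i : upd v i (v i) = v.
Proof. by apply: funord => j; rewrite /upd; case: eqP => // ->. Qed.

Lemma multilinear_zero k (a : kform V k) (v : 'I_k -> V) i :
  alternating a -> v i = 0 -> a v = 0.
Proof.
move=> [lin _] vi; have := lin v i 1 0 0; rewrite scale1r addr0 -vi upd_id.
by rewrite mul1r => /eqP; rewrite eq_sym -subr_eq0 addrK => /eqP.
Qed.

Lemma ins_sum k (a : kform V k.+1) w (I : Type) (r : seq I) (c : I -> R) (e : I -> V) :
  alternating a ->
  ins (\sum_(i <- r) c i *: e i) a w = \sum_(i <- r) c i * ins (e i) a w.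
Proof.
move=> aa; have [lin _] := aa; elim: r => [|i r IH].
  rewrite !big_nil /ins (multilinear_zero (i := ord0))//.
  by case: (unliftP ord0 ord0) => [j /eqP|_] //; rewrite (negPf (neq_lift _ _)).
rewrite !big_cons -IH /ins.
have := lin (fun i => if unlift ord0 i is Some j then w j else 0) ord0 (c i) (e i)
  (\sum_(j <- r) c j *: e j).
by rewrite !upd_ord0.
Qed.

Lemma multilinear_expand k m (a : kform V k) (C : 'M[R]_(k, m)) (e : 'I_m -> V) :
  alternating a ->
  a (fun i => \sum_j C i j *: e j) =
  \sum_(s : {ffun 'I_k -> 'I_m}) (\prod_i C i (s i)) * a (fun i => e (s i)).
Proof.
elim: k a C => [|k IH] a C aa.
  (* For k = 0 there is exactly one index map; its body is obtained by absurdity from an element of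
     ['I_0]. *)
  rewrite (big_pred1 [ffun i : 'I_0 => (match i with Ordinal _ h => match notF h with end end) : 'I_m]).
    by rewrite big_ord0 mul1r; congr a; apply: funord => -[].
  by move=> s; apply/esym/eqP/ffunP => -[].
pose mk (p : 'I_m * {ffun 'I_k -> 'I_m}) : {ffun 'I_k.+1 -> 'I_m} :=
  [ffun i => if unlift ord0 i is Some j then p.2 j else p.1].
rewrite (reindex mk) /=; last first.
  exists (fun s : {ffun 'I_k.+1 -> 'I_m} => (s ord0, [ffun j => s (lift ord0 j)])).
    move=> [i s] _; rewrite /mk !ffunE unlift_none /=; congr pair.
    by apply/ffunP => j; rewrite !ffunE liftK.
  move=> s _; apply/ffunP => i; rewrite /mk ffunE /=.
  by case: (unliftP ord0 i) => [j ->|->]; rewrite ?ffunE.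
rewrite -(pair_bigA _ (fun i s => (\prod_j C j (mk (i, s) j)) * a (fun j => e (mk (i, s) j)))) /=.
rewrite -[in LHS](unlift_cons (fun i => \sum_j C i j *: e j)).
rewrite -[LHS]/(ins (\sum_j C ord0 j *: e j) a (fun i => \sum_j C (lift ord0 i) j *: e j)).
rewrite ins_sum//; apply: eq_bigr => i _.
pose C' := \matrix_(i, j) C (lift ord0 i) j.
have -> : (fun i => \sum_j C (lift ord0 i) j *: e j) = (fun i => \sum_j C' i j *: e j).
  by apply: funord => i'; apply: eq_bigr => j _; rewrite mxE.
rewrite IH; last exact: ins_alternating.
rewrite mulr_sumr; apply: eq_bigr => s _; rewrite big_ord_recl mulrA; congr (_ * _ * _).
- by rewrite /mk ffunE unlift_none.
- by apply: eq_bigr => j _; rewrite mxE /mk ffunE liftK.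
rewrite /ins; congr a; apply: funord => j; rewrite /mk ffunE.
by case: (unliftP ord0 j).
Qed.

(** Polarisation: the form with v i + v j in both slots is zero, and of its four terms the two with
    equal entries vanish. *)
Lemma alternating_tperm k (a : kform V k) v (i j : 'I_k) :
  alternating a -> i != j -> a (fun l => v (tperm i j l)) = - a v.
Proof.
move=> [lin alt] ij.
have add w l x y : a (upd w l (x + y)) = a (upd w l x) + a (upd w l y).
  by rewrite -[x]scale1r lin mul1r scale1r.
pose w x y := upd (upd v i x) j y.
have wxx x : a (w x x) = 0.
  by apply: (alt _ i j) => //; rewrite /w /upd eqxx (negPf ij) eqxx.
have addl x x' y : a (w (x + x') y) = a (w x y) + a (w x' y).
  have sw z : w z y = upd (upd v j y) i z.
    apply: funord => l; rewrite /w /upd; case: eqP => // ->.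
    by rewrite eq_sym (negPf ij).
  by rewrite !sw add.
have := wxx (v i + v j); rewrite addl /w !add -/(w _ _) -/(w _ _) -/(w _ _) -/(w _ _).
rewrite !wxx add0r addr0 => /eqP; rewrite addrC addr_eq0 => /eqP e.
have -> : (fun l => v (tperm i j l)) = w (v j) (v i).
  apply: funord => l; rewrite /w /upd; case: tpermP => [->|->|/eqP/negPf-> /eqP/negPf->] //.
    by rewrite (negPf ij) eqxx.
  by rewrite eqxx.
rewrite e; congr (- a _); apply: funord => l; rewrite /w /upd.
by case: eqP => [->//|_]; case: eqP => [->|].
Qed.

Lemma alternating_perm k (a : kform V k) v (s : 'S_k) :
  alternating a -> a (fun l => v (s l)) = (-1) ^+ (s : bool) * a v.
Proof.
move=> aa; have [ts -> dts] := prod_tpermP s.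
elim: ts dts v => [_ v|[i j] ts IH /= /andP[ij dts] v].
  by rewrite big_nil odd_perm1 mul1r; congr a; apply: funord => l; rewrite perm1.
rewrite big_cons odd_mul_tperm ij /=.
have -> : (fun l => v ((tperm i j * \prod_(t <- ts) tperm t.1 t.2)%g l)) =
          (fun l => (fun l' => v ((\prod_(t <- ts) tperm t.1 t.2)%g l')) (tperm i j l)).
  by apply: funord => l; rewrite permM.
rewrite (alternating_tperm (fun l' => v ((\prod_(t <- ts) tperm t.1 t.2)%g l')) aa ij).
by rewrite IH// -mulNr; congr (_ * _); case: (odd_perm _); rewrite ?expr0 ?expr1 ?opprK.
Qed.

(** In the multilinear expansion the non-injective index maps contribute zero, and the injective
    ones are the permutations of the Leibniz formula. *)
Lemma alternating_det k (a : kform V k) (C : 'M[R]_k) (e : 'I_k -> V) :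
  alternating a -> a (fun i => \sum_j C i j *: e j) = \det C * a e.
Proof.
move=> aa; rewrite multilinear_expand//.
rewrite (bigID (fun f : {ffun 'I_k -> 'I_k} => injectiveb f)) /= [X in _ + X]big1 ?addr0; last first.
  move=> s /injectivePn[i [j ij e']].
  by rewrite [a _](aa.2 _ i j) ?mulr0 ?e'.
rewrite (reindex (@pval _)) /=; last first.
  pose in_Sn := insubd (1%g : 'S_k).
  by exists in_Sn => /= f Uf; first apply: val_inj; apply: insubdK.
rewrite /determinant mulr_suml; apply: eq_big => [s|s _]; first by rewrite (valP s).
have -> : (fun i => e (pval s i)) = (fun i => e (s i)) by apply: funord => i; rewrite pvalE.
rewrite (alternating_perm e s aa) mulrA; congr (_ * _); rewrite mulrC; congr (_ * _).
by apply: eq_bigr => i _; rewrite pvalE.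
Qed.

End Space.

Section Contraction.
Variable n : nat.
Implicit Types (k m : nat).

Lemma pairing_ecovec (v : 'rV[R]_n) j : pairing v (ecovec R j) = v 0 j.
Proof. by rewrite /pairing -colE mxE. Qed.

(** The hypothesis says that [Q] is q times a decomposable k-vector. Expanding its determinant and
    summing over the index maps, each of the k! permutations contributes q a(v), because its sign
    occurs twice; the factorial is the one that [contract] divides by. *)
Lemma kform_contract k (Q : kform 'cV[R]_n k) (a : kform 'rV[R]_n k) q (v : 'I_k -> 'rV[R]_n) :
  (forall xi, Q xi = \det (\matrix_(i, j) pairing (v j) (xi i)) * q) ->
  alternating a ->
  \sum_(s : {ffun 'I_k -> 'I_n}) Q (fun i => ecovec R (s i)) * a (fun i => evec R (s i)) =
  k`!%:R * (q * a v).
Proof.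
move=> HQ aa.
have e (s : {ffun 'I_k -> 'I_n}) : Q (fun i => ecovec R (s i)) * a (fun i => evec R (s i)) =
   q * \sum_(t : 'S_k) (-1) ^+ (t : bool) *
     ((\prod_i v (t i) 0 (s i)) * a (fun i => evec R (s i))).
  rewrite HQ [_ * q]mulrC -mulrA; congr (_ * _); rewrite mulr_suml.
  apply: eq_bigr => t _; rewrite mulrA; congr (_ * _ * _); apply: eq_bigr => i _.
  by rewrite mxE pairing_ecovec.
under eq_bigr do rewrite e.
rewrite -mulr_sumr mulrCA; congr (_ * _); rewrite exchange_big /=.
have -> : k`!%:R * a v = \sum_(t : 'S_k) a v.
  by rewrite sumr_const card_Sn mulr_natl.
apply: eq_bigr => t _; rewrite -mulr_sumr.
have -> : \sum_(s : {ffun 'I_k -> 'I_n}) (\prod_i v (t i) 0 (s i)) * a (fun i => evec R (s i)) =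
    a (fun i => v (t i)).
  pose C := \matrix_(i < k, j < n) v (t i) 0 j.
  have -> : (fun i => v (t i)) = (fun i => \sum_j C i j *: evec R j).
    apply: funord => i; rewrite {1}(row_sum_delta (v (t i))).
    by apply: eq_bigr => j _; rewrite mxE.
  rewrite multilinear_expand//; apply: eq_bigr => s _; congr (_ * _).
  by apply: eq_bigr => i _; rewrite mxE.
by rewrite (alternating_perm _ t aa) mulrA -signr_addb addbb mul1r.
Qed.

Lemma slot_alternating k m (a : kform 'rV[R]_n (k + m)) (w : 'I_m -> 'rV[R]_n) :
  alternating a ->
  alternating (fun u : 'I_k -> 'rV[R]_n => a (fun j => match fintype.split j with
                  | inl i => u (rev_ord i)
                  | inr i => w i
                  end)).
Proof.
move=> [lin alt].
have su (u : 'I_k -> 'rV[R]_n) i x : (fun j => match fintype.split j with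
    | inl i' => upd u i x (rev_ord i') | inr i' => w i' end) =
   upd (fun j => match fintype.split j with
    | inl i' => u (rev_ord i') | inr i' => w i' end) (lshift m (rev_ord i)) x.
  apply: funord => j; rewrite /upd; case: (splitP j) => [i' ij|i' ij].
    have -> : j = lshift m i' by apply: val_inj.
    by rewrite eq_lshift (can2_eq rev_ordK rev_ordK).
  have -> : j = rshift k i' by apply: val_inj.
  by rewrite eq_rlshift.
split=> [u i c x y|u i j ij e]; first by rewrite !su lin.
apply: (alt _ (lshift m (rev_ord i)) (lshift m (rev_ord j))).
  by rewrite eq_lshift (inj_eq rev_ord_inj).
by rewrite -![lshift m _]/(unsplit (inl _)) !unsplitK !rev_ordK.
Qed.

(** Against a decomposable k-vector the sum over index maps in [contract] collapses to one
    evaluation. The [rev_ord] left in it is the source of the signs in the later formulas. *)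
Lemma contract_det k m (Q : kform 'cV[R]_n k) (a : kform 'rV[R]_n (k + m)) q
    (v : 'I_k -> 'rV[R]_n) w :
  (forall xi, Q xi = \det (\matrix_(i, j) pairing (v j) (xi i)) * q) ->
  alternating a ->
  contract m Q a w = q * a (fun j => match fintype.split j with
                  | inl i => v (rev_ord i)
                  | inr i => w i
                  end).
Proof.
move=> HQ aa; rewrite /contract.
have /= -> := kform_contract HQ (slot_alternating w aa).
by rewrite mulKf// pnatr_eq0 -lt0n fact_gt0.
Qed.

End Contraction.
End Multilinear.

(** * Explicit determinants, wedge products and contractions in low degree *)

Section LowDegree.
Variable R : realType.

(* [iNk] is the element k of ['I_N]. *)
Definition i20 : 'I_2 := @Ordinal 2 0 isT.
Definition i21 : 'I_2 := @Ordinal 2 1 isT.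
Definition i30 : 'I_3 := @Ordinal 3 0 isT.
Definition i31 : 'I_3 := @Ordinal 3 1 isT.
Definition i32 : 'I_3 := @Ordinal 3 2 isT.

Lemma ord2P (P : 'I_2 -> Prop) : P i20 -> P i21 -> forall i, P i.
Proof.
by move=> h0 h1 [[|[|//]] hi]; [move: h0|move: h1]; congr P; apply: val_inj.
Qed.

Lemma ord3P (P : 'I_3 -> Prop) : P i30 -> P i31 -> P i32 -> forall i, P i.
Proof.
by move=> h0 h1 h2 [[|[|[|//]]] hi]; [move: h0|move: h1|move: h2]; congr P; apply: val_inj.
Qed.

Lemma sum2 (V : nmodType) (F : 'I_2 -> V) : \sum_i F i = F i20 + F i21.
Proof.
by rewrite !big_ord_recl big_ord0 addr0; congr (F _ + F _); apply: val_inj.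
Qed.

Lemma sum3 (V : nmodType) (F : 'I_3 -> V) : \sum_i F i = F i30 + F i31 + F i32.
Proof.
rewrite !big_ord_recl big_ord0 addr0 addrA.
by congr (F _ + F _ + F _); apply: val_inj.
Qed.

Lemma prod2 (F : 'I_2 -> R) : \prod_i F i = F i20 * F i21.
Proof.
by rewrite !big_ord_recl big_ord0 mulr1; congr (F _ * F _); apply: val_inj.
Qed.

Lemma prod3 (F : 'I_3 -> R) : \prod_i F i = F i30 * F i31 * F i32.
Proof.
rewrite !big_ord_recl big_ord0 mulr1 mulrA.
by congr (F _ * F _ * F _); apply: val_inj.
Qed.

Lemma det2 (M : 'M[R]_2) :
  \det M = M i20 i20 * M i21 i21 - M i20 i21 * M i21 i20.
Proof.
rewrite (expand_det_row _ i20) sum2 /cofactor !det_mx11 !mxE /=.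
have e0 : lift i20 (0 : 'I_1) = i21 by apply: val_inj.
have e1 : lift i21 (0 : 'I_1) = i20 by apply: val_inj.
by rewrite e0 e1 expr0 expr1 mul1r mulN1r mulrN.
Qed.

Lemma det3 (M : 'M[R]_3) :
  \det M = M i30 i30 * (M i31 i31 * M i32 i32 - M i31 i32 * M i32 i31)
         - M i30 i31 * (M i31 i30 * M i32 i32 - M i31 i32 * M i32 i30)
         + M i30 i32 * (M i31 i30 * M i32 i31 - M i31 i31 * M i32 i30).
Proof.
rewrite (expand_det_row _ i30) sum3 /cofactor !det2 !mxE /=.
have e00 : lift i30 i20 = i31 by apply: val_inj.
have e01 : lift i30 i21 = i32 by apply: val_inj.
have e10 : lift i31 i20 = i30 by apply: val_inj.
have e11 : lift i31 i21 = i32 by apply: val_inj.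
have e20 : lift i32 i20 = i30 by apply: val_inj.
have e21 : lift i32 i21 = i31 by apply: val_inj.
rewrite e00 e01 e10 e11 e20 e21 -[(0 + 0)%N]/0%N -[(0 + 1)%N]/1%N -[(0 + 2)%N]/2%N.
by rewrite expr0 expr1 sqrrN expr1n; ring.
Qed.

Section Space.
Variable V : lmodType R.
Implicit Types x y z : V.

Lemma args1 (v : 'I_1 -> V) x : v ord0 = x -> v = args [:: x].
Proof. by move=> <-; apply: funord => i; rewrite ord1. Qed.

Lemma args2 (v : 'I_2 -> V) x y : v i20 = x -> v i21 = y -> v = args [:: x; y].
Proof. by move=> <- <-; apply: funord; apply: ord2P. Qed.

Lemma args3 (v : 'I_3 -> V) x y z :
  v i30 = x -> v i31 = y -> v i32 = z -> v = args [:: x; y; z].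
Proof. by move=> <- <- <-; apply: funord; apply: ord3P. Qed.

Lemma pair2E x y : pair2 x y = args [:: x; y].
Proof. exact: args2. Qed.

Lemma alternating2_flip (a : kform V 2) x y : alternating a ->
  a (args [:: y; x]) = - a (args [:: x; y]).
Proof.
move=> aa; rewrite -(alternating_tperm (args [:: x; y]) aa (isT : i20 != i21)).
congr a; apply/esym/args2; first by rewrite tpermL.
by rewrite tpermR.
Qed.

Lemma alternating2_diag (a : kform V 2) x : alternating a -> a (args [:: x; x]) = 0.
Proof. by move=> aa; apply: (aa.2 _ i20 i21). Qed.

Lemma alternating3_12 (a : kform V 3) x y z : alternating a ->
  a (args [:: y; x; z]) = - a (args [:: x; y; z]).
Proof.
move=> aa; rewrite -(alternating_tperm (args [:: x; y; z]) aa (isT : i30 != i31)).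
by congr a; apply/esym/args3; rewrite ?tpermL ?tpermR ?tpermD.
Qed.

Lemma alternating3_23 (a : kform V 3) x y z : alternating a ->
  a (args [:: x; z; y]) = - a (args [:: x; y; z]).
Proof.
move=> aa; rewrite -(alternating_tperm (args [:: x; y; z]) aa (isT : i31 != i32)).
by congr a; apply/esym/args3; rewrite ?tpermL ?tpermR ?tpermD.
Qed.

Lemma wedge11 (a b : kform V 1) x y :
  wedge a b (args [:: x; y]) =
  a (args [:: x]) * b (args [:: y]) - a (args [:: y]) * b (args [:: x]).
Proof.
pose v : 'I_2 -> V := args [:: x; y].
pose M : 'M[R]_2 := \matrix_(i, j) if i == i20 then a (args [:: v j]) else b (args [:: v j]).
have := det2 M; rewrite !mxE /= => <-.
rewrite /wedge mul1n invr1 mul1r; apply: eq_bigr => s _; congr (_ * _).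
rewrite prod2 !mxE /=; congr (a _ * b _); apply: args1; congr (v (s _)); exact: val_inj.
Qed.

(** As [a] couples two slots, the sum over permutations is not itself a determinant. The indicator
    rows of [M p q] select the permutations sending the first two slots to p and q, so it becomes a
    sum of determinants weighted by the values of [a]. *)
Lemma wedge21 (a : kform V 2) (b : kform V 1) x y z : alternating a ->
  wedge a b (args [:: x; y; z]) =
  a (args [:: x; y]) * b (args [:: z]) - a (args [:: x; z]) * b (args [:: y])
  + a (args [:: y; z]) * b (args [:: x]).
Proof.
move=> aa; pose v : 'I_3 -> V := args [:: x; y; z].
pose A p q := a (args [:: v p; v q]); pose B p := b (args [:: v p]).
pose M p q : 'M[R]_3 := \matrix_(i, j)
  (if i == i30 then (j == p)%:R else if i == i31 then (j == q)%:R else B j).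
rewrite /wedge.
have -> : \sum_(s : 'S_(2 + 1)) (-1) ^+ (s : bool) *
    (a (fun i => v (s (lshift 1 i))) * b (fun i => v (s (rshift 2 i)))) =
    \sum_p \sum_q A p q * \det (M p q).
  transitivity (\sum_(s : 'S_3) \sum_p \sum_q A p q *
      ((-1) ^+ (s : bool) * ((s i30 == p)%:R * (s i31 == q)%:R * B (s i32)))).
    apply: eq_bigr => s _.
    rewrite (bigD1 (s i30)) //= [X in _ + X]big1 ?addr0; last first.
      by move=> p pn; rewrite big1// => q _; rewrite eq_sym (negPf pn) !(mul0r,mulr0).
    rewrite (bigD1 (s i31)) //= [X in _ + X]big1 ?addr0; last first.
      by move=> q qn; rewrite [_ == q]eq_sym (negPf qn) !(mul0r,mulr0).
    rewrite !eqxx !mul1r [LHS]mulrCA; congr (_ * (_ * _)).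
      by congr (a _); apply: args2; congr (v (s _)); exact: val_inj.
    by congr (b _); apply: args1; congr (v (s _)); exact: val_inj.
  rewrite exchange_big; apply: eq_bigr => p _; rewrite exchange_big.
  apply: eq_bigr => q _; rewrite -mulr_sumr; congr (_ * _); apply: eq_bigr => s _.
  by rewrite prod3 !mxE.
rewrite !sum3 !det3 !mxE /= /A /= !alternating2_diag//.
rewrite -[v i30]/x -[v i31]/y -[v i32]/z.
rewrite (alternating2_flip x y aa) (alternating2_flip x z aa) (alternating2_flip y z aa).
rewrite /B -[v i30]/x -[v i31]/y -[v i32]/z /=.
rewrite (_ : (2`! * 1`!)%:R = 2 :> R) //; by field.
Qed.

(** Any other set of p indices has an element outside [S], and there [A] kills the argument; only
    the term of [S] survives. *)
Lemma component_adapted (A B : V -> V) p q (a : kform V (p + q)) (v : 'I_(p + q) -> V)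
    (S : {set 'I_(p + q)}) :
  alternating a -> #|S| = p ->
  (forall i, i \in S -> A (v i) = v i) ->
  (forall i, i \notin S -> A (v i) = 0 /\ B (v i) = v i) ->
  component A B a v = a v.
Proof.
move=> aa cS hS hN; rewrite /component (bigD1 S) ?cS//= [X in _ + X]big1 ?addr0.
  by congr a; apply: funord => i; case: ifPn => [/hS//|/hN[]].
move=> S' /andP[/eqP cS' nS].
have /subsetPn[i iS' iS] : ~~ (S' \subset S).
  by apply: contra nS => sub; rewrite eqEcard sub cS cS' leqnn.
by apply: (multilinear_zero (i := i) aa); rewrite iS'; case: (hN i iS).
Qed.

Lemma component_0 (A B : V -> V) q (a : kform V (0 + q)) v :
  component A B a v = a (fun i => B (v i)).
Proof.
rewrite /component (big_pred1 (finset.set0 : {set _})) => [|S]; last by rewrite cards_eq0.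
by congr a; apply: funord => i; rewrite inE.
Qed.

Lemma component_full (A B : V -> V) p (a : kform V (p + 0)) v :
  component A B a v = a (fun i => A (v i)).
Proof.
rewrite /component (big_pred1 [set: _]%SET) => [|S].
  by congr a; apply: funord => i; rewrite inE.
rewrite /= [RHS]eqEcard finset.subsetT cardsT card_ord /=.
have := max_card (mem S); rewrite card_ord; move: #|_| => c.
by rewrite addn0 eqn_leq => ->.
Qed.

End Space.

Lemma contract31 n (Q : kform 'cV[R]_n 3) (a : kform 'rV[R]_n (3 + 1)) q
   (v1 v2 v3 w : 'rV[R]_n) :
  (forall xi, Q xi = \det (\matrix_(i, j) pairing (args [:: v1; v2; v3] j) (xi i)) * q) ->
  alternating a ->
  contract 1 Q a (args [:: w]) = q * a (args [:: v3; v2; v1; w]).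
Proof.
move=> HQ aa; rewrite (contract_det _ HQ aa); congr (_ * a _).
apply: funord => j; case: splitP => i e.
  have -> : j = lshift 1 i by apply: val_inj.
  by move: i {e}; apply: ord3P.
by rewrite /args e (ord1 i).
Qed.

Lemma contract30 n (Q : kform 'cV[R]_n 3) (a : kform 'rV[R]_n (3 + 0)) q
   (v1 v2 v3 : 'rV[R]_n) w :
  (forall xi, Q xi = \det (\matrix_(i, j) pairing (args [:: v1; v2; v3] j) (xi i)) * q) ->
  alternating a ->
  contract 0 Q a w = q * a (args [:: v3; v2; v1]).
Proof.
move=> HQ aa; rewrite (contract_det _ HQ aa); congr (_ * a _).
apply: funord => j; case: splitP => [i e|[]//].
by rewrite {2}/args e; move: i {e}; apply: ord3P.
Qed.

Lemma contract20 n (Q : kform 'cV[R]_n 2) (a : kform 'rV[R]_n (2 + 0)) q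
   (v1 v2 : 'rV[R]_n) w :
  (forall xi, Q xi = \det (\matrix_(i, j) pairing (args [:: v1; v2] j) (xi i)) * q) ->
  alternating a ->
  contract 0 Q a w = q * a (args [:: v2; v1]).
Proof.
move=> HQ aa; rewrite (contract_det _ HQ aa); congr (_ * a _).
apply: funord => j; case: splitP => [i e|[]//].
by rewrite {2}/args e; move: i {e}; apply: ord2P.
Qed.

Lemma contract22 n (Q : kform 'cV[R]_n 2) (a : kform 'rV[R]_n (2 + 2)) q
   (v1 v2 w1 w2 : 'rV[R]_n) :
  (forall xi, Q xi = \det (\matrix_(i, j) pairing (args [:: v1; v2] j) (xi i)) * q) ->
  alternating a ->
  contract 2 Q a (args [:: w1; w2]) = q * a (args [:: v2; v1; w1; w2]).
Proof.
move=> HQ aa; rewrite (contract_det _ HQ aa); congr (_ * a _).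
apply: funord => j; case: splitP => i e; rewrite [RHS]/args e;
  by move: i {e}; apply: ord2P.
Qed.

End LowDegree.

(** * Bigraded components and exterior derivatives remain alternating *)

Section Alternation.
Variables (R : realType) (V : lmodType R).

Lemma antisym_zero (x : R) : x = - x -> x = 0.
Proof. by move/eqP; rewrite -subr_eq0 opprK -mulr2n mulrn_eq0 => /eqP. Qed.

(** For equal arguments at i and j, the transposition of i and j permutes the index sets of size p
    and turns the sum into its negative. *)
Lemma component_alternating (A B : {linear V -> V}) p q (a : kform V (p + q)) :
  alternating a -> alternating (component A B a).
Proof.
move=> aa; split=> [v i c x y|v i j ij e].
  rewrite /component mulr_sumr -big_split; apply: eq_bigr => S _ /=.
  have up z : (fun l => if l \in S then A (upd v i z l) else B (upd v i z l)) =
      upd (fun l => if l \in S then A (v l) else B (v l)) i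
          (if i \in S then A z else B z).
    by apply: funord => l; rewrite /upd; case: eqP => // ->.
  by rewrite !up; case: ifP => _; rewrite linearP aa.1.
apply: antisym_zero; rewrite {1}/component.
pose st (S : {set 'I_(p + q)}) := [set tperm i j l | l in S]%SET.
have stE S l : (l \in st S) = (tperm i j l \in S).
  by rewrite -{1}[l](tpermK i j) (mem_imset _ _ (@perm_inj _ _)).
have stK : involutive st by move=> S; apply/setP => l; rewrite !stE tpermK.
rewrite (reindex_inj (inv_inj stK)) /= -sumrN; apply: eq_big => S.
  by rewrite card_imset //; exact: perm_inj.
move=> _; rewrite -(alternating_tperm _ aa ij); congr a; apply: funord => l.
rewrite stE.
by case: tpermP => [->|->|]; rewrite ?e.
Qed.

Lemma lift_perm_decomp n (t : 'S_n.+1) i : exists s, t = lift_perm i (t i) s.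
Proof.
pose f k := odflt k (unlift (t i) (t (lift i k))).
have fE k : lift (t i) (f k) = t (lift i k).
  rewrite /f; case: unliftP => [j ->//|/perm_inj /eqP].
  by rewrite eq_sym (negPf (neq_lift _ _)).
have fi : injective f.
  by move=> k l e; apply: (@lift_inj _ i); apply: (@perm_inj _ t); rewrite -!fE e.
exists (perm fi); apply/permP => k; case: (unliftP i k) => [j ->|->].
  by rewrite lift_perm_lift permE fE.
by rewrite lift_perm_id.
Qed.

(** Here [D u] stands for the derivative of a form in the direction [u], so that the sum is the
    exterior derivative. If v i = v j, reindexing by [tperm i j] negates every term: removing slot l
    leaves a permutation [s] of the other slots, and the odd parity of the transposition is the sum
    of the parities of [s], of l and of the image of l. *)
Lemma antisymmetrization_alternating k (D : V -> kform V k) :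
  (forall u, alternating (D u)) ->
  (forall c u w v, D (c *: u + w) v = c * D u v + D w v) ->
  alternating (fun v : 'I_k.+1 -> V =>
    \sum_(i < k.+1) (-1) ^+ i * D (v i) (fun j => v (lift i j))).
Proof.
move=> Da Dl; split=> [v i c x y|v i j ij e].
  rewrite mulr_sumr -big_split; apply: eq_bigr => l _ /=.
  case: (unliftP l i) => [i' ->|->].
    have up z : (fun j => upd v (lift l i') z (lift l j)) =
                upd (fun j => v (lift l j)) i' z.
      by apply: funord => j; rewrite /upd (inj_eq lift_inj).
    rewrite !up (Da _).1 /upd (negPf (neq_lift _ _)); ring.
  have up z : (fun j => upd v l z (lift l j)) = (fun j => v (lift l j)).
    by apply: funord => j; rewrite /upd eq_sym (negPf (neq_lift _ _)).
  by rewrite !up /upd eqxx Dl; ring.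
apply: antisym_zero; rewrite /= [LHS](reindex_inj (@perm_inj _ (tperm i j))) -sumrN /=.
apply: eq_bigr => l _; have [s es] := lift_perm_decomp (tperm i j) l.
have vt m : v (tperm i j m) = v m by case: tpermP => [->|->|].
have sg : (-1 : R) ^+ tperm i j l = - (-1) ^+ l * (-1) ^+ (s : bool).
  have := odd_lift_perm l (tperm i j l) s; rewrite -es odd_tperm ij => h.
  rewrite -(signr_odd R (tperm i j l)) -(signr_odd R l) mulNr -signr_addb.
  have {h} -> : odd (tperm i j l) = ~~ (odd l (+) s).
    by move: h; case: (odd l); case: (odd _); case: (odd_perm s).
  by case: (_ (+) _); rewrite ?expr0 ?expr1 ?opprK.
rewrite vt sg -!mulrA mulNr; congr (- (_ * _)).
rewrite -(alternating_perm (fun m => v (lift (tperm i j l) m)) s (Da (v l))).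
congr (D _); apply: funord => m.
by rewrite -[in LHS](lift_perm_lift l) -es vt.
Qed.

End Alternation.

(** * Linear algebra of the splitting into horizontal and vertical parts *)

Section Pointwise.
Variable R : realType.

(** A k-vector composed with a projection of rank k is a multiple of a decomposable one. The
    projections 1 - g = T h of rank 2 and g = A B of rank 3 bring Q_H and Q_V to the form required
    by [contract_det]. *)
Lemma mvec_det n k (Q : kform 'cV[R]_n k) (A : 'M[R]_(n, k)) (B : 'M[R]_(k, n)) xi :
  alternating Q ->
  Q (fun i => A *m B *m xi i) =
  \det (\matrix_(i, j) pairing (row j B) (xi i)) * Q (fun j => col j A).
Proof.
move=> aQ; rewrite -alternating_det//; congr Q; apply: funord => i.
apply/matrixP => a b; rewrite (ord1 b) -mulmxA mxE summxE; apply: eq_bigr => j _.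
rewrite !mxE /pairing !mxE mulrC; congr (_ * _); apply: eq_bigr => l _.
by rewrite !mxE.
Qed.

Lemma form_det n k (a : kform 'rV[R]_n k) (A : 'M[R]_(n, k)) (B : 'M[R]_(k, n)) w :
  alternating a ->
  a (fun i => w i *m (A *m B)) =
  \det (\matrix_(i, j) pairing (w i) (col j A)) * a (fun j => row j B).
Proof.
move=> aa; rewrite -alternating_det//; congr a; apply: funord => i.
apply/matrixP => b c; rewrite (ord1 b) mulmxA mxE summxE; apply: eq_bigr => j _.
rewrite !mxE /pairing !mxE; congr (_ * _); apply: eq_bigr => l _.
by rewrite !mxE.
Qed.

(* T is the differential of the projection and h the horizontal lift. *)
Record frame n m (T : 'M[R]_(n, m)) (g : 'M[R]_n) (h : 'M[R]_(m, n)) : Prop := Frame {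
  frame_hT : h *m T = 1%:M;
  frame_hg : h *m g = 0;
  frame_sum : T *m h + g = 1%:M
}.

Section FrameTheory.
Variables (n m : nat) (T : 'M[R]_(n, m)) (g : 'M[R]_n) (h : 'M[R]_(m, n)).
Hypothesis fr : frame T g h.

Lemma frame_gT : g *m T = 0.
Proof.
have := congr1 (mulmxr T) (frame_sum fr).
rewrite /= mulmxDl mul1mx -mulmxA (frame_hT fr) mulmx1 => /eqP.
by rewrite -subr_eq0 addrAC subrr add0r => /eqP.
Qed.

Lemma frame_gg : g *m g = g.
Proof.
have := congr1 (mulmx g) (frame_sum fr).
by rewrite /= mulmxDr mulmx1 mulmxA frame_gT mul0mx add0r.
Qed.

Lemma frame_Th : T *m h = 1%:M - g.
Proof. by rewrite -(frame_sum fr) addrK. Qed.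

Lemma frame_rank : (\rank g = n - m)%N.
Proof.
have rh : (\rank h = m)%N.
  by apply/eqP; rewrite -/(row_free h); apply/row_freeP; exists T; exact: frame_hT fr.
have l1 : (\rank h + \rank g <= n)%N by apply: mulmx0_rank_max; exact: frame_hg fr.
have l2 : (n <= m + \rank g)%N.
  rewrite -{1}(mxrank1 R n) -(frame_sum fr) (leq_trans (mxrank_add _ _))// leq_add2r.
  by rewrite (leq_trans (mxrankM_maxl _ _))// rank_leq_col.
rewrite rh in l1; apply/eqP; rewrite eqn_leq leq_subLR l2 andbT.
by rewrite -(leq_add2l m) subnKC// (leq_trans _ l1)// leq_addr.
Qed.

End FrameTheory.

Lemma factor_idempotent n r (C : 'M[R]_(n, r)) (D : 'M[R]_(r, n)) C' D' :
  C' *m C = 1%:M -> D *m D' = 1%:M -> (C *m D) *m (C *m D) = C *m D ->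
  D *m C = 1%:M.
Proof.
move=> cc dd e; have := congr1 (mulmx C') (congr1 (mulmxr D') e).
by rewrite /= -!mulmxA dd mulmx1 !mulmxA cc mul1mx.
Qed.

Lemma rank_factor n r (g : 'M[R]_n) : g *m g = g -> (\rank g = r)%N ->
  exists (A : 'M[R]_(n, r)) (B : 'M[R]_(r, n)), A *m B = g /\ B *m A = 1%:M.
Proof.
move=> gg <-; exists (col_base g), (row_base g); split; first exact: mulmx_base.
apply: factor_idempotent (mulVpmx (col_base_full g)) (mulmxVp (row_base_free g)) _.
by rewrite mulmx_base.
Qed.

Lemma frame_of_connection n m (T : 'M[R]_(n, m)) (g : 'M[R]_n) :
  row_full T -> g *m T = 0 -> (forall v : 'rV_n, v *m T = 0 -> v *m g = v) ->
  frame T g (pinvmx T *m (1%:M - g)).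
Proof.
move=> fT gT gv.
have gg : g *m g = g.
  by apply/row_matrixP => i; rewrite row_mul gv// -row_mul gT row0.
have := mulVpmx fT; move: (pinvmx T) => S ST; split.
- by rewrite -mulmxA mulmxBl mul1mx gT subr0.
- by rewrite -mulmxA mulmxBl mul1mx gg subrr mulmx0.
(* The rows of [D] are vertical, hence fixed by [g]; so T S (1 - g) = 1 - g for any S with S T = 1,
   and the lift does not depend on the choice made by [pinvmx]. *)
set D := 1%:M - T *m S.
have Dg : D *m g = D.
  apply/row_matrixP => i; rewrite row_mul gv// -row_mul /D mulmxBl mul1mx.
  by rewrite -mulmxA ST mulmx1 subrr row0.
have : D *m (1%:M - g) = 0 by rewrite mulmxBr mulmx1 Dg subrr.
rewrite /D mulmxBl mul1mx -mulmxA => /eqP; rewrite subr_eq0 => /eqP <-.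
by rewrite subrK.
Qed.

End Pointwise.

Section PointAlgebra.
Variable R : realType.

Lemma alternating_precomp (V W : lmodType R) k (f : {linear V -> W}) (a : kform W k) :
  alternating a -> alternating (fun v => a (fun i => f (v i))).
Proof.
move=> [lin alt]; split=> [v i c x y|v i j ij e].
  have up z : (fun l => f (upd v i z l)) = upd (fun l => f (v l)) i (f z).
    by apply: funord => l; rewrite /upd; case: ifP.
  by rewrite !up linearP lin.
by apply: (alt _ i j ij); rewrite e.
Qed.

Lemma alternating_mulmx n m k (T : 'M[R]_(n, m)) (a : kform 'rV[R]_m k) :
  alternating a -> alternating (fun v => a (fun i => v i *m T)).
Proof. exact: (alternating_precomp (mulmxr T)). Qed.

Lemma alternating_mulmxl n m k (T : 'M[R]_(n, m)) (a : kform 'cV[R]_n k) :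
  alternating a -> alternating (fun v => a (fun i => T *m v i)).
Proof. exact: (alternating_precomp (mulmx T)). Qed.

Lemma form_comp_alternating n (g : 'M[R]_n) p q (a : kform 'rV[R]_n (p + q)) :
  alternating a -> alternating (form_comp g p q a).
Proof. exact: (component_alternating (mulmxr _) (mulmxr _)). Qed.

Lemma mvec_comp_alternating n (g : 'M[R]_n) p q (a : kform 'cV[R]_n (p + q)) :
  alternating a -> alternating (mvec_comp g p q a).
Proof. exact: (component_alternating (mulmx _) (mulmx _)). Qed.

Lemma pairing_row n k (v : 'M[R]_(k, n)) j (xi : 'cV[R]_n) :
  pairing (row j v) xi = (v *m xi) j 0.
Proof. by rewrite /pairing -row_mul mxE. Qed.

Lemma pairing_col n k (w : 'rV[R]_n) (N : 'M[R]_(n, k)) j :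
  pairing w (col j N) = (w *m N) 0 j.
Proof. by rewrite /pairing colE mulmxA -colE mxE. Qed.

Lemma covecE n (b : kform 'rV[R]_n 1) (w : 'rV[R]_n) :
  alternating b -> pairing w (covec b) = b (args [:: w]).
Proof.
move=> ab; rewrite pairingE.
have -> : args [:: w] = (fun i : 'I_1 => \sum_j (\matrix_(i, j) w 0 j) i j *: evec R j).
  apply/esym/args1; rewrite [RHS](row_sum_delta w); apply: eq_bigr => j _.
  by rewrite mxE.
rewrite multilinear_expand//.
pose mk j : {ffun 'I_1 -> 'I_n} := [ffun=> j].
rewrite (reindex mk) /=; last first.
  exists (fun s : {ffun 'I_1 -> 'I_n} => s ord0) => [j _|s _]; first by rewrite ffunE.
  by apply/ffunP => i; rewrite ffunE (ord1 i).
apply: eq_bigr => j _; rewrite big_ord_recl big_ord0 mulr1 mxE ffunE; congr (_ * _).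
by rewrite mxE; congr b; apply: funord => i; rewrite ffunE.
Qed.

Section FiveTwo.
Variables (n : nat) (T : 'M[R]_(n, 2)) (g : 'M[R]_n) (h : 'M[R]_(2, n)).
Hypothesis fr : frame T g h.

Lemma horizontal_bivector (Q : kform 'cV[R]_n (2 + 0)) :
  alternating Q -> mvec_comp g 2 0 Q = Q ->
  forall xi, Q xi = \det (\matrix_(i, j) pairing (row j h) (xi i)) *
    Q (args [:: col i20 T; col i21 T]).
Proof.
move=> aQ hQ xi; rewrite -{1}hQ /mvec_comp component_full.
have -> : (fun i => (1%:M - g) *m xi i) = (fun i => T *m h *m xi i).
  by apply: funord => i; rewrite (frame_Th fr).
rewrite (mvec_det T h xi aQ); congr (_ * Q _); exact: args2.
Qed.

Lemma horizontal_2form (s : kform 'rV[R]_n (2 + 0)) :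
  alternating s -> form_comp g 2 0 s = s ->
  forall w, s w = \det (\matrix_(i, j) pairing (w i) (col j T)) *
    s (args [:: row i20 h; row i21 h]).
Proof.
move=> aQ hQ w; rewrite -{1}hQ /form_comp component_full.
have -> : (fun i => w i *m (1%:M - g)) = (fun i => w i *m (T *m h)).
  by apply: funord => i; rewrite (frame_Th fr).
rewrite (form_det T h w aQ); congr (_ * s _); exact: args2.
Qed.

Section Vertical.
Variables (Q : kform 'cV[R]_n (0 + 3)) (N : 'M[R]_(n, 3)).
Hypotheses (aQ : alternating Q) (hQ : mvec_comp g 0 3 Q = Q).
Hypothesis rg : (\rank g = 3)%N.

Lemma vertical_mvec xi : Q xi = Q (fun i => g *m xi i).
Proof. by rewrite -{1}hQ /mvec_comp component_0. Qed.

Definition cols3 (N : 'M[R]_(n, 3)) : 'I_3 -> 'cV[R]_n :=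
  args [:: col i30 N; col i31 N; col i32 N].

Lemma cols3E N' : (fun j => col j N') = cols3 N'.
Proof. exact: args3. Qed.

Definition rows3 (v : 'M[R]_(3, n)) : 'I_3 -> 'rV[R]_n :=
  args [:: row i30 v; row i31 v; row i32 v].

Lemma rows3E v : (fun j => row j v) = rows3 v.
Proof. exact: args3. Qed.

(** [v] is the vertical frame dual to the columns of [N]. With g = A B, the determinant of B N is a
    factor of the value of [Q] on these columns, so B N is invertible and v = (B N)^-1 B. *)
Lemma vertical_trivector : Q (cols3 N) != 0 ->
  exists v : 'M[R]_(3, n), [/\ g *m N *m v = g, v *m (g *m N) = 1%:M &
    forall xi, Q xi = \det (\matrix_(i, j) pairing (rows3 v j) (xi i)) * Q (cols3 N)].
Proof.
move=> q0; have [A [B [AB BA]]] := rank_factor (frame_gg fr) rg.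
have QA xi : Q xi = \det (\matrix_(i, j) pairing (row j B) (xi i)) * Q (cols3 A).
  by rewrite vertical_mvec -AB (mvec_det A B xi aQ) cols3E.
have uS : B *m N \in unitmx.
  have := QA (cols3 N); rewrite -{1}cols3E.
  have -> : \matrix_(i, j) pairing (row j B) (cols3 N i) = (B *m N)^T.
    apply/matrixP => i j; rewrite -cols3E !mxE /pairing !mxE.
    by apply: eq_bigr => l _; rewrite !mxE.
  rewrite det_tr => e; rewrite unitmxE unitfE; apply: contraNneq q0 => d0.
  by rewrite -cols3E e d0 mul0r.
pose v := invmx (B *m N) *m B.
have gNv : g *m N *m v = g.
  by rewrite /v -[in LHS]AB -(mulmxA A) -mulmxA (mulKVmx uS) AB.
exists v; split => //.
  by rewrite /v -[in LHS]AB -(mulmxA A) mulmxA -(mulmxA _ B A) BA mulmx1 mulVmx.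
move=> xi; rewrite vertical_mvec.
have -> : (fun i => g *m xi i) = (fun i => (g *m N) *m v *m xi i) by rewrite gNv.
rewrite (mvec_det (g *m N) v xi aQ) -rows3E; congr (_ * _).
rewrite [RHS]vertical_mvec; congr Q; apply: funord => j.
by rewrite -cols3E colE -mulmxA -colE.
Qed.

Variable v : 'M[R]_(3, n).
Hypotheses (gNv : g *m N *m v = g) (vgN : v *m (g *m N) = 1%:M).
Hypothesis Qv : forall xi,
  Q xi = \det (\matrix_(i, j) pairing (rows3 v j) (xi i)) * Q (cols3 N).

Lemma dual_frame_vg : v *m g = v.
Proof. by rewrite -gNv mulmxA vgN mul1mx. Qed.

Lemma dual_frame_vN : v *m N = 1%:M.
Proof. by rewrite -[in LHS]dual_frame_vg -mulmxA. Qed.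

(** The contraction evaluates [Om] on the dual frame in reverse order; reversing three vectors is
    odd, whence the minus sign. *)
Lemma dual_trivector (Om : kform 'rV[R]_n (0 + 3)) :
  alternating Om -> form_comp g 0 3 Om = Om ->
  contract 0 Q Om = (fun=> 1) ->
  forall w, Om w = - (Q (cols3 N))^-1 * \det (\matrix_(i, j) pairing (w i) (col j (g *m N))).
Proof.
move=> aO hO QO w.
have := congr1 (fun f => f (fun=> 0)) QO; rewrite (contract30 _ Qv aO).
have -> : Om (args [:: row i32 v; row i31 v; row i30 v]) = - Om (rows3 v).
  by rewrite (alternating3_12 _ _ _ aO) (alternating3_23 _ _ _ aO) (alternating3_12 _ _ _ aO) !opprK.
move=> e.
have q0 : Q (cols3 N) != 0.
  by apply/eqP => q0; move: e; rewrite q0 mul0r => /eqP; rewrite eq_sym oner_eq0.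
have -> : - (Q (cols3 N))^-1 = Om (rows3 v).
  by apply: (mulfI q0); rewrite mulrN mulfV// -e mulrN opprK.
rewrite -{1}hO /form_comp component_0 mulrC.
have -> : (fun i => w i *m g) = (fun i => w i *m (g *m N *m v)) by rewrite gNv.
by rewrite (form_det _ _ _ aO) rows3E.
Qed.

Lemma vertical_1form (b : kform 'rV[R]_n (0 + 1)) :
  alternating b -> form_comp g 0 1 b = b ->
  forall w, b (args [:: w]) =
    \sum_k b (args [:: row k v]) * pairing w (col k (g *m N)).
Proof.
move=> ab hb w.
have -> : b (args [:: w]) = b (args [:: w *m g]).
  rewrite -{1}hb /form_comp component_0; congr b; exact: args1.
rewrite -(covecE _ ab).
have -> : w *m g = w *m (g *m N) *m v by rewrite -mulmxA gNv.
rewrite {1}/pairing -(mulmxA _ v) [LHS]mxE; apply: eq_bigr => k _.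
by rewrite mulrC -(covecE _ ab) pairing_row pairing_col.
Qed.

Lemma trivector_covec (b : kform 'rV[R]_n 1) : alternating b ->
  [/\ Q (args [:: covec b; col i31 N; col i32 N]) = b (args [:: row i30 v]) * Q (cols3 N),
      Q (args [:: covec b; col i32 N; col i30 N]) = b (args [:: row i31 v]) * Q (cols3 N) &
      Q (args [:: covec b; col i30 N; col i31 N]) = b (args [:: row i32 v]) * Q (cols3 N)].
Proof.
move=> ab.
have p j k : pairing (row j v) (col k N) = (j == k)%:R.
  by rewrite pairing_row -[in LHS](mulmx1 v) colE mulmx1 mulmxA dual_frame_vN mul1mx mxE eqxx andbT.
by split; rewrite Qv det3 !mxE /rows3 /= !p /= -!(covecE _ ab) /args /=; ring.
Qed.

End Vertical.
End FiveTwo.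

(** The sign is that of exchanging the two vectors in [contract]. It is applied with c = 1 to Q_H
    and with c = -1 to psi, which makes the lift of psi the opposite of Q_H. *)
Lemma bivector_volume n (T : 'M[R]_(n, 2)) (h : 'M[R]_(2, n)) (Q : kform 'cV[R]_n 2)
    (om : kform 'rV[R]_2 2) q c :
  h *m T = 1%:M -> alternating om ->
  (forall xi, Q xi = \det (\matrix_(i, j) pairing (row j h) (xi i)) * q) ->
  contract 0 (Q : kform 'cV[R]_n 2) ((fun v => om (fun i => v i *m T)) : kform 'rV[R]_n (2 + 0))
    = (fun=> c) ->
  q * om (args [:: evec R i20; evec R i21]) = - c.
Proof.
move=> hT ao HQ.
move=> /(congr1 (fun f => f (fun=> 0))).
rewrite (@contract20 _ _ _ _ q (row i20 h) (row i21 h)); last exact: alternating_mulmx.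
  have -> : (fun i : 'I_(2 + 0) => args [:: row i21 h; row i20 h] i *m T) =
            args [:: evec R i21; evec R i20].
    by apply: args2; rewrite -row_mul hT row1.
  by rewrite alternating2_flip// => <-; rewrite mulrN opprK.
by move=> xi; rewrite HQ; congr (\det _ * _); apply/matrixP => i j; rewrite !mxE -(args2 (v := fun j => row j h) erefl erefl).
Qed.

End PointAlgebra.

(** * Change of charts *)

Section Charts.
Variables (R : realType) (n : nat) (M : manifold R n).
Implicit Types (c : chart R M n) (U : set M).

Definition cimg c U : set 'rV[R]_n := cfun c @` (cdom c `&` U).

Lemma cimgP c U x : cimg c U x -> [/\ cdom c (cinv c x), U (cinv c x) &
  cfun c (cinv c x) = x].
Proof. by move=> [p [cp Up] <-]; rewrite cfunK. Qed.

Lemma cimg_in c U p : cdom c p -> U p -> cimg c U (cfun c p).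
Proof. by move=> cp Up; exists p. Qed.

Lemma cimg_open c U : open U -> open (cimg c U).
Proof.
move=> oU; rewrite openE => x Ux; have [cx Ux' ex] := cimgP Ux.
have ix : (cfun c @` cdom c) x by exists (cinv c x).
have n1 : nbhs x (cfun c @` cdom c) by apply: open_nbhs_nbhs; split => //; exact: cimg_open.
have n2 : nbhs x (cinv c @^-1` (cdom c `&` U)).
  apply: (cinv_cont ix); apply: open_nbhs_nbhs; split => //.
  by apply: openI => //; exact: cdom_open.
apply: filterS2 n1 n2 => z [p cp <-]; rewrite /= cfunK// => -[_ Up].
by exists p.
Qed.

Lemma cimgS c U W : U `<=` W -> cimg c U `<=` cimg c W.
Proof. by move=> UW _ [p [cp Up] <-]; exists p => //; split=> //; exact: UW. Qed.

Definition trans c c' : 'rV[R]_n -> 'rV[R]_n := cfun c' \o cinv c.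

Lemma trans_diff c c' p : atlas c -> atlas c' -> cdom c p -> cdom c' p ->
  differentiable (trans c c') (cfun c p).
Proof.
move=> ac ac' cp c'p; apply: differentiable_rowP => j.
by have [d _] := atlas_compat ac ac' j 1%N; apply: d; exists p.
Qed.

Definition jtr c c' p := jacobian (trans c c') (cfun c p).

Lemma jacobian_near m k (f f' : 'rV[R]_m -> 'rV[R]_k) a :
  {near a, f =1 f'} -> differentiable f a -> jacobian f a = jacobian f' a.
Proof.
move=> e df; have df' := near_eq_differentiable e df.
apply/matrixP => i j; apply: etrans (jacobianE i j df) _.
apply: etrans _ (esym (jacobianE i j df')); apply: near_eq_derive.
by apply: filterS e => z ->.
Qed.

Lemma jacobian_id m a : jacobian (id : 'rV[R]_m -> 'rV[R]_m) a = 1%:M.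
Proof.
have d : differentiable (id : 'rV[R]_m -> 'rV[R]_m) a by case: (is_diff_id a).
by apply/row_matrixP => i; rewrite rowE -(deriveEjacobian _ d) derive_id row1.
Qed.

Lemma near_chart c U p : open U -> cdom c p -> U p ->
  \forall x \near cfun c p, cimg c U x.
Proof. by move=> oU cp Up; apply: open_near; [exact: cimg_open|exact: cimg_in]. Qed.

Lemma jtr_comp c c' c'' p : atlas c -> atlas c' -> atlas c'' ->
  cdom c p -> cdom c' p -> cdom c'' p -> jtr c c' p *m jtr c' c'' p = jtr c c'' p.
Proof.
move=> ac ac' ac'' cp c'p c''p.
have e : trans c c' (cfun c p) = cfun c' p by rewrite /trans /= cfunK.
have d1 := trans_diff ac ac' cp c'p; have d2 := trans_diff ac' ac'' c'p c''p.
rewrite -e in d2.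
rewrite /jtr -e -(jacobian_comp d1 d2); apply: jacobian_near.
  apply: filterS (near_chart (cdom_open c') cp c'p) => x /cimgP[cx c'x ex].
  by rewrite /trans /= cfunK.
exact: differentiable_comp.
Qed.

Lemma jtr_id c p : atlas c -> cdom c p -> jtr c c p = 1%:M.
Proof.
move=> ac cp; rewrite -(jacobian_id (cfun c p)); apply: jacobian_near.
  by apply: filterS (near_chart openT cp I) => x /cimgP[_ _ ex].
exact: trans_diff.
Qed.

Lemma atlas_chart_at (p : M) : atlas (chart_at p).
Proof. by rewrite /chart_at; case: cid => c []. Qed.

Lemma cdom_chart_at (p : M) : cdom (chart_at p) p.
Proof. by rewrite /chart_at; case: cid => c []. Qed.

Lemma jacE c p : jac c p = jtr c (chart_at p) p. Proof. by []. Qed.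

Lemma jac_unit c p : atlas c -> cdom c p -> jac c p \in unitmx.
Proof.
move=> ac cp; have ad := atlas_chart_at p; have cd := cdom_chart_at p.
have := jtr_comp ac ad ac cp cd cp; rewrite (jtr_id ac cp) => e.
by rewrite jacE; exact: (mulmx1_unit e).1.
Qed.

Lemma jac_inv c p : atlas c -> cdom c p -> invmx (jac c p) = jtr (chart_at p) c p.
Proof.
move=> ac cp; have ad := atlas_chart_at p; have cd := cdom_chart_at p.
have := jtr_comp ac ad ac cp cd cp; rewrite (jtr_id ac cp) -jacE => e.
by rewrite -[RHS](mulKmx (jac_unit ac cp)) e mulmx1.
Qed.

Lemma jac_chart_at (p : M) : jac (chart_at p) p = 1%:M.
Proof. by rewrite jacE jtr_id//; [exact: atlas_chart_at|exact: cdom_chart_at]. Qed.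

Definition grad_in c (f : M -> R) (x : 'rV[R]_n) : 'cV[R]_n :=
  \col_i pd i (f \o cinv c) x.

Lemma covec_ext_d (f : M -> R) p : grad f p = grad_in (chart_at p) f (coord p).
Proof.
apply/matrixP => i j; rewrite !mxE /ext_d big_ord_recl big_ord0 addr0 expr0 mul1r.
by [].
Qed.

Lemma grad_trans c p (f : M -> R) : atlas c -> cdom c p ->
  differentiable (f \o cinv (chart_at p)) (coord p) ->
  jac c p *m grad f p = grad_in c f (cfun c p).
Proof.
move=> ac cp df; have ad := atlas_chart_at p; have cd := cdom_chart_at p.
have dt := trans_diff ac ad cp cd.
have e : trans c (chart_at p) (cfun c p) = coord p by rewrite /trans /= cfunK.
rewrite covec_ext_d; apply/matrixP => i j; rewrite (ord1 j) [RHS]mxE /pd.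
have -> : 'D_(evec R i) (f \o cinv c) (cfun c p) =
          'D_(evec R i) ((f \o cinv (chart_at p)) \o trans c (chart_at p)) (cfun c p).
  apply: near_eq_derive.
  apply: filterS (near_chart (cdom_open (chart_at p)) cp cd) => x /cimgP[cx c'x ex].
  by rewrite /trans /= cfunK.
rewrite -e in df; rewrite (derive_comp_sum _ dt df) mxE; apply: eq_bigr => k _.
by rewrite jacE -(jacobianE _ _ dt) [X in _ * X]mxE e.
Qed.

Lemma smooth_fun_diff U f c p : open U -> smooth_fun U f -> atlas c -> cdom c p -> U p ->
  differentiable (f \o cinv c) (cfun c p).
Proof.
by move=> oU sf ac cp Up; have [d _] := sf c ac 1%N; apply: d; exists p.
Qed.

Lemma grad_chart U f c p : open U -> smooth_fun U f -> atlas c -> cdom c p -> U p ->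
  grad f p = invmx (jac c p) *m grad_in c f (cfun c p).
Proof.
move=> oU sf ac cp Up; rewrite -(grad_trans ac cp) ?mulKmx ?jac_unit//.
by apply: (smooth_fun_diff oU sf) => //; [exact: atlas_chart_at|exact: cdom_chart_at].
Qed.

Lemma smooth_fun_cont U f p : open U -> smooth_fun U f -> U p -> {for p, continuous f}.
Proof.
move=> oU sf Up; have ad := atlas_chart_at p; have cd := cdom_chart_at p.
have c1 : {for p, continuous ((f \o cinv (chart_at p)) \o cfun (chart_at p))}.
  apply: continuous_comp; first exact: cfun_cont.
  exact/differentiable_continuous/(smooth_fun_diff oU sf ad cd Up).
apply: near_eq_continuous c1.
by apply: filterS (open_near (cdom_open (chart_at p)) cd) => q cq; rewrite /= cfunK.
Qed.

End Charts.

(** * Bivectors and brackets of functions in one fixed chart *)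

Section BracketInChart.
Variables (R : realType) (n : nat) (M : manifold R n).

Lemma bilinear_expand (P : kform 'cV[R]_n 2) (xi ze : 'cV[R]_n) : alternating P ->
  P (args [:: xi; ze]) =
  \sum_i \sum_j P (args [:: ecovec R i; ecovec R j]) * xi i 0 * ze j 0.
Proof.
move=> aP.
have e1 (x : 'cV[R]_n) : x = \sum_i x i 0 *: ecovec R i.
  apply/matrixP => i j; rewrite (ord1 j) summxE (bigD1 i)//= big1 ?addr0.
    by rewrite !mxE !eqxx mulr1.
  by move=> k ki; rewrite !mxE eq_sym (negPf ki) mulr0.
have l1 x y : P (args [:: x; y]) = \sum_i x i 0 * P (args [:: ecovec R i; y]).
  rewrite {1}(e1 x) -ins_args ins_sum//; apply: eq_bigr => i _.
  by rewrite ins_args.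
rewrite l1; apply: eq_bigr => i _; rewrite (alternating2_flip _ _ aP) l1.
rewrite -sumrN mulr_sumr; apply: eq_bigr => j _.
by rewrite (alternating2_flip (ecovec R i) (ecovec R j) aP); ring.
Qed.

Definition mx_in (c : chart R M n) (P : mvec M 2) (i j : 'I_n) (x : 'rV[R]_n) : R :=
  mvec_in c P (args [:: ecovec R i; ecovec R j]) x.

Lemma mvec_in_alternating c k (Q : mvec M k) x :
  alternating (Q (cinv c x)) -> alternating (fun xi => mvec_in c Q xi x).
Proof. exact: alternating_mulmxl. Qed.

Lemma form_in_alternating c k (Q : dform M k) x :
  alternating (Q (cinv c x)) -> alternating (fun xi => form_in c Q xi x).
Proof. exact: alternating_mulmx. Qed.

(** [bracket] reads the gradients at each point in its own distinguished chart. An iterated bracket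
    differentiates the inner one, and this requires an expression in one chart valid at all nearby
    points. *)
Lemma bracket_in_chart (U : set M) P f g c p : open U -> U p ->
  smooth_fun U f -> smooth_fun U g -> atlas c -> cdom c p -> alternating (P p) ->
  bracket P f g p = brk (mx_in c P) (f \o cinv c) (g \o cinv c) (cfun c p).
Proof.
move=> oU Up sf sg ac cp aP; rewrite /bracket (grad_chart oU sf ac cp Up)
  (grad_chart oU sg ac cp Up) pair2E.
set x := cfun c p.
transitivity (mvec_in c P (args [:: grad_in c f x; grad_in c g x]) x).
  by rewrite /mvec_in /x cfunK//; congr (P p); apply/esym/args2.
have aP' : alternating (P (cinv c x)) by rewrite /x cfunK.
rewrite (bilinear_expand _ _ (mvec_in_alternating aP')).
by apply: eq_bigr => i _; apply: eq_bigr => j _; rewrite !mxE.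
Qed.

End BracketInChart.

Lemma near_forall (S : topologicalType) (P : S -> Prop) (x0 : S) :
  (forall x, P x) -> \forall x \near x0, P x.
Proof. by move=> e; apply: nearW. Qed.

Lemma eq_near1 (S : topologicalType) (T : Type) (f g : S -> T) (x0 : S) :
  f =1 g -> {near x0, f =1 g}.
Proof. by move=> e; apply: nearW. Qed.

(** * The Jacobi identity in adapted coordinates *)

Section LocalModel.
Variables (R : realType) (n : nat).
Local Notation V := 'rV[R]_n.

(** Locality and the algebraic rules are all that the Jacobi computations use, so the adapted frame
    enters only through five abstract derivations at one point. *)
Record derivation_at (x0 : V) (D : (V -> R) -> R) : Prop := Derivation {
  derv_near : forall f g : V -> R, {near x0, f =1 g} -> D f = D g;
  dervD : forall f g : V -> R, differentiable f x0 -> differentiable g x0 ->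
    D (fun x => f x + g x) = D f + D g;
  dervM : forall f g : V -> R, differentiable f x0 -> differentiable g x0 ->
    D (fun x => f x * g x) = D f * g x0 + f x0 * D g;
  dervN : forall f : V -> R, differentiable f x0 -> D (fun x => - f x) = - D f
}.

Lemma derivation_derive (x0 w : V) : derivation_at x0 (fun f => 'D_w f x0).
Proof.
split=> [f g|f g|f g|f]; [exact: near_eq_derive|exact: derD|exact: derM|exact: derN].
Qed.

Lemma derv_minor (x0 : V) D (f g h k l : V -> R) : derivation_at x0 D ->
  differentiable f x0 -> differentiable g x0 -> differentiable h x0 ->
  differentiable k x0 -> differentiable l x0 ->
  differentiable (fun x => f x * (g x * h x - k x * l x)) x0 /\
  D (fun x => f x * (g x * h x - k x * l x)) =
  D f * (g x0 * h x0 - k x0 * l x0) +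
  f x0 * (D g * h x0 + g x0 * D h - (D k * l x0 + k x0 * D l)).
Proof.
move=> dD df dg dh dk dl.
have d1 : differentiable (fun x => g x * h x) x0 by exact: differentiableM.
have d2 : differentiable (fun x => k x * l x) x0 by exact: differentiableM.
have d3 : differentiable (fun x => - (k x * l x)) x0 by exact: differentiableN.
have d4 : differentiable (fun x => g x * h x - k x * l x) x0 by exact: differentiableD.
split; first exact: differentiableM.
rewrite (dervM dD df d4) (dervD dD d1 d3) (dervN dD d2) (dervM dD dg dh).
by rewrite (dervM dD dk dl).
Qed.

Lemma derv_det3 (x0 : V) D (e : 'I_3 -> 'I_3 -> V -> R) : derivation_at x0 D ->
  (forall i j, differentiable (e i j) x0) ->
  differentiable (fun x => \det (\matrix_(i, j) e i j x)) x0 /\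
  D (fun x => \det (\matrix_(i, j) e i j x)) =
  \sum_l \det (\matrix_(i, j) if i == l then D (e i j) else e i j x0).
Proof.
move=> dD de.
have -> : (fun x => \det (\matrix_(i, j) e i j x)) = (fun x =>
     e i30 i30 x * (e i31 i31 x * e i32 i32 x - e i31 i32 x * e i32 i31 x)
   + - (e i30 i31 x * (e i31 i30 x * e i32 i32 x - e i31 i32 x * e i32 i30 x))
   + e i30 i32 x * (e i31 i30 x * e i32 i31 x - e i31 i31 x * e i32 i30 x)).
  by apply/funext => x; rewrite det3 !mxE.
have m j k l k' l' := @derv_minor x0 D (e i30 j) (e i31 k) (e i32 l) (e i31 k') (e i32 l')
  dD (de _ _) (de _ _) (de _ _) (de _ _) (de _ _).
have [d0 D0] := m i30 i31 i32 i32 i31.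
have [d1 D1] := m i31 i30 i32 i32 i30.
have [d2 D2] := m i32 i30 i31 i31 i30.
have dN := differentiableN d1; have dS := differentiableD d0 dN.
split; first exact: (differentiableD dS d2).
rewrite (dervD dD dS d2) (dervD dD d0 dN) (dervN dD d1) D0 D1 D2.
by rewrite sum3 !det3 !mxE /=; ring.
Qed.

(* [Dh i] and [Dv k] are the derivatives at x0 along the frame h_1, h_2, v_1, v_2,
   v_3 adapted to the splitting; F, q, b and A are as in the header. *)
Variables (x0 : V) (Dh : 'I_2 -> (V -> R) -> R) (Dv : 'I_3 -> (V -> R) -> R).
Hypotheses (derh : forall i, derivation_at x0 (Dh i))
  (derv : forall k, derivation_at x0 (Dv k)).
Variables (kappa F q : V -> R) (b : 'I_3 -> V -> R) (A : 'I_2 -> 'I_3 -> V -> R).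
Hypotheses (dkappa : differentiable kappa x0) (dF : differentiable F x0)
  (dq : differentiable q x0) (db : forall m, differentiable (b m) x0)
  (dA : forall i k, differentiable (A i k) x0).
Hypotheses (A0 : forall i k, A i k x0 = 0) (q0 : q x0 != 0)
  (DvF : forall k, Dv k F = 0).

Local Notation "'a'" := (fun x : V => - (kappa x * F x)).

(* P_beta(dz_k, dz_l) *)
Definition vbracket (k l : 'I_3) (x : V) : R :=
  if (k == i30) && (l == i31) then - (q x * b i32 x)
  else if (k == i31) && (l == i32) then - (q x * b i30 x)
  else if (k == i32) && (l == i30) then - (q x * b i31 x)
  else if (k == i31) && (l == i30) then q x * b i32 x
  else if (k == i32) && (l == i31) then q x * b i30 x
  else if (k == i30) && (l == i32) then q x * b i31 x
  else 0.

(** The first equation of a Poisson triple on (v_1, v_2, v_3). *)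
Hypothesis eqA : (Dv i30 (b i31) - Dv i31 (b i30)) * b i32 x0
  - (Dv i30 (b i32) - Dv i32 (b i30)) * b i31 x0
  + (Dv i31 (b i32) - Dv i32 (b i31)) * b i30 x0 = 0.

(* [q * liehor i m] is, up to sign, a component of the Lie derivative of P_beta
   along h_i; [curv k] is a component of the curvature of the connection. *)
Definition liehor (i : 'I_2) (m : 'I_3) : R :=
  Dh i (b m) + (b i30 x0 * Dv m (A i i30) + b i31 x0 * Dv m (A i i31)
     + b i32 x0 * Dv m (A i i32))
  - (- (Dh i q / q x0) + (Dv i30 (A i i30) + Dv i31 (A i i31) + Dv i32 (A i i32)))
    * b m x0.

Definition curv (k : 'I_3) : R := Dh i20 (A i21 k) - Dh i21 (A i20 k).

(** The third equation on pairs of vertical frame vectors, with rho(v_k, v_l) = - F curv_m / q for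
    (k, l, m) cyclic. *)
Hypothesis eqC :
  [/\ Dv i31 kappa * b i32 x0 - Dv i32 kappa * b i31 x0 =
         kappa x0 ^+ 2 * - (F x0 * curv i30 / q x0),
      Dv i32 kappa * b i30 x0 - Dv i30 kappa * b i32 x0 =
         kappa x0 ^+ 2 * - (F x0 * curv i31 / q x0) &
      Dv i30 kappa * b i31 x0 - Dv i31 kappa * b i30 x0 =
         kappa x0 ^+ 2 * - (F x0 * curv i32 / q x0)].

Lemma differentiable_a : differentiable (a : V -> R) x0.
Proof. by apply: differentiableN; exact: differentiableM. Qed.

Lemma dervMA (D : (V -> R) -> R) (f : V -> R) i k : derivation_at x0 D ->
  differentiable f x0 -> D (fun x => f x * A i k x) = f x0 * D (A i k).
Proof. by move=> dD df; rewrite (dervM dD)// A0 mulr0 add0r. Qed.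

Lemma Dva k : Dv k a = - (F x0 * Dv k kappa).
Proof.
have dM : differentiable (fun x => kappa x * F x) x0 by exact: differentiableM.
by rewrite (dervN (derv k) dM) (dervM (derv k) dkappa dF) DvF mulr0 addr0 mulrC.
Qed.

Lemma derv_qb (D : (V -> R) -> R) m : derivation_at x0 D ->
  D (fun x => q x * b m x) = D q * b m x0 + q x0 * D (b m).
Proof. by move=> dD; rewrite (dervM dD dq (db m)). Qed.

Lemma derv_Nqb (D : (V -> R) -> R) m : derivation_at x0 D ->
  D (fun x => - (q x * b m x)) = - (D q * b m x0 + q x0 * D (b m)).
Proof.
move=> dD; have dM : differentiable (fun x => q x * b m x) x0.
  by apply: differentiableM.
by rewrite (dervN dD dM) derv_qb.
Qed.

(** On the left, b_3 is multiplied only by the derivatives of A^1 along v_1 and of A^2 along v_2. In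
    [liehor] the derivative of A^3 along v_3 occurs once from d beta and once in the divergence
    coming from theta, and the two cancel. *)
Lemma lie_z01 i : Dh i (vbracket i30 i31)
  - (\sum_m vbracket i30 m x0 * Dv m (A i i31))
  + (\sum_m vbracket i31 m x0 * Dv m (A i i30)) = - (q x0 * liehor i i32).
Proof.
rewrite !sum3 /vbracket /= /liehor derv_Nqb//.
by field.
Qed.

Lemma lie_z12 i : Dh i (vbracket i31 i32)
  - (\sum_m vbracket i31 m x0 * Dv m (A i i32))
  + (\sum_m vbracket i32 m x0 * Dv m (A i i31)) = - (q x0 * liehor i i30).
Proof.
rewrite !sum3 /vbracket /= /liehor derv_Nqb//.
by field.
Qed.

Lemma lie_z02 i : Dh i (vbracket i30 i32)
  - (\sum_m vbracket i30 m x0 * Dv m (A i i32))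
  + (\sum_m vbracket i32 m x0 * Dv m (A i i30)) = q x0 * liehor i i31.
Proof.
rewrite !sum3 /vbracket /= /liehor derv_qb//.
by field.
Qed.

(** The derivatives of q cancel in the cyclic sum; what remains is - q^2 times the left-hand side of
    [eqA]. *)
Lemma vertical_jacobi :
  (\sum_m vbracket i30 m x0 * Dv m (vbracket i31 i32))
  + (\sum_m vbracket i31 m x0 * Dv m (vbracket i32 i30))
  + (\sum_m vbracket i32 m x0 * Dv m (vbracket i30 i31)) = 0.
Proof.
rewrite !sum3 /vbracket /= !derv_Nqb//.
apply: (etrans _ (mulr0 (- (q x0 ^+ 2)))); rewrite -[in RHS]eqA.
by ring.
Qed.

(** The sum is P_beta(dz_k, da) with a = - kappa F. Since F has no vertical derivative, it involves
    only that of kappa, and [eqC] expresses the result through the curvature. *)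
Lemma curvature_jacobi k :
  (- (kappa x0 * F x0)) ^+ 2 * curv k + \sum_m vbracket k m x0 * Dv m a = 0.
Proof.
rewrite sum3 !Dva; case: eqC => e0 e1 e2; move: k.
have sq (c u : R) : u = kappa x0 ^+ 2 * - (F x0 * c / q x0) ->
    (- (kappa x0 * F x0)) ^+ 2 * c = - F x0 * q x0 * u by move=> ->; field.
apply: ord3P; rewrite /vbracket /=.
- by rewrite (sq _ _ e0); ring.
- by rewrite (sq _ _ e1); ring.
- by rewrite (sq _ _ e2); ring.
Qed.

Lemma differentiable_vbracket k l : differentiable (vbracket k l) x0.
Proof.
have d m : differentiable (fun x => q x * b m x) x0 by exact: differentiableM.
have d' m : differentiable (fun x => - (q x * b m x)) x0 by exact: differentiableN.
move: k l; do 2! apply: ord3P; rewrite /vbracket /=;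
  first [exact: d|exact: d'|exact: differentiable_cst].
Qed.

Lemma vbracket_antisym k l x : vbracket k l x = - vbracket l k x.
Proof.
by move: k l; do 2! apply: ord3P; rewrite /vbracket /= ?opprK ?oppr0.
Qed.

Lemma derv_zero (D : (V -> R) -> R) : derivation_at x0 D -> D (fun=> 0) = 0.
Proof.
move=> dD; have d0 : differentiable (fun=> 0 : R) x0 by exact: differentiable_cst.
apply: etrans (etrans (dervM dD d0 d0) _); last by rewrite mulr0 mul0r addr0.
by apply: (derv_near dD); apply: eq_near1 => x; rewrite mulr0.
Qed.

Lemma liehor_zero i k l : (forall m, liehor i m = 0) ->
  Dh i (vbracket k l) - (\sum_m vbracket k m x0 * Dv m (A i l))
  + (\sum_m vbracket l m x0 * Dv m (A i k)) = 0.
Proof.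
move=> l0.
have anti k' l' : Dh i (vbracket k' l') = - Dh i (vbracket l' k').
  rewrite -(dervN (derh i) (differentiable_vbracket l' k')).
  by apply: (derv_near (derh i)); apply: eq_near1 => x; exact: vbracket_antisym.
have flip k' l' : Dh i (vbracket k' l') - (\sum_m vbracket k' m x0 * Dv m (A i l'))
  + (\sum_m vbracket l' m x0 * Dv m (A i k')) = 0 ->
  Dh i (vbracket l' k') - (\sum_m vbracket l' m x0 * Dv m (A i k'))
  + (\sum_m vbracket k' m x0 * Dv m (A i l')) = 0.
  rewrite (anti l' k') => e; apply/eqP; rewrite -oppr_eq0 -[eqbRHS]e; apply/eqP.
  by ring.
have diag k' : Dh i (vbracket k' k') - (\sum_m vbracket k' m x0 * Dv m (A i k'))
  + (\sum_m vbracket k' m x0 * Dv m (A i k')) = 0.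
  have h : Dh i (vbracket k' k') = 0.
    rewrite -(derv_zero (derh i)); apply: (derv_near (derh i)); apply: eq_near1 => x.
    by move: k'; apply: ord3P.
  by rewrite h sub0r addNr.
have z01 := lie_z01 i; have z02 := lie_z02 i; have z12 := lie_z12 i.
rewrite l0 mulr0 ?oppr0 in z01 z02 z12.
rewrite l0 mulr0 in z02; rewrite l0 mulr0 oppr0 in z12.
move: k l; do 2! apply: ord3P; first [exact: diag|exact: z01|exact: z02|exact: z12
  |exact: flip z01|exact: flip z02|exact: flip z12].
Qed.

Section Jacobi.
Variables (P : 'I_n -> 'I_n -> V -> R) (y : 'I_2 -> V -> R) (z : 'I_3 -> V -> R).
Hypotheses (dP : forall i j, differentiable (P i j) x0)
  (antiP : \forall x \near x0, forall i j, P i j x = - P j i x)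
  (dy : forall j, twice_diff (y j) x0) (dz : forall k, twice_diff (z k) x0).
(** Outer brackets are needed only at [x0], where the frame turns them into derivations; inner
    brackets are differentiated and must be known in a neighbourhood. *)
Hypotheses
  (brk_y0 : forall f, differentiable f x0 -> brk P (y i20) f x0 = a x0 * Dh i21 f)
  (brk_y1 : forall f, differentiable f x0 -> brk P (y i21) f x0 = - (a x0 * Dh i20 f))
  (brk_z : forall k f, differentiable f x0 ->
     brk P (z k) f x0 = \sum_m vbracket k m x0 * Dv m f).
Hypotheses
  (brk_yy : {near x0, brk P (y i20) (y i21) =1 a})
  (brk_y0z : forall k, {near x0, brk P (y i20) (z k) =1 fun x => a x * A i21 k x})
  (brk_y1z : forall k, {near x0, brk P (y i21) (z k) =1 fun x => - (a x * A i20 k x)})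
  (brk_zz : forall k l, {near x0, brk P (z k) (z l) =1 fun x =>
     a x * (A i20 k x * A i21 l x + - (A i20 l x * A i21 k x)) + vbracket k l x}).
Hypothesis eqB : forall i m, kappa x0 * liehor i m = 0.

Lemma jacobi_yyz k : jacobiator P (y i20) (y i21) (z k) x0 = 0.
Proof.
rewrite /jacobiator (brk_flip dP antiP (y i21) (dz k) (dy i20)).
rewrite brk_y0 ?brk_y1 ?brk_z; try exact: (differentiable_brk dP).
rewrite (derv_near (derh _) (brk_y1z k)) (derv_near (derh _) (brk_y0z k)).
have dM : differentiable (fun x => a x * A i20 k x) x0.
  by apply: differentiableM => //; exact: differentiable_a.
rewrite (dervN (derh _) dM) !(dervMA _ _ (derh _) differentiable_a).
under eq_bigr do rewrite (derv_near (derv _) brk_yy).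
by rewrite -[RHS](curvature_jacobi k) /curv; ring.
Qed.

(** The horizontal contribution to {z_k, z_l} is quadratic in A, hence vanishes to second order at
    [x0]. *)
Lemma derv_zz (D : (V -> R) -> R) k l : derivation_at x0 D ->
  D (brk P (z k) (z l)) = D (vbracket k l).
Proof.
move=> dD; rewrite (derv_near dD (brk_zz k l)).
have dAA i j k' l' : differentiable (fun x => A i k' x * A j l' x) x0.
  exact: differentiableM.
have dNAA i j k' l' : differentiable (fun x => - (A i k' x * A j l' x)) x0.
  by apply: differentiableN; exact: dAA.
have dS : differentiable (fun x => A i20 k x * A i21 l x + - (A i20 l x * A i21 k x)) x0.
  by apply: differentiableD; [exact: dAA|exact: dNAA].
rewrite (dervD dD); [|exact: (differentiableM differentiable_a dS)
  |exact: differentiable_vbracket].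
rewrite (dervM dD differentiable_a dS) (dervD dD (dAA _ _ _ _) (dNAA _ _ _ _)).
rewrite (dervN dD (dAA _ _ _ _)) !dervMA// !A0; ring.
Qed.

(** The brackets of y with z are multiples of a A, and A vanishes at [x0]: the factor a is never
    differentiated and comes out in front. *)
Lemma jacobi_y0zz k l : jacobiator P (y i20) (z k) (z l) x0 =
  a x0 * (Dh i21 (vbracket k l) - (\sum_m vbracket k m x0 * Dv m (A i21 l))
  + (\sum_m vbracket l m x0 * Dv m (A i21 k))).
Proof.
rewrite /jacobiator (brk_flip dP antiP (z k) (dz l) (dy i20)).
rewrite brk_y0 ?brk_z; try exact: (differentiable_brk dP).
rewrite derv_zz// mulrDr mulrBr !mulr_sumr; congr (_ - _ + _); apply: eq_bigr => m _.
  rewrite (derv_near (derv _) (brk_y0z l)) (dervMA _ _ (derv _) differentiable_a).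
  by ring.
rewrite (derv_near (derv _) (brk_y0z k)) (dervMA _ _ (derv _) differentiable_a).
by ring.
Qed.

Lemma jacobi_y1zz k l : jacobiator P (y i21) (z k) (z l) x0 =
  - (a x0 * (Dh i20 (vbracket k l) - (\sum_m vbracket k m x0 * Dv m (A i20 l))
  + (\sum_m vbracket l m x0 * Dv m (A i20 k)))).
Proof.
have dM k' : differentiable (fun x => a x * A i20 k' x) x0.
  by apply: differentiableM => //; exact: differentiable_a.
rewrite /jacobiator (brk_flip dP antiP (z k) (dz l) (dy i21)).
rewrite brk_y1 ?brk_z; try exact: (differentiable_brk dP).
have e k' l' : \sum_m vbracket k' m x0 * Dv m (brk P (y i21) (z l')) =
    - (a x0 * \sum_m vbracket k' m x0 * Dv m (A i20 l')).
  rewrite mulr_sumr -sumrN; apply: eq_bigr => m _.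
  rewrite (derv_near (derv _) (brk_y1z l')) (dervN (derv _) (dM l')).
  by rewrite (dervMA _ _ (derv _) differentiable_a); ring.
by rewrite derv_zz// !e; ring.
Qed.

Lemma jacobi_zzz : jacobiator P (z i30) (z i31) (z i32) x0 = 0.
Proof.
rewrite /jacobiator !brk_z; try exact: (differentiable_brk dP).
rewrite -[RHS]vertical_jacobi; congr (_ + _ + _); apply: eq_bigr => m _;
  by rewrite derv_zz.
Qed.

Lemma a_liehor i m : a x0 * liehor i m = 0.
Proof. by rewrite /= mulNr mulrAC eqB mul0r oppr0. Qed.

Lemma jacobi_yzz i (k l : 'I_3) : (k < l)%N -> jacobiator P (y i) (z k) (z l) x0 = 0.
Proof.
move: i k l; apply: ord2P; do 2! apply: ord3P; rewrite //= => _;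
  rewrite ?jacobi_y0zz ?jacobi_y1zz ?lie_z01 ?lie_z02 ?lie_z12;
  rewrite ?mulrN mulrCA a_liehor mulr0 ?oppr0 //.
Qed.

End Jacobi.

(** * Lie derivative of P_beta along a horizontal lift, in adapted coordinates *)

Section Connection.
Variables (P : 'I_n -> 'I_n -> V -> R) (y : 'I_2 -> V -> R) (z : 'I_3 -> V -> R).
Variables (X : 'I_n -> V -> R) (u : 'I_2 -> V -> R).
Hypotheses
  (antiP : \forall x \near x0, forall i j, P i j x = - P j i x)
  (du : forall i, differentiable (u i) x0)
  (Dvu : forall k i, Dv k (u i) = 0).
Hypotheses
  (brk_y : forall j f, {near x0, brk P (y j) f =1 fun=> 0})
  (brk_z : forall k f, differentiable f x0 ->
     brk P (z k) f x0 = \sum_m vbracket k m x0 * Dv m f)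
  (brk_zz : forall k l, {near x0, brk P (z k) (z l) =1 vbracket k l})
  (X_der : forall f, differentiable f x0 -> vder X f x0 = \sum_i u i x0 * Dh i f)
  (X_y : forall j, {near x0, vder X (y j) =1 u j})
  (X_z : forall k, {near x0, vder X (z k) =1 fun x => \sum_i u i x * A i k x}).
Hypothesis eqB : forall i m, liehor i m = 0.

Let lie f h := vder X (brk P f h) x0 - brk P (vder X f) h x0 - brk P f (vder X h) x0.

Lemma brk_fy j f : brk P f (y j) x0 = 0.
Proof.
rewrite (nbhs_singleton (brk_antisym antiP _ _)) (nbhs_singleton (brk_y j f)).
by rewrite oppr0.
Qed.

Lemma X_zero f : {near x0, f =1 fun=> 0} -> vder X f x0 = 0.
Proof.
move=> f0; rewrite (vder_near X f0) X_der; last exact: differentiable_cst.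
by rewrite big1// => i _; rewrite (derv_zero (derh i)) mulr0.
Qed.

Lemma brk_zu k i f : {near x0, f =1 u i} -> brk P (z k) f x0 = 0.
Proof.
move=> e; rewrite (brk_near _ _ e) brk_z// big1// => m _; by rewrite Dvu mulr0.
Qed.

Lemma lie_yz j k : lie (y j) (z k) = 0.
Proof.
rewrite /lie (X_zero (brk_y j (z k))) (nbhs_singleton (brk_y j _)).
rewrite (nbhs_singleton (brk_antisym antiP _ _)) (brk_zu k (X_y j)).
by rewrite oppr0 !subr0 addr0.
Qed.

Lemma lie_zy j k : lie (z k) (y j) = 0.
Proof.
rewrite /lie brk_fy (brk_zu k (X_y j)) X_zero ?subr0//.
apply: filterS2 (brk_antisym antiP (z k) (y j)) (brk_y j (z k)) => x -> ->.
by rewrite oppr0.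
Qed.

Lemma lie_yy i j : lie (y i) (y j) = 0.
Proof.
by rewrite /lie (X_zero (brk_y i (y j))) brk_fy (nbhs_singleton (brk_y i _)) !subr0.
Qed.

(** As A vanishes at [x0], the derivatives of [u] drop out, and the expression is the combination
    with coefficients u_i of the left-hand sides of [liehor_zero]. *)
Lemma lie_zz k l : lie (z k) (z l) = 0.
Proof.
have dS k' : differentiable (fun x => \sum_i u i x * A i k' x) x0.
  by apply: diff_sum => i _; exact: differentiableM.
have DS m k' : Dv m (fun x => \sum_i u i x * A i k' x) = \sum_i u i x0 * Dv m (A i k').
  have -> : Dv m (fun x => \sum_i u i x * A i k' x) =
            Dv m (fun x => u i20 x * A i20 k' x + u i21 x * A i21 k' x).
    by apply: (derv_near (derv m)); apply: eq_near1 => x; rewrite sum2.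
  by rewrite (dervD (derv m)) ?dervMA ?sum2//; exact: differentiableM.
rewrite /lie (vder_near X (brk_zz k l)) (X_der (differentiable_vbracket k l)).
rewrite (nbhs_singleton (brk_antisym antiP _ _)).
rewrite (brk_near P (z l) (X_z k)) (brk_near P (z k) (X_z l)) !brk_z//.
under [X in _ - - X - _]eq_bigr do rewrite DS.
under [X in _ - X]eq_bigr do rewrite DS.
have s k' l' : \sum_m vbracket k' m x0 * (\sum_i u i x0 * Dv m (A i l')) =
  \sum_i u i x0 * \sum_m vbracket k' m x0 * Dv m (A i l').
  under eq_bigr do rewrite mulr_sumr.
  rewrite exchange_big; apply: eq_bigr => i _; rewrite mulr_sumr.
  by apply: eq_bigr => m _; ring.
rewrite !s opprK -big_split -sumrB big1// => i _ /=.
rewrite -mulrDr -mulrBr addrAC.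
by rewrite (liehor_zero k l (eqB i)) mulr0.
Qed.

End Connection.

End LocalModel.

(** * Bundle charts and exterior derivatives *)

Section BundleCharts.
Variables (R : realType) (n m : nat) (M : manifold R n) (B : manifold R m).
Variable pi : M -> B.
Hypothesis spi : smooth_map pi.

Definition ymap (c : chart R M n) (c' : chart R B m) : 'rV[R]_n -> 'rV[R]_m :=
  cfun c' \o pi \o cinv c.

Definition over (c' : chart R B m) : set M := pi @^-1` cdom c'.

Lemma over_open c' : open (over c').
Proof. by apply: open_comp; [move=> x _; exact: spi.1|exact: cdom_open]. Qed.

Lemma ymap_smooth c c' : atlas c -> atlas c' ->
  Csmooth_map (cimg c (over c')) (ymap c c').
Proof. exact: spi.2. Qed.

Lemma ymap_diff c c' p : atlas c -> atlas c' -> cdom c p -> over c' p ->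
  differentiable (ymap c c') (cfun c p).
Proof.
move=> ac ac' cp op; apply: differentiable_rowP => j.
by have [d _] := ymap_smooth ac ac' j 1%N; apply: d; exact: cimg_in.
Qed.

Definition dymap c c' p := jacobian (ymap c c') (cfun c p).

Lemma dymap_comp c d c' d' p : atlas c -> atlas d -> atlas c' -> atlas d' ->
  cdom c p -> cdom d p -> over c' p -> over d' p ->
  dymap c c' p = jtr c d p *m dymap d d' p *m jtr d' c' (pi p).
Proof.
move=> ac ad ac' ad' cp dp op op'.
have d1 := trans_diff ac ad cp dp.
have d2 := ymap_diff ad ad' dp op'.
have d3 := trans_diff ad' ac' op' op.
have e1 : trans c d (cfun c p) = cfun d p by rewrite /trans /= cfunK.
have e2 : ymap d d' (cfun d p) = cfun d' (pi p) by rewrite /ymap /= cfunK.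
have d2' : differentiable (ymap d d') (trans c d (cfun c p)) by rewrite e1.
have d12 := differentiable_comp d1 d2'.
have e12 : (ymap d d' \o trans c d) (cfun c p) = cfun d' (pi p) by rewrite /= e1.
have d3' : differentiable (trans d' c') ((ymap d d' \o trans c d) (cfun c p)).
  by rewrite e12.
have := jacobian_comp d12 d3'; rewrite (jacobian_comp d1 d2') e12 e1 => h.
apply: etrans _ h; apply/esym; apply: jacobian_near; last exact: differentiable_comp.
have oW : open (over c' `&` over d' `&` cdom d).
  by apply: openI; [apply: openI; exact: over_open|exact: cdom_open].
apply: filterS (near_chart oW cp _) => // x /cimgP[cx [[ox ox'] dx] ex].
by rewrite /ymap /trans /= !cfunK.
Qed.

Lemma tangentE p : tangent pi p = dymap (chart_at p) (chart_at (pi p)) p.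
Proof. by []. Qed.

Lemma over_chart_at p : over (chart_at (pi p)) p.
Proof. exact: cdom_chart_at. Qed.

Lemma dymap_tangent c c' p : atlas c -> atlas c' -> cdom c p -> over c' p ->
  dymap c c' p = jac c p *m tangent pi p *m invmx (jac c' (pi p)).
Proof.
move=> ac ac' cp op; rewrite tangentE (jac_inv ac' op) jacE.
apply: dymap_comp => //; try exact: atlas_chart_at.
  exact: cdom_chart_at.
exact: over_chart_at.
Qed.

Lemma dymap_entry c c' p i j : atlas c -> atlas c' -> cdom c p -> over c' p ->
  dymap c c' p i j = pd i (fun x => ymap c c' x 0 j) (cfun c p).
Proof. by move=> ac ac' cp op; exact: jacobianE (ymap_diff ac ac' cp op). Qed.

End BundleCharts.

Section Transport.
Variables (R : realType).

Lemma frame_transport n m (T : 'M[R]_(n, m)) g h (J : 'M[R]_n) (K : 'M[R]_m) :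
  J \in unitmx -> K \in unitmx -> frame T g h ->
  frame (J *m T *m invmx K) (J *m g *m invmx J) (K *m h *m invmx J).
Proof.
move=> uJ uK [hT hg s]; split.
- by rewrite -!mulmxA (mulKmx uJ) (mulmxA h) hT mul1mx mulmxV.
- by rewrite -!mulmxA (mulKmx uJ) (mulmxA h) hg mul0mx mulmx0.
rewrite -!mulmxA (mulKmx uK) (mulmxA T) -mulmxDr -mulmxDl s mul1mx.
by rewrite mulmxV.
Qed.

End Transport.

Section ExteriorDerivative.
Variables (R : realType) (n : nat) (M : manifold R n).

Lemma Csmooth_chart_diff (c : chart R M n) (f : 'rV[R]_n -> R) p :
  Csmooth (cimg c setT) f -> cdom c p -> differentiable f (cfun c p).
Proof. by move=> sf cp; have [d _] := sf 1%N; apply: d; exact: cimg_in. Qed.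

Lemma ext_d_alternating k (a : dform M k) p : is_form setT a -> alternating (ext_d a p).
Proof.
move=> [aa sa].
have d v : differentiable (form_in (chart_at p) a v) (coord p).
  apply: Csmooth_chart_diff; last exact: cdom_chart_at.
  by apply: sa; exact: atlas_chart_at.
apply: (antisymmetrization_alternating
  (D := fun u v => 'D_u (form_in (chart_at p) a v) (coord p))) => [u|e u w v].
  split=> [v i e x y|v i j ij e].
    have -> : form_in (chart_at p) a (upd v i (e *: x + y)) =
      (fun z => e * form_in (chart_at p) a (upd v i x) z
                + form_in (chart_at p) a (upd v i y) z).
      apply/funext => z.
      exact: (form_in_alternating (c := chart_at p) (aa (cinv (chart_at p) z) I)).1.
    rewrite derD; [|by apply: differentiableM => //; exact: differentiable_cst|exact: d].
    rewrite derM; [|exact: differentiable_cst|exact: d].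
    by rewrite derive_cst mul0r add0r.
  have -> : form_in (chart_at p) a v = (fun=> 0).
    apply/funext => z.
    exact: (form_in_alternating (c := chart_at p) (aa (cinv (chart_at p) z) I)).2 _ i j ij e.
  exact: derive_cst.
by rewrite (deriveE _ (d v)) linearP (deriveE _ (d v)) (deriveE _ (d v)).
Qed.

Lemma alternating_sum2 (V : lmodType R) (D : V -> ('I_1 -> V) -> R) u w :
  \sum_(i < 2) (-1) ^+ i * D (args [:: u; w] i) (fun j => args [:: u; w] (lift i j)) =
  D u (args [:: w]) - D w (args [:: u]).
Proof.
rewrite !big_ord_recl big_ord0 addr0 expr0 expr1 mul1r mulN1r.
by congr (D _ _ - D _ _); exact: args1.
Qed.

Lemma alternating_sum4 (V : lmodType R) (D : V -> ('I_3 -> V) -> R) u v w z :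
  \sum_(i < 4) (-1) ^+ i *
    D (args [:: u; v; w; z] i) (fun j => args [:: u; v; w; z] (lift i j)) =
  D u (args [:: v; w; z]) - D v (args [:: u; w; z])
  + D w (args [:: u; v; z]) - D z (args [:: u; v; w]).
Proof.
rewrite !big_ord_recl big_ord0 addr0 !addrA.
rewrite -[lift ord0 (ord0 : 'I_3) : nat]/1%N.
rewrite -[lift ord0 (lift ord0 (ord0 : 'I_2)) : nat]/2%N.
rewrite -[lift ord0 (lift ord0 (lift ord0 (ord0 : 'I_1))) : nat]/3%N.
rewrite expr0 expr1 sqrrN expr1n exprS sqrrN expr1n mulr1 !mul1r !mulN1r.
by congr (D _ _ - D _ _ + D _ _ - D _ _); exact: args3.
Qed.

Lemma ext_d1 (a : dform M 1) p u w : ext_d a p (args [:: u; w]) =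
  'D_u (form_in (chart_at p) a (args [:: w])) (coord p)
  - 'D_w (form_in (chart_at p) a (args [:: u])) (coord p).
Proof.
exact: (alternating_sum2 (fun u l => 'D_u (form_in (chart_at p) a l) (coord p))).
Qed.

Lemma ext_d3 (a : dform M 3) p u v w z : ext_d a p (args [:: u; v; w; z]) =
  'D_u (form_in (chart_at p) a (args [:: v; w; z])) (coord p)
  - 'D_v (form_in (chart_at p) a (args [:: u; w; z])) (coord p)
  + 'D_w (form_in (chart_at p) a (args [:: u; v; z])) (coord p)
  - 'D_z (form_in (chart_at p) a (args [:: u; v; w])) (coord p).
Proof.
exact: (alternating_sum4 (fun u l => 'D_u (form_in (chart_at p) a l) (coord p))).
Qed.

Lemma ext_d0 (f : M -> R) p u : ext_d (fun_form f) p (args [:: u]) =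
  'D_u (f \o cinv (chart_at p)) (coord p).
Proof. by rewrite /ext_d big_ord_recl big_ord0 addr0 expr0 mul1r. Qed.

End ExteriorDerivative.

Section FourForms.
Variables (R : realType) (V : lmodType R).

Lemma ord4P (P : 'I_4 -> Prop) : P ord0 -> P (@Ordinal 4 1 isT) ->
  P (@Ordinal 4 2 isT) -> P (@Ordinal 4 3 isT) -> forall i, P i.
Proof.
by move=> h0 h1 h2 h3 [[|[|[|[|//]]]] hi];
  [move: h0|move: h1|move: h2|move: h3]; congr P; apply: val_inj.
Qed.

Lemma alternating4_swap01 (a : kform V 4) x y z w : alternating a ->
  a (args [:: y; x; z; w]) = - a (args [:: x; y; z; w]).
Proof.
move=> aa; rewrite -(alternating_tperm (args [:: x; y; z; w]) aa
  (isT : (ord0 : 'I_4) != @Ordinal 4 1 isT)).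
by congr a; apply: funord; apply: ord4P; rewrite ?tpermL ?tpermR ?tpermD.
Qed.

Lemma alternating4_swap12 (a : kform V 4) x y z w : alternating a ->
  a (args [:: x; z; y; w]) = - a (args [:: x; y; z; w]).
Proof.
move=> aa; rewrite -(alternating_tperm (args [:: x; y; z; w]) aa
  (isT : @Ordinal 4 1 isT != @Ordinal 4 2 isT)).
by congr a; apply: funord; apply: ord4P; rewrite ?tpermL ?tpermR ?tpermD.
Qed.

Lemma alternating4_swap03 (a : kform V 4) x y z w : alternating a ->
  a (args [:: w; y; z; x]) = - a (args [:: x; y; z; w]).
Proof.
move=> aa; rewrite -(alternating_tperm (args [:: x; y; z; w]) aa
  (isT : ord0 != @Ordinal 4 3 isT)).
by congr a; apply: funord; apply: ord4P; rewrite ?tpermL ?tpermR ?tpermD.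
Qed.

Lemma form_comp_adapted n (g : 'M[R]_n) p q (a : kform 'rV[R]_n (p + q))
    (v : 'I_(p + q) -> 'rV[R]_n) (S : {set 'I_(p + q)}) :
  alternating a -> #|S| = p -> (forall i, i \in S -> v i *m g = 0) ->
  (forall i, i \notin S -> v i *m g = v i) -> form_comp g p q a v = a v.
Proof.
move=> aa cS hS hN; apply: (component_adapted aa cS) => [i iS|i iS].
  by rewrite mulmxBr mulmx1 hS// subr0.
by rewrite mulmxBr mulmx1 hN// subrr.
Qed.

End FourForms.

(** * Locality of the Jacobi identity, and vectors determined by pairings *)

Section LocalTensors.
Variables (R : realType) (n : nat) (M : manifold R n).

Lemma grad_local (W : set M) (f h : M -> R) p : open W -> W p ->
  (forall q, W q -> f q = h q) -> grad f p = grad h p.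
Proof.
move=> oW Wp e; rewrite !covec_ext_d; apply/matrixP => i j; rewrite [LHS]mxE [RHS]mxE.
apply: near_eq_derive; apply: filterS (near_chart oW (cdom_chart_at p) Wp) => x.
by move=> /cimgP[_ Wx _]; exact: e.
Qed.

(** Agreement of the tensors at one point would not be enough, since the inner bracket is
    differentiated; on an open set the inner brackets agree near the point, and so do their
    gradients. *)
Lemma poisson_tensor_local (V : set M) (P Q : mvec M 2) : open V ->
  (forall p, V p -> P p = Q p) -> poisson_tensor V P -> poisson_tensor V Q.
Proof.
move=> oV e [[aP sP] jP]; split.
  split=> [p Vp|c ac xi k]; first by rewrite -e//; exact: aP.
  apply: (Ck_ext (cimg_open (U := V) oV) (f' := mvec_in c P xi)); last exact: sP.
  by move=> x /cimgP[_ Vx _]; rewrite /mvec_in e.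
move=> W f g h oW WV sf sg sh p Wp.
have b f1 f2 q : W q -> bracket Q f1 f2 q = bracket P f1 f2 q.
  by move=> Wq; rewrite /bracket e//; exact: WV.
have b2 f1 f2 f3 : bracket Q f1 (bracket Q f2 f3) p = bracket P f1 (bracket P f2 f3) p.
  by rewrite b// /bracket -(grad_local oW Wp (b f2 f3)).
by rewrite !b2; exact: (jP W).
Qed.

Lemma vecE k (a : kform 'cV[R]_k 1) (ze : 'cV[R]_k) :
  alternating a -> pairing (vec a) ze = a (args [:: ze]).
Proof.
move=> aa; have -> : args [:: ze] = (fun i : 'I_1 => \sum_j (\matrix_(i, j) ze j 0) i j *: ecovec R j).
  apply/esym/args1; apply/matrixP => i j; rewrite (ord1 j) summxE (bigD1 i)//= big1 ?addr0.
    by rewrite !mxE !eqxx mulr1.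
  by move=> l li; rewrite !mxE eq_sym (negPf li) mulr0.
rewrite multilinear_expand// pairingE.
pose mk j : {ffun 'I_1 -> 'I_k} := [ffun=> j].
rewrite (reindex mk) /=; last first.
  exists (fun s : {ffun 'I_1 -> 'I_k} => s ord0) => [j _|s _]; first by rewrite ffunE.
  by apply/ffunP => i; rewrite ffunE (ord1 i).
apply: eq_bigr => j _; rewrite big_ord_recl big_ord0 mulr1 mxE mulrC mxE ffunE; congr (_ * _).
by congr a; apply: funord => i; rewrite ffunE.
Qed.

Lemma row_pairing_eq k (v w : 'rV[R]_k) :
  (forall xi : 'cV[R]_k, pairing v xi = pairing w xi) -> v = w.
Proof.
by move=> e; apply/matrixP => i j; rewrite (ord1 i) -!pairing_ecovec; exact: e.
Qed.

Lemma col_pairing_eq k (xi ze : 'cV[R]_k) :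
  (forall v : 'rV[R]_k, pairing v xi = pairing v ze) -> xi = ze.
Proof.
by move=> e; apply/matrixP => i j; rewrite (ord1 j) -!pairing_evec; exact: e.
Qed.

Lemma plane_form (a : kform 'rV[R]_2 2) v : alternating a ->
  a v = (v i20 0 i20 * v i21 0 i21 - v i20 0 i21 * v i21 0 i20) *
        a (args [:: evec R i20; evec R i21]).
Proof.
move=> aa; have := form_det 1%:M 1%:M v aa.
have -> : (fun i => v i *m (1%:M *m 1%:M)) = v.
  by apply: funord => i; rewrite !mulmx1.
move=> ->; rewrite det2 !mxE !pairing_col !mulmx1; congr (_ * a _).
by apply: args2; rewrite rowE mulmx1.
Qed.

End LocalTensors.

(** * Poisson triples *)

Section TripleData.
Variables (R : realType) (M : manifold R 5) (B : manifold R 2)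
    (pi : M -> B) (Omega : dform M 5) (omega : dform B 2)
    (g : endo M) (kappa : M -> R) (beta : dform M 1)
    (OmegaV : dform M 3) (QH : mvec M 2) (QV : mvec M 3) (psi : mvec B 2).
Hypotheses (hpi : fiber_bundle pi) (homega : volume_form omega)
    (hsplit : splitting pi Omega omega g OmegaV QH QV psi)
    (htriple : poisson_triple pi OmegaV QH QV g kappa beta).

Let Pi := triple_tensor pi QV psi g kappa beta.
Let Pbeta := P_ QV beta.

Lemma triple_frame p : frame (tangent pi p) (g p) (hor pi g p).
Proof.
have [_ _ fT] := hpi; have [_ /(_ p I) [gv vg]] := triple_connection htriple.
apply: frame_of_connection => //.
by apply/row_matrixP => i; rewrite row_mul rowE row0; exact: gv.
Qed.

Lemma triple_rank p : (\rank (g p) = 3)%N.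
Proof. exact: (frame_rank (triple_frame p)). Qed.

Lemma QH_alt p : alternating (QH p). Proof. exact: (QH_bideg hsplit).1.1. Qed.
Lemma QV_alt p : alternating (QV p). Proof. exact: (QV_bideg hsplit).1.1. Qed.
Lemma OmegaV_alt p : alternating (OmegaV p).
Proof. exact: (OmegaV_bideg hsplit).1.1. Qed.
Lemma psi_alt b : alternating (psi b). Proof. exact: (psi_mvec hsplit).1. Qed.
Lemma beta_alt p : alternating (beta p).
Proof. exact: (triple_bideg htriple).1.1. Qed.
Lemma omega_alt b : alternating (omega b). Proof. exact: homega.1.1. Qed.

Lemma QH_comp p : mvec_comp (g p) 2 0 (QH p) = QH p.
Proof. exact: (QH_bideg hsplit).2. Qed.
Lemma QV_comp p : mvec_comp (g p) 0 3 (QV p) = QV p.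
Proof. exact: (QV_bideg hsplit).2. Qed.
Lemma OmegaV_comp p : form_comp (g p) 0 3 (OmegaV p) = OmegaV p.
Proof. exact: (OmegaV_bideg hsplit).2. Qed.
Lemma beta_comp p : form_comp (g p) 0 1 (beta p) = beta p.
Proof. exact: (triple_bideg htriple).2. Qed.

Lemma Pbeta_args p xi ze :
  Pbeta p (args [:: xi; ze]) = - QV p (args [:: covec (beta p); xi; ze]).
Proof. by rewrite /Pbeta /P_ ins_args. Qed.

Lemma Pbeta_alt p : alternating (Pbeta p).
Proof.
have [lin alt] := ins_alternating (covec (beta p)) (QV_alt p).
split=> [v i c x y|v i j ij e]; rewrite /Pbeta /P_.
  by rewrite lin opprD mulrN.
by rewrite (alt v i j ij e) oppr0.
Qed.

Lemma Pbeta_vertical p xi ze :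
  Pbeta p (args [:: xi; ze]) = Pbeta p (args [:: g p *m xi; g p *m ze]).
Proof.
rewrite !Pbeta_args (vertical_mvec (QV_comp p)) [in RHS](vertical_mvec (QV_comp p)).
congr (- QV p _); apply: funord; apply: ord3P; rewrite /args //=.
  by rewrite mulmxA (frame_gg (triple_frame p)).
by rewrite mulmxA (frame_gg (triple_frame p)).
Qed.

Definition omega_val b := omega b (args [:: evec R i20; evec R i21]).
Definition QH_val p := QH p (args [:: col i20 (tangent pi p); col i21 (tangent pi p)]).

Lemma QH_det p xi :
  QH p xi = \det (\matrix_(i, j) pairing (row j (hor pi g p)) (xi i)) * QH_val p.
Proof. exact: (horizontal_bivector (triple_frame p) (QH_alt p) (QH_comp p)). Qed.

Lemma QH_val_omega p : QH_val p * omega_val (pi p) = -1.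
Proof.
apply: (bivector_volume (frame_hT (triple_frame p)) (omega_alt _) (QH_det p)).
exact: (QH_eq hsplit).
Qed.

Lemma psi_det b (xi : 'I_2 -> 'cV[R]_2) : psi b xi =
  \det (\matrix_(i, j) pairing (row j 1%:M) (xi i)) *
  psi b (args [:: ecovec R i20; ecovec R i21]).
Proof.
have := mvec_det 1%:M 1%:M xi (psi_alt b).
have -> : (fun i => 1%:M *m 1%:M *m xi i) = xi.
  by apply: funord => i; rewrite !mul1mx.
by move=> ->; congr (_ * psi b _); apply: args2; rewrite colE mul1mx.
Qed.

Lemma psi_val_omega b :
  psi b (args [:: ecovec R i20; ecovec R i21]) * omega_val b = 1.
Proof.
have h := @bivector_volume _ _ 1%:M 1%:M (psi b) (omega b) _ (-1) (mulmx1 _)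
  (omega_alt b) (psi_det b).
rewrite h ?opprK// -(psi_eq hsplit b); congr (contract 0 _ _).
by apply/funext => v; congr (omega b); apply: funord => i; rewrite mulmx1.
Qed.

Lemma omega_val_neq0 b : omega_val b != 0.
Proof.
by apply/eqP => e; have := psi_val_omega b; rewrite e mulr0 => /eqP; rewrite eq_sym oner_eq0.
Qed.

Lemma hor_psi p xi : hor_mvec pi g psi p xi = - QH p xi.
Proof.
rewrite /hor_mvec psi_det QH_det -mulrN; congr (\det _ * _).
  apply/matrixP => i j; rewrite !mxE /pairing mulmxA; congr (_ 0 0).
  by rewrite -!row_mul mul1mx.
apply: (mulIf (omega_val_neq0 (pi p))).
by rewrite psi_val_omega mulNr QH_val_omega opprK.
Qed.

Lemma Pi_eq p xi : Pi p xi = - (kappa p * QH p xi) + Pbeta p xi.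
Proof. by rewrite /Pi /triple_tensor hor_psi mulrN. Qed.

Lemma Pi_alt p : alternating (Pi p).
Proof.
have [lh ah] := QH_alt p; have [lb ab] := Pbeta_alt p.
split=> [v i c x y|v i j ij e]; rewrite !Pi_eq.
  by rewrite lh lb; ring.
by rewrite (ah v i j ij e) (ab v i j ij e) mulr0 oppr0 addr0.
Qed.

(** * Coordinate expressions in a chart of M and a chart of B *)

Section InCharts.
Variables (c : chart R M 5) (c' : chart R B 2).
Hypotheses (ac : atlas c) (ac' : atlas c').

(** [hc], [Tc] and [gc] are the matrices of the horizontal lift, of d pi and of the connection in
    the charts c and c'. They serve for pointwise identities; differentiability is obtained from
    [hcov_in], which agrees with the entries of [hc]. *)
Definition hc p := jac c' (pi p) *m hor pi g p *m invmx (jac c p).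
Definition Tc p := dymap pi c c' p.
Definition gc p := endo_in c g (cfun c p).

Let smooth_pi : smooth_map pi. Proof. by case: hpi. Qed.

Definition dom_cc : set M := cdom c `&` over pi c'.

Lemma Tc_eq p : dom_cc p -> Tc p = jac c p *m tangent pi p *m invmx (jac c' (pi p)).
Proof. by move=> [cp op]; exact: dymap_tangent. Qed.

Lemma gc_eq p : cdom c p -> gc p = jac c p *m g p *m invmx (jac c p).
Proof. by move=> cp; rewrite /gc /endo_in cfunK. Qed.

Lemma chart_frame p : dom_cc p -> frame (Tc p) (gc p) (hc p).
Proof.
move=> [cp op]; rewrite Tc_eq// gc_eq//; apply: frame_transport.
- exact: jac_unit.
- exact: jac_unit.
- exact: triple_frame.
Qed.

Lemma mvec_in_at k (Q : mvec M k) xi p : cdom c p ->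
  mvec_in c Q xi (cfun c p) = Q p (fun i => invmx (jac c p) *m xi i).
Proof. by move=> cp; rewrite /mvec_in cfunK. Qed.

Lemma form_in_at k (a : dform M k) v p : cdom c p ->
  form_in c a v (cfun c p) = a p (fun i => v i *m jac c p).
Proof. by move=> cp; rewrite /form_in cfunK. Qed.

(* Q_H(dy_1, dy_2), by i_(Q_H) (pi^* omega) = 1; the sign comes from the reversed
   order of the arguments in [contract]. *)
Definition F_in (x : 'rV[R]_5) : R :=
  - (form_in c' omega (args [:: evec R i20; evec R i21]) (ymap pi c c' x))^-1.

Lemma omega_in p : over pi c' p ->
  form_in c' omega (args [:: evec R i20; evec R i21]) (cfun c' (pi p)) =
  \det (jac c' (pi p)) * omega_val (pi p).
Proof.
move=> op; rewrite /form_in cfunK//; move: (jac c' (pi p)) => K.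
rewrite /omega_val.
have := alternating_det K (args [:: evec R i20; evec R i21]) (omega_alt (pi p)).
move=> <-; congr (omega _); apply: funord => i.
have e j : args [:: evec R i20; evec R i21] j = evec R j by move: j; apply: ord2P.
rewrite e -rowE [LHS]row_sum_delta; apply: eq_bigr => j _.
by rewrite e mxE.
Qed.

Lemma ymap_at p : cdom c p -> ymap pi c c' (cfun c p) = cfun c' (pi p).
Proof. by move=> cp; rewrite /ymap /= cfunK. Qed.

Lemma QH_in p xi : dom_cc p -> mvec_in c QH xi (cfun c p) =
  \det (\matrix_(i, j) pairing (row j (hc p)) (xi i)) * F_in (cfun c p).
Proof.
move=> dp; have [cp op] := dp; rewrite mvec_in_at// QH_det.
rewrite /F_in ymap_at// omega_in// invfM.
have uK := jac_unit ac' op.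
have -> : \matrix_(i, j) pairing (row j (hc p)) (xi i) =
  \matrix_(i, j) pairing (row j (hor pi g p)) (invmx (jac c p) *m xi i) *m (jac c' (pi p))^T.
  apply/matrixP => i j; rewrite mxE [RHS]mxE pairing_row /hc.
  move: (hor pi g p) (invmx _) (jac c' _) => H J K; rewrite -!mulmxA mxE.
  apply: eq_bigr => k _.
  by rewrite [X in _ = X * _]mxE [X in _ = _ * X]mxE pairing_row mulrC.
rewrite det_mulmx det_tr -mulrA; congr (_ * _).
rewrite -mulrN mulVKf -?unitfE -?unitmxE//.
apply: (mulIf (omega_val_neq0 (pi p))).
by rewrite QH_val_omega mulNr mulVf// omega_val_neq0.
Qed.

Lemma F_in_neq0 p : dom_cc p -> F_in (cfun c p) != 0.
Proof.
move=> [cp op]; rewrite /F_in ymap_at// omega_in// oppr_eq0 invr_eq0 mulf_neq0//.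
  by rewrite -unitfE -unitmxE; exact: jac_unit.
exact: omega_val_neq0.
Qed.

Definition y_in (j : 'I_2) (x : 'rV[R]_5) : R := ymap pi c c' x 0 j.
Definition dy_in (j : 'I_2) (x : 'rV[R]_5) : 'cV[R]_5 := \col_i pd i (y_in j) x.

Lemma dy_at j p : dom_cc p -> dy_in j (cfun c p) = col j (Tc p).
Proof.
move=> [cp op]; apply/matrixP => i k; rewrite [LHS]mxE [RHS]mxE /Tc.
by rewrite (dymap_entry smooth_pi i j ac ac' cp op).
Qed.

Definition bil (P : mvec M 2) (xi ze : 'cV[R]_5) (x : 'rV[R]_5) : R :=
  \sum_a \sum_b mx_in c P a b x * xi a 0 * ze b 0.

Lemma bil_at (P : mvec M 2) xi ze x : alternating (P (cinv c x)) ->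
  bil P xi ze x = mvec_in c P (args [:: xi; ze]) x.
Proof. by move=> aP; rewrite (bilinear_expand _ _ (mvec_in_alternating aP)). Qed.

(* xi(h_j), written through Q_H and the dy_i to make its smoothness apparent. *)
Definition hcov_in (j : 'I_2) (xi : 'cV[R]_5) (x : 'rV[R]_5) : R :=
  (if j == i20 then bil QH xi (dy_in i21 x) x
   else bil QH (dy_in i20 x) xi x) / F_in x.

Lemma hT_entry p (i j : 'I_2) : dom_cc p -> (hc p *m col j (Tc p)) i 0 = (i == j)%:R.
Proof.
move=> dp; rewrite colE mulmxA (frame_hT (chart_frame dp)) mul1mx mxE eqxx andbT.
by [].
Qed.

Lemma hcov_at j xi p : dom_cc p -> hcov_in j xi (cfun c p) = (hc p *m xi) j 0.
Proof.
move=> dp; have [cp op] := dp.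
pose r i := (hc p *m xi) i 0; rewrite -/(r j).
have aQ : alternating (QH (cinv c (cfun c p))) by exact: QH_alt.
have F0 := F_in_neq0 dp.
move: j; apply: ord2P; rewrite /hcov_in /= (bil_at _ _ aQ) (QH_in _ dp) (dy_at _ dp);
  rewrite (mulfK F0) det2 !mxE !pairing_row /args /= !(hT_entry _ _ dp) /= -/(r _) -/(r _); ring.
Qed.

(** The covector of [beta] is expanded in the coordinate covectors of c. The resulting sum consists
    of products of smooth coefficients, which the invariant expression does not show. *)
Lemma QV_covec_in xi ze p : cdom c p ->
  \sum_a form_in c beta (args [:: evec R a]) (cfun c p) *
         mvec_in c QV (args [:: ecovec R a; xi; ze]) (cfun c p) =
  QV p (args [:: covec (beta p); invmx (jac c p) *m xi; invmx (jac c p) *m ze]).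
Proof.
move=> cp; have uJ := jac_unit ac cp; rewrite -[in RHS]ins_args.
have -> : covec (beta p) = \sum_a beta p (args [:: evec R a *m jac c p]) *:
                            (invmx (jac c p) *m ecovec R a).
  rewrite -[LHS](mulKmx uJ); move: (invmx _) => J'.
  have -> : jac c p *m covec (beta p) =
     \sum_a beta p (args [:: evec R a *m jac c p]) *: ecovec R a.
    apply/matrixP => i j; rewrite (ord1 j) summxE (bigD1 i)//= big1 ?addr0.
      rewrite [RHS]mxE [X in _ = _ * X]mxE !eqxx mulr1 -(covecE _ (beta_alt p)).
      by rewrite /pairing -mulmxA -rowE [RHS]mxE.
    by move=> k' ki; rewrite !mxE eq_sym (negPf ki) mulr0.
  by rewrite mulmx_sumr; apply: eq_bigr => a _; rewrite scalemxAr.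
rewrite ins_sum; last exact: QV_alt.
apply: eq_bigr => a _; rewrite ins_args form_in_at// mvec_in_at//; congr (_ * _).
  by congr (beta p); apply: args1.
by congr (QV p); apply: args3.
Qed.

Definition Pbeta_num (xi : 'I_2 -> 'cV[R]_5) (x : 'rV[R]_5) : R :=
  - \sum_a form_in c beta (args [:: evec R a]) x *
         mvec_in c QV (args [:: ecovec R a; xi i20; xi i21]) x.

Lemma Pbeta_in xi x : cimg c setT x -> mvec_in c Pbeta xi x = Pbeta_num xi x.
Proof.
move=> /cimgP[cx _ <-]; rewrite /Pbeta_num QV_covec_in// mvec_in_at// -Pbeta_args.
by congr (Pbeta _); exact: args2.
Qed.

Lemma Pbeta_smooth xi : Csmooth (cimg c setT) (mvec_in c Pbeta xi).
Proof.
have oc : open (cimg c setT) by exact/cimg_open/openT.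
move=> k; apply: (Ck_ext oc (f' := Pbeta_num xi)) => [x cx|]; first by rewrite Pbeta_in.
rewrite /Pbeta_num.
have -> : (fun x => - \sum_a form_in c beta (args [:: evec R a]) x *
    mvec_in c QV (args [:: ecovec R a; xi i20; xi i21]) x) =
  (fun x => (-1) * \sum_a form_in c beta (args [:: evec R a]) x *
    mvec_in c QV (args [:: ecovec R a; xi i20; xi i21]) x).
  by apply/funext => x; rewrite mulN1r.
apply: (Ck_mul oc); first exact: Ck_cst.
apply: (@Ck_sum _ _ _ _ _ _ xpredT (fun a x => form_in c beta (args [:: evec R a]) x *
    mvec_in c QV (args [:: ecovec R a; xi i20; xi i21]) x) oc) => a _.
have s1 := (triple_bideg htriple).1.2 c ac (args [:: evec R a]) k.
have s2 := (QV_bideg hsplit).1.2 c ac (args [:: ecovec R a; xi i20; xi i21]) k.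
exact: Ck_mul oc s1 s2.
Qed.

Lemma Pi_in xi x : mvec_in c Pi xi x =
  - (kappa (cinv c x) * mvec_in c QH xi x) + mvec_in c Pbeta xi x.
Proof. exact: Pi_eq. Qed.

Lemma Pi_smooth xi : Csmooth (cimg c setT) (mvec_in c Pi xi).
Proof.
have oc : open (cimg c setT) by exact/cimg_open/openT.
move=> k; have sb := Pbeta_smooth xi k.
have sk : Ck k (cimg c setT) (kappa \o cinv c) by exact: (triple_smooth htriple ac).
have sQ := (QH_bideg hsplit).1.2 c ac xi k.
have := Ck_add oc (Ck_mul oc (@Ck_cst _ _ k (cimg c setT) (-1)) (Ck_mul oc sk sQ)) sb.
by apply: (Ck_ext oc) => x _; rewrite Pi_in mulN1r.
Qed.

Lemma QH_in2 p xi ze : dom_cc p -> mvec_in c QH (args [:: xi; ze]) (cfun c p) =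
  ((hc p *m xi) i20 0 * (hc p *m ze) i21 0 - (hc p *m xi) i21 0 * (hc p *m ze) i20 0)
  * F_in (cfun c p).
Proof.
move=> dp; pose r i := (hc p *m xi) i 0; pose t i := (hc p *m ze) i 0.
rewrite -!/(r _) -!/(t _) (QH_in _ dp) det2 !mxE !pairing_row /args /= -!/(r _) -!/(t _).
by ring.
Qed.

Lemma Pbeta_in_T p j ze : dom_cc p ->
  mvec_in c Pbeta (args [:: col j (Tc p); ze]) (cfun c p) = 0.
Proof.
move=> dp; have [cp op] := dp; rewrite mvec_in_at//.
have -> : Pbeta p (fun i => invmx (jac c p) *m args [:: col j (Tc p); ze] i) =
  Pbeta p (args [:: invmx (jac c p) *m col j (Tc p); invmx (jac c p) *m ze]).
  by congr (Pbeta p); apply: args2.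
rewrite Pbeta_vertical.
have -> : g p *m (invmx (jac c p) *m col j (Tc p)) = 0.
  rewrite (Tc_eq dp) colE -!mulmxA (mulKmx (jac_unit ac cp)) !mulmxA.
  by rewrite (frame_gT (triple_frame p)) !mul0mx.
exact: (multilinear_zero (i := i20) (Pbeta_alt p)).
Qed.

Section LocalFunctions.
Variable N : 'M[R]_(5, 3).

Definition A_in (j : 'I_2) (k : 'I_3) (x : 'rV[R]_5) : R := hcov_in j (col k N) x.

Lemma A_at j k p : dom_cc p -> A_in j k (cfun c p) = (hc p *m N) j k.
Proof.
move=> dp; rewrite /A_in hcov_at//.
by rewrite colE mulmxA -colE [LHS]mxE.
Qed.

(* The vertical coframe, the covectors g *m N_k expressed without g. *)
Definition eta (k : 'I_3) (w : 'rV[R]_5) (x : 'rV[R]_5) : R :=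
  pairing w (col k N) - \sum_j pairing w (dy_in j x) * A_in j k x.

Lemma eta_at k w p : dom_cc p -> eta k w (cfun c p) = pairing w (col k (gc p *m N)).
Proof.
move=> dp; have fr := chart_frame dp.
have -> : gc p *m N = N - Tc p *m (hc p *m N).
  by rewrite mulmxA (frame_Th fr) mulmxBl mul1mx opprB addrC subrK.
rewrite /eta !pairing_col mulmxBr [RHS]mxE [X in _ = _ + X]mxE; congr (_ - _).
rewrite mulmxA [RHS]mxE; apply: eq_bigr => j _.
by rewrite A_at// dy_at// pairing_col.
Qed.

Definition q_in (x : 'rV[R]_5) : R := mvec_in c QV (cols3 N) x.

(* By Cramer, b_m = Q_V(beta, dz_k, dz_l) / q for (k, l, m) cyclic. *)
Definition b_num (k l : 'I_3) (x : 'rV[R]_5) : R :=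
  \sum_a form_in c beta (args [:: evec R a]) x *
         mvec_in c QV (args [:: ecovec R a; col k N; col l N]) x.

Definition b_in (m : 'I_3) (x : 'rV[R]_5) : R :=
  (if m == i30 then b_num i31 i32 x else
   if m == i31 then b_num i32 i30 x else b_num i30 i31 x) / q_in x.

Lemma b_num_at k l p : cdom c p -> b_num k l (cfun c p) =
  QV p (args [:: covec (beta p); invmx (jac c p) *m col k N; invmx (jac c p) *m col l N]).
Proof. exact: QV_covec_in. Qed.

Let Np p := invmx (jac c p) *m N.

Lemma cols3_Np p : cols3 (Np p) = (fun i => invmx (jac c p) *m cols3 N i).
Proof.
by rewrite -!cols3E; apply: funord => i /=; rewrite !colE /Np -mulmxA.
Qed.

Lemma q_at p : cdom c p -> q_in (cfun c p) = QV p (cols3 (Np p)).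
Proof. by move=> cp; rewrite /q_in mvec_in_at// cols3_Np. Qed.

Lemma pairing_eta p w k : dom_cc p ->
  pairing (w *m jac c p) (col k (g p *m Np p)) = eta k w (cfun c p).
Proof.
by move=> dp; rewrite (eta_at _ _ dp) !pairing_col (gc_eq dp.1) /Np !mulmxA.
Qed.

(** Where q is nonzero, the columns of [N] restrict to a basis of the dual of the vertical space.
    Evaluating on the dual frame of [vertical_trivector] gives the coefficients; the frame itself,
    chosen point by point, no longer appears in the formulas, so they can be differentiated. *)
Lemma vertical_at p : dom_cc p -> q_in (cfun c p) != 0 ->
  [/\ forall w, form_in c beta (args [:: w]) (cfun c p) =
        \sum_k b_in k (cfun c p) * eta k w (cfun c p),
      forall w, form_in c OmegaV w (cfun c p) =
        - (q_in (cfun c p))^-1 * \det (\matrix_(i, j) eta j (w i) (cfun c p)) &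
      forall k l, mvec_in c Pbeta (args [:: col k N; col l N]) (cfun c p) =
        vbracket q_in b_in k l (cfun c p)].
Proof.
move=> dp; have [cp op] := dp; have fr := triple_frame p; rewrite q_at// => q0.
have [v [gNv vgN Qv]] := vertical_trivector fr (QV_alt p) (QV_comp p) (triple_rank p) q0.
have [t0 t1 t2] := trivector_covec gNv vgN Qv (beta_alt p).
have cN k : invmx (jac c p) *m col k N = col k (Np p).
  by rewrite !colE /Np -mulmxA.
have bE k : b_in k (cfun c p) = beta p (args [:: row k v]).
  by move: k; apply: ord3P; rewrite /b_in /= b_num_at// q_at// !cN ?t0 ?t1 ?t2 mulfK.
split=> [w|w|k l].
- rewrite form_in_at//.
  have -> : beta p (fun i => args [:: w] i *m jac c p) = beta p (args [:: w *m jac c p]).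
    by congr (beta p); apply: args1.
  rewrite (vertical_1form gNv (beta_alt p) (beta_comp p)); apply: eq_bigr => k _.
  by rewrite bE pairing_eta.
- rewrite form_in_at//.
  rewrite (dual_trivector gNv Qv (OmegaV_alt p) (OmegaV_comp p) (QV_eq hsplit p)).
  congr (_ * \det _); apply/matrixP => i j.
  by rewrite mxE [RHS]mxE pairing_eta.
rewrite mvec_in_at//.
have -> : Pbeta p (fun i => invmx (jac c p) *m args [:: col k N; col l N] i) =
          Pbeta p (args [:: col k (Np p); col l (Np p)]).
  by congr (Pbeta p); apply: args2; rewrite /= cN.
have vb : forall k' l' m', QV p (args [:: covec (beta p); col k' (Np p); col l' (Np p)]) =
    beta p (args [:: row m' v]) * QV p (cols3 (Np p)) ->
  Pbeta p (args [:: col k' (Np p); col l' (Np p)]) = - (q_in (cfun c p) * b_in m' (cfun c p)) /\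
  Pbeta p (args [:: col l' (Np p); col k' (Np p)]) = q_in (cfun c p) * b_in m' (cfun c p).
  move=> k' l' m' e; rewrite (alternating2_flip (col k' (Np p)) _ (Pbeta_alt p)).
  by rewrite Pbeta_args e bE q_at// mulrC opprK.
have [v12 v21] := vb _ _ _ t0; have [v20 v02] := vb _ _ _ t1; have [v01 v10] := vb _ _ _ t2.
move: k l; do 2! apply: ord3P; rewrite /vbracket /= ?alternating2_diag//; exact: Pbeta_alt.
Qed.

End LocalFunctions.

End InCharts.

(** * First derivatives and the structure equations at one point *)

Section AtPoint.
(** The columns of [N] are the dz_k and the rows of [v0] the dual vertical frame at p0. [N] is kept
    constant over the chart, so away from p0 its columns need not annihilate the horizontal space;
    [A_in] measures the failure. *)
Variables (p0 : M) (N : 'M[R]_(5, 3)) (v0 : 'M[R]_(3, 5)).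
Hypotheses (Nv : N *m v0 = g p0) (vN : v0 *m N = 1%:M).
Let c := chart_at p0.
Let c' := chart_at (pi p0).
Let x0 : 'rV[R]_5 := coord p0.
Let ac : atlas c := atlas_chart_at p0.
Let ac' : atlas c' := atlas_chart_at (pi p0).
Let T := tangent pi p0.
Let h0 := hor pi g p0.
Let fr : frame T (g p0) h0 := triple_frame p0.

Lemma at_dom : dom_cc c c' p0.
Proof. by split; [exact: cdom_chart_at|exact: over_chart_at]. Qed.

Let cp0 : cdom c p0 := cdom_chart_at p0.

Lemma at_Tc : Tc c c' p0 = T. Proof. by []. Qed.

Lemma at_hc : hc c c' p0 = h0.
Proof. by rewrite /hc !jac_chart_at invmx1 mulmx1 mul1mx. Qed.

Lemma at_gN : g p0 *m N = N.
Proof. by rewrite -Nv -mulmxA vN mulmx1. Qed.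

Lemma at_vg : v0 *m g p0 = v0.
Proof. by rewrite -Nv mulmxA vN mul1mx. Qed.

Lemma at_vT : v0 *m T = 0.
Proof. by rewrite -at_vg -mulmxA (frame_gT fr) mulmx0. Qed.

Lemma at_hN : h0 *m N = 0.
Proof. by rewrite -at_gN mulmxA (frame_hg fr) mul0mx. Qed.

Lemma at_Q xi : QV p0 xi = \det (\matrix_(i, j) pairing (rows3 v0 j) (xi i)) * QV p0 (cols3 N).
Proof.
rewrite (vertical_mvec (QV_comp p0)).
have -> : (fun i => g p0 *m xi i) = (fun i => N *m v0 *m xi i) by rewrite Nv.
by rewrite (mvec_det N v0 xi (QV_alt p0)) cols3E -rows3E.
Qed.

Lemma at_q0 : q_in c N x0 != 0.
Proof.
rewrite /q_in /x0 /coord mvec_in_at// jac_chart_at invmx1.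
have -> : (fun i => 1%:M *m cols3 N i) = cols3 N by apply: funord => i; rewrite mul1mx.
apply/eqP => q0; have := congr1 (fun f => f (fun=> 0)) (QV_eq hsplit p0).
rewrite (contract30 _ at_Q (OmegaV_alt p0)) q0 mul0r => /eqP.
by rewrite eq_sym oner_eq0.
Qed.

Lemma at_A0 j k : A_in c c' N j k x0 = 0.
Proof. by rewrite /x0 /coord (A_at ac ac' _ _ _ at_dom) at_hc at_hN mxE. Qed.

Lemma near_dom : \forall x \near x0, exists2 p, dom_cc c c' p & x = cfun c p.
Proof.
have spi : smooth_map pi by case: hpi.
apply: filterS (near_chart (over_open spi c') cp0 at_dom.2) => x /cimgP[cx ox ex].
by exists (cinv c x).
Qed.

Lemma chart_diff f : Csmooth (cimg c setT) f -> differentiable f x0.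
Proof. by move=> sf; exact: (Csmooth_chart_diff sf cp0). Qed.

Lemma d_QH xi : differentiable (mvec_in c QH xi) x0.
Proof. apply: chart_diff; exact: ((QH_bideg hsplit).1.2 c ac). Qed.
Lemma d_QV xi : differentiable (mvec_in c QV xi) x0.
Proof. apply: chart_diff; exact: ((QV_bideg hsplit).1.2 c ac). Qed.
Lemma d_beta v : differentiable (form_in c beta v) x0.
Proof. apply: chart_diff; exact: ((triple_bideg htriple).1.2 c ac). Qed.
Lemma d_kappa : differentiable (kappa \o cinv c) x0.
Proof. apply: chart_diff; exact: (triple_smooth htriple ac). Qed.

Lemma d2_y j : twice_diff (y_in c c' j) x0.
Proof.
have spi : smooth_map pi by case: hpi.
apply: (@Csmooth_twice_diff _ _ (cimg c (over pi c'))).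
- exact/cimg_open/over_open.
- exact: cimg_in cp0 at_dom.2.
- exact: (ymap_smooth spi ac ac' j).
Qed.

Lemma d_ymap : differentiable (ymap pi c c') x0.
Proof.
have spi : smooth_map pi by case: hpi.
exact: (ymap_diff spi ac ac' cp0 at_dom.2).
Qed.

Lemma d_inv_omega : differentiable
  (fun y => - (form_in c' omega (args [:: evec R i20; evec R i21]) y)^-1) (ymap pi c c' x0).
Proof.
have e := ymap_at c' cp0.
apply: differentiableN; apply: differentiableV; rewrite e.
  exact: (Csmooth_chart_diff (homega.1.2 c' ac' _) at_dom.2).
rewrite omega_in ?mulf_neq0//; [|exact: omega_val_neq0|exact: at_dom.2].
by rewrite /c' jac_chart_at det1 oner_eq0.
Qed.

Lemma d_F : differentiable (F_in c c') x0.
Proof. exact: differentiable_comp d_ymap d_inv_omega. Qed.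

(** The rows of [v0] are vertical at p0 and the function is pulled back from the base. *)
Lemma D_basic (W : normedModType R) (f : 'rV[R]_2 -> W) k :
  differentiable f (ymap pi c c' x0) ->
  'D_(row k v0) (f \o ymap pi c c') x0 = 0.
Proof.
move=> df; rewrite (derive_comp _ d_ymap df) (deriveEjacobian _ d_ymap).
rewrite -[jacobian _ _]/(Tc c c' p0) at_Tc -row_mul at_vT row0.
exact: derive0.
Qed.

Lemma D_F k : 'D_(row k v0) (F_in c c') x0 = 0.
Proof. exact: D_basic d_inv_omega. Qed.

Lemma d_bil (P : mvec M 2) (xi ze : 'rV[R]_5 -> 'cV[R]_5) : (forall v, differentiable (mvec_in c P v) x0) ->
  (forall a, differentiable (fun x => xi x a 0) x0) ->
  (forall a, differentiable (fun x => ze x a 0) x0) ->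
  differentiable (fun x => bil c P (xi x) (ze x) x) x0.
Proof.
move=> dP dx dz; apply: diff_sum => a _; apply: diff_sum => b _.
by apply: differentiableM => //; apply: differentiableM => //; exact: dP.
Qed.

Lemma d_dy j a : differentiable (fun x => dy_in c c' j x a 0) x0.
Proof.
have -> : (fun x => dy_in c c' j x a 0) = pd a (y_in c c' j).
  by apply/funext => x; rewrite mxE.
exact: (d2_y j).1.
Qed.

Lemma d_hcov j xi : differentiable (hcov_in c c' j xi) x0.
Proof.
apply: differentiableM; last first.
  by apply: differentiableV; [exact: d_F|exact: (F_in_neq0 ac' at_dom)].
move: j; apply: ord2P => /=.
  apply: (d_bil (xi := fun=> xi) (ze := dy_in c c' i21)) => [v|a|a];
    first [exact: d_QH|exact: d_dy|exact: differentiable_cst].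
apply: (d_bil (xi := dy_in c c' i20) (ze := fun=> xi)) => [v|a|a];
  first [exact: d_QH|exact: d_dy|exact: differentiable_cst].
Qed.

Lemma d_A j k : differentiable (A_in c c' N j k) x0.
Proof. exact: d_hcov. Qed.

Lemma d_q : differentiable (q_in c N) x0. Proof. exact: d_QV. Qed.

Lemma d_bnum k l : differentiable (b_num c N k l) x0.
Proof.
by apply: diff_sum => a _; apply: differentiableM; [exact: d_beta|exact: d_QV].
Qed.

Lemma d_b m : differentiable (b_in c N m) x0.
Proof.
apply: differentiableM; last by apply: differentiableV; [exact: d_q|exact: at_q0].
by move: m; apply: ord3P => /=; exact: d_bnum.
Qed.

Lemma pairing_dy w j : pairing w (dy_in c c' j x0) = (w *m T) 0 j.
Proof. by rewrite (dy_at ac ac' j at_dom) at_Tc pairing_col. Qed.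

Lemma d_pairing_dy w j : differentiable (fun x => pairing w (dy_in c c' j x)) x0.
Proof.
have -> : (fun x => pairing w (dy_in c c' j x)) =
          (fun x => \sum_a w 0 a * dy_in c c' j x a 0).
  by apply/funext => x; rewrite pairingE.
apply: diff_sum => a _; apply: differentiableM; last exact: d_dy.
exact: differentiable_cst.
Qed.

Lemma d_eta k w : differentiable (eta c c' N k w) x0.
Proof.
apply: differentiableB; first exact: differentiable_cst.
by apply: diff_sum => j _; apply: differentiableM; [exact: d_pairing_dy|exact: d_A].
Qed.

Lemma eta0 k w : eta c c' N k w x0 = pairing w (col k N).
Proof. by rewrite /eta big1 ?subr0// => j _; rewrite at_A0 mulr0. Qed.

(** Because A vanishes at [x0], the derivative of dy_j is multiplied by zero and no second
    derivative of y appears. *)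
Lemma D_eta k w u : 'D_u (eta c c' N k w) x0 =
  - \sum_j (w *m T) 0 j * 'D_u (A_in c c' N j k) x0.
Proof.
have dS : differentiable (fun x => \sum_j pairing w (dy_in c c' j x) * A_in c c' N j k x) x0.
  by apply: diff_sum => j _; apply: differentiableM; [exact: d_pairing_dy|exact: d_A].
have dC : differentiable (fun=> pairing w (col k N)) x0 by exact: differentiable_cst.
apply: etrans (derD u dC (differentiableN dS)) _.
rewrite derive_cst add0r; apply: etrans (derN u dS) _; congr (- _).
rewrite der_sum => [|j _]; last by apply: differentiableM; [exact: d_pairing_dy|exact: d_A].
apply: eq_bigr => j _.
apply: etrans (derM u (d_pairing_dy w j) (d_A j k)) _.
by rewrite at_A0 mulr0 add0r pairing_dy.
Qed.

Lemma near_q : \forall x \near x0, q_in c N x != 0.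
Proof.
have /differentiable_continuous cq := d_q.
have := cq [set y | y != 0]; apply; apply: open_nbhs_nbhs; split; last exact: at_q0.
exact: open_neq.
Qed.

Lemma near_vertical : \forall x \near x0,
  [/\ forall w, form_in c beta (args [:: w]) x = \sum_k b_in c N k x * eta c c' N k w x,
      forall w, form_in c OmegaV w x =
        - (q_in c N x)^-1 * \det (\matrix_(i, j) eta c c' N j (w i) x) &
      forall k l, mvec_in c Pbeta (args [:: col k N; col l N]) x =
        vbracket (q_in c N) (b_in c N) k l x].
Proof.
by apply: filterS2 near_dom near_q => x [p dp ->] q0; exact: vertical_at.
Qed.

Lemma vN_entry m k : pairing (row m v0) (col k N) = (m == k)%:R.
Proof. by rewrite pairing_row colE mulmxA vN mul1mx mxE eqxx andbT. Qed.

Lemma hN_entry i k : pairing (row i h0) (col k N) = 0.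
Proof. by rewrite pairing_row colE mulmxA at_hN mul0mx mxE. Qed.

Lemma D_eta_v k m u : 'D_u (eta c c' N k (row m v0)) x0 = 0.
Proof.
rewrite D_eta -row_mul at_vT row0 big1 ?oppr0// => j _.
by rewrite mxE mul0r.
Qed.

Lemma D_eta_h k i u : 'D_u (eta c c' N k (row i h0)) x0 = - 'D_u (A_in c c' N i k) x0.
Proof.
rewrite D_eta -row_mul (frame_hT fr) row1; congr (- _).
rewrite (bigD1 i)//= big1 ?addr0 => [|j ji]; first by rewrite mxE !eqxx mul1r.
by rewrite mxE (negPf ji) andbF mul0r.
Qed.

Lemma D_beta w u : 'D_u (form_in c beta (args [:: w])) x0 =
  \sum_k ('D_u (b_in c N k) x0 * pairing w (col k N)
           + b_in c N k x0 * 'D_u (eta c c' N k w) x0).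
Proof.
have e : {near x0, form_in c beta (args [:: w]) =1
                   fun x => \sum_k b_in c N k x * eta c c' N k w x}.
  by apply: filterS near_vertical => x [].
apply: etrans (near_eq_derive u e) _.
rewrite der_sum => [|k _]; last by apply: differentiableM; [exact: d_b|exact: d_eta].
apply: eq_bigr => k _; apply: etrans (derM u (d_b k) (d_eta k w)) _.
by rewrite eta0.
Qed.

Lemma D_beta_v m u : 'D_u (form_in c beta (args [:: row m v0])) x0 = 'D_u (b_in c N m) x0.
Proof.
rewrite D_beta (bigD1 m)//= big1 ?addr0 => [|k km].
  by rewrite D_eta_v vN_entry eqxx mulr1 mulr0 addr0.
by rewrite D_eta_v vN_entry eq_sym (negPf km) !mulr0 addr0.
Qed.

Lemma D_beta_h i u : 'D_u (form_in c beta (args [:: row i h0])) x0 =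
  - \sum_k b_in c N k x0 * 'D_u (A_in c c' N i k) x0.
Proof.
rewrite D_beta -sumrN; apply: eq_bigr => k _.
by rewrite hN_entry D_eta_h mulr0 add0r mulrN.
Qed.

(** Near p0 the form is - 1/q times the determinant of the vertical coframe. The first term
    differentiates 1/q, the second the determinant, one row at a time. *)
Lemma D_OmegaV w u : 'D_u (form_in c OmegaV w) x0 =
  'D_u (q_in c N) x0 / q_in c N x0 ^+ 2 * \det (\matrix_(i, j) pairing (w i) (col j N))
  - (q_in c N x0)^-1 * \sum_l \det (\matrix_(i, j)
       if i == l then 'D_u (eta c c' N j (w i)) x0 else pairing (w i) (col j N)).
Proof.
have e : {near x0, form_in c OmegaV w =1
    fun x => - (q_in c N x)^-1 * \det (\matrix_(i, j) eta c c' N j (w i) x)}.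
  by apply: filterS near_vertical => x [].
have [dd Dd] := derv_det3 (derivation_derive x0 u) (fun i j => d_eta j (w i)).
have dV : differentiable (fun x => (q_in c N x)^-1) x0.
  by apply: differentiableV; [exact: d_q|exact: at_q0].
have DV : 'D_u (fun x => (q_in c N x)^-1) x0 = - ('D_u (q_in c N) x0 / q_in c N x0 ^+ 2).
  apply: etrans (deriveV at_q0 (diff_derivable d_q)) _.
  by rewrite scaleNr mulrC.
apply: etrans (near_eq_derive u e) _.
apply: etrans (derM u (differentiableN dV) dd) _.
rewrite (derN u dV) DV opprK Dd mulNr; congr (_ * \det _ - _ * _).
  by apply/matrixP => i j; rewrite mxE [RHS]mxE eta0.
apply: eq_bigr => l _; congr (\det _); apply/matrixP => i j.
by rewrite mxE [RHS]mxE eta0.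
Qed.

Local Notation q := (q_in c N).
Local Notation b := (b_in c N).
Local Notation A := (A_in c c' N).

Lemma D_OmegaV_vvv u : 'D_u (form_in c OmegaV (rows3 v0)) x0 = 'D_u q x0 / q x0 ^+ 2.
Proof.
rewrite D_OmegaV det3 !mxE sum3 !det3 !mxE /= /rows3 /args /= !D_eta_v !vN_entry /=.
by ring.
Qed.

(** The row of a horizontal argument vanishes at [x0], so only its derivative, minus that of A,
    contributes. With two horizontal arguments two rows vanish and the derivative is zero. *)
Lemma D_OmegaV_hvv u i k l : 'D_u (form_in c OmegaV (args [:: row i h0; row k v0; row l v0])) x0 =
  (q x0)^-1 * ('D_u (A i i30) x0 * ((k == i31)%:R * (l == i32)%:R - (k == i32)%:R * (l == i31)%:R)
  - 'D_u (A i i31) x0 * ((k == i30)%:R * (l == i32)%:R - (k == i32)%:R * (l == i30)%:R)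
  + 'D_u (A i i32) x0 * ((k == i30)%:R * (l == i31)%:R - (k == i31)%:R * (l == i30)%:R)).
Proof.
rewrite D_OmegaV det3 !mxE sum3 !det3 !mxE /= /args /= !D_eta_v !D_eta_h !vN_entry !hN_entry.
by ring.
Qed.

Lemma D_OmegaV_hhv u i j k :
  'D_u (form_in c OmegaV (args [:: row i h0; row j h0; row k v0])) x0 = 0.
Proof.
rewrite D_OmegaV det3 !mxE sum3 !det3 !mxE /= /args /= !D_eta_v !D_eta_h !vN_entry !hN_entry.
by ring.
Qed.

Lemma dOmegaV_hvvv i :
  ext_d OmegaV p0 (args [:: row i h0; row i30 v0; row i31 v0; row i32 v0]) =
  'D_(row i h0) q x0 / q x0 ^+ 2 - (q x0)^-1 *
  ('D_(row i30 v0) (A i i30) x0 + 'D_(row i31 v0) (A i i31) x0 + 'D_(row i32 v0) (A i i32) x0).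
Proof.
rewrite ext_d3 -/c -/x0 -[args [:: row i30 v0; _; _]]/(rows3 v0) D_OmegaV_vvv !D_OmegaV_hvv /=.
pose DA m k : R := 'D_(row m v0) (A i k) x0.
pose Q : R := 'D_(row i h0) q x0 / q x0 ^+ 2; pose s : R := (q x0)^-1.
rewrite -!/(DA i30 _) -!/(DA i31 _) -!/(DA i32 _) -/Q -/s; move: DA Q s => DA Q s.
by ring.
Qed.

Lemma dOmegaV_hhvv k l :
  ext_d OmegaV p0 (args [:: row i20 h0; row i21 h0; row k v0; row l v0]) =
  'D_(row i20 h0) (form_in c OmegaV (args [:: row i21 h0; row k v0; row l v0])) x0
  - 'D_(row i21 h0) (form_in c OmegaV (args [:: row i20 h0; row k v0; row l v0])) x0.
Proof. by rewrite ext_d3 -/c -/x0 !D_OmegaV_hhv subr0 addr0. Qed.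

Let Dh i f : R := 'D_(row i h0) f x0.
Let Dv k f : R := 'D_(row k v0) f x0.

Lemma vg_row k : row k v0 *m g p0 = row k v0.
Proof. by rewrite -row_mul at_vg. Qed.

Lemma hg_row i : row i h0 *m g p0 = 0.
Proof. by rewrite -row_mul (frame_hg fr) row0. Qed.

Lemma at_form_in k (a : dform M k) v : form_in c a v x0 = a p0 v.
Proof.
rewrite /x0 /coord form_in_at// jac_chart_at; congr (a p0).
by apply: funord => i; rewrite mulmx1.
Qed.

Lemma at_mvec_in k (Q : mvec M k) v : mvec_in c Q v x0 = Q p0 v.
Proof.
rewrite /x0 /coord mvec_in_at// jac_chart_at invmx1; congr (Q p0).
by apply: funord => i; rewrite mul1mx.
Qed.

Lemma at_QH xi : QH p0 xi =
  \det (\matrix_(i, j) pairing (args [:: row i20 h0; row i21 h0] j) (xi i)) * F_in c c' x0.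
Proof.
rewrite -at_mvec_in /x0 /coord (QH_in ac' _ at_dom) at_hc.
by rewrite -(args2 (v := fun j => row j h0) erefl erefl).
Qed.

Lemma beta_v m : beta p0 (args [:: row m v0]) = b m x0.
Proof.
rewrite -at_form_in; have [/(_ (row m v0)) -> _ _] := nbhs_singleton near_vertical.
rewrite (bigD1 m)//= big1 ?addr0 => [|k km]; rewrite eta0 vN_entry.
  by rewrite eqxx mulr1.
by rewrite eq_sym (negPf km) mulr0.
Qed.

Lemma beta_h i : beta p0 (args [:: row i h0]) = 0.
Proof.
rewrite -at_form_in; have [/(_ (row i h0)) -> _ _] := nbhs_singleton near_vertical.
by rewrite big1// => k _; rewrite eta0 hN_entry mulr0.
Qed.

Lemma dbeta_alt : alternating (ext_d beta p0).
Proof. exact: (ext_d_alternating _ (triple_bideg htriple).1). Qed.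

Lemma dOmegaV_alt : alternating (ext_d OmegaV p0).
Proof. exact: (ext_d_alternating _ (OmegaV_bideg hsplit).1). Qed.

Lemma d01_beta_vv k l :
  d01_beta g beta p0 (args [:: row k v0; row l v0]) = Dv k (b l) - Dv l (b k).
Proof.
rewrite /d01_beta /form_comp component_0.
have -> : (fun i : 'I_(0 + 2) => args [:: row k v0; row l v0] i *m g p0) =
          args [:: row k v0; row l v0] by apply: args2; exact: vg_row.
by rewrite ext_d1 -/c -/x0 !D_beta_v.
Qed.

Lemma structure_vertical : (Dv i30 (b i31) - Dv i31 (b i30)) * b i32 x0
  - (Dv i30 (b i32) - Dv i32 (b i30)) * b i31 x0
  + (Dv i31 (b i32) - Dv i32 (b i31)) * b i30 x0 = 0.
Proof.
rewrite -(triple_03 htriple p0 (rows3 v0)) /rows3 wedge21; last first.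
  exact: (@form_comp_alternating _ _ (g p0) 0 2 _ dbeta_alt).
by rewrite !d01_beta_vv !beta_v.
Qed.

Lemma d10_beta_hv i m : d10_beta g beta p0 (args [:: row i h0; row m v0]) =
  Dh i (b m) + \sum_k b k x0 * Dv m (A i k).
Proof.
rewrite /d10_beta.
rewrite (form_comp_adapted (p := 1) (q := 1) (S := [set (ord0 : 'I_(1 + 1))]%SET) dbeta_alt) ?cards1//.
- by rewrite ext_d1 -/c -/x0 D_beta_v D_beta_h opprK.
- by move=> j; rewrite inE => /eqP ->; exact: hg_row.
by move=> j; rewrite inE; move: j; apply: ord2P => // _; exact: vg_row.
Qed.

Lemma theta_h i : theta g OmegaV QV p0 (args [:: row i h0]) =
  - (Dh i q / q x0) + (Dv i30 (A i i30) + Dv i31 (A i i31) + Dv i32 (A i i32)).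
Proof.
have q0 := at_q0; rewrite /theta.
rewrite (contract31 _ at_Q (@form_comp_alternating _ _ (g p0) 1 3 _ dOmegaV_alt)).
rewrite (form_comp_adapted (p := 1) (q := 3) (S := [set (ord_max : 'I_(1 + 3))]%SET) dOmegaV_alt) ?cards1//.
(* The arguments arrive as v_3, v_2, v_1, h_i; two transpositions sort them, so no sign remains. *)
- rewrite (alternating4_swap03 _ _ _ _ dOmegaV_alt) (alternating4_swap12 _ _ _ _ dOmegaV_alt).
  rewrite opprK dOmegaV_hvvv.
  have -> : QV p0 (cols3 N) = q x0 by rewrite /q_in at_mvec_in.
  rewrite -!/(Dv _ _) -/(Dh _ _); move: (Dh i q) (Dv i30 _ + _ + _) => Q S.
  by field.
- by move=> j; rewrite inE => /eqP ->; exact: hg_row.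
by move=> j; rewrite inE; move: j; apply: ord4P => // _; exact: vg_row.
Qed.

Lemma structure_mixed i m : kappa p0 * liehor x0 Dh Dv q b A i m = 0.
Proof.
rewrite -(triple_12 htriple p0 (args [:: row i h0; row m v0])) wedge11.
by rewrite beta_h mulr0 subr0 beta_v d10_beta_hv theta_h sum3.
Qed.

Lemma d01_kappa_v k : d01_fun g kappa p0 (args [:: row k v0]) = Dv k (kappa \o cinv c).
Proof.
rewrite /d01_fun /form_comp component_0.
have -> : (fun i : 'I_(0 + 1) => args [:: row k v0] i *m g p0) =
          args [:: row k v0] by apply: args1; exact: vg_row.
by rewrite ext_d0.
Qed.

(** [contract] inserts h_2 before h_1; the single transposition gives the minus sign. *)
Lemma rho_vv k l : rho g OmegaV QH p0 (args [:: row k v0; row l v0]) =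
  - (F_in c c' x0 * ext_d OmegaV p0 (args [:: row i20 h0; row i21 h0; row k v0; row l v0])).
Proof.
rewrite /rho (contract22 _ _ at_QH (@form_comp_alternating _ _ (g p0) 2 2 _ dOmegaV_alt)).
rewrite (form_comp_adapted (p := 2) (q := 2)
  (S := [set (ord0 : 'I_(2 + 2)); @Ordinal 4 1 isT]%SET) dOmegaV_alt) ?cards2//.
- by rewrite (alternating4_swap01 _ _ _ _ dOmegaV_alt) mulrN.
- by move=> j; rewrite !inE => /orP[/eqP ->|/eqP ->]; exact: hg_row.
by move=> j; rewrite !inE; move: j; apply: ord4P => // _; exact: vg_row.
Qed.

Lemma structure_curvature_vv k l :
  Dv k (kappa \o cinv c) * b l x0 - Dv l (kappa \o cinv c) * b k x0 =
  kappa p0 ^+ 2 * - (F_in c c' x0 *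
    ext_d OmegaV p0 (args [:: row i20 h0; row i21 h0; row k v0; row l v0])).
Proof.
apply/eqP; rewrite -subr_eq0 -(triple_21 htriple p0 (args [:: row k v0; row l v0])).
by rewrite wedge11 !d01_kappa_v !beta_v rho_vv.
Qed.

Lemma structure_curvature :
  let K := kappa \o cinv c in
  [/\ Dv i31 K * b i32 x0 - Dv i32 K * b i31 x0 =
         K x0 ^+ 2 * - (F_in c c' x0 * curv Dh A i30 / q x0),
      Dv i32 K * b i30 x0 - Dv i30 K * b i32 x0 =
         K x0 ^+ 2 * - (F_in c c' x0 * curv Dh A i31 / q x0) &
      Dv i30 K * b i31 x0 - Dv i31 K * b i30 x0 =
         K x0 ^+ 2 * - (F_in c c' x0 * curv Dh A i32 / q x0)].
Proof.
move=> K; have K0 : K x0 = kappa p0 by rewrite /K /x0 /coord /= cfunK.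
rewrite !structure_curvature_vv !dOmegaV_hhvv !D_OmegaV_hvv /= K0 /curv /Dh.
move: ('D_(row i20 h0) (A i21 i30) x0) ('D_(row i21 h0) (A i20 i30) x0) => a0 a0'.
move: ('D_(row i20 h0) (A i21 i31) x0) ('D_(row i21 h0) (A i20 i31) x0) => a1 a1'.
move: ('D_(row i20 h0) (A i21 i32) x0) ('D_(row i21 h0) (A i20 i32) x0) => a2 a2'.
have := at_q0; move: (q x0) (F_in c c' x0) (kappa p0) => Q F k Q0.
by split; field.
Qed.

(** * Brackets of the adapted coordinates and the Jacobi identity *)

Definition z_in (k : 'I_3) (x : 'rV[R]_5) : R := pairing x (col k N).
Definition grad_of (f : 'rV[R]_5 -> R) (x : 'rV[R]_5) : 'cV[R]_5 := \col_i pd i f x.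
Let K := kappa \o cinv c.
Local Notation F := (F_in c c').
Local Notation y := (y_in c c').

Lemma grad_z k x : grad_of (z_in k) x = col k N.
Proof. by apply/matrixP => i j; rewrite [LHS]mxE pd_pairing (ord1 j). Qed.

Lemma grad_y j x : grad_of (y j) x = dy_in c c' j x. Proof. by []. Qed.

Lemma pairing_grad w f : differentiable f x0 -> pairing w (grad_of f x0) = 'D_w f x0.
Proof.
move=> df; rewrite pairingE (derive_basis w df); apply: eq_bigr => i _.
by rewrite mxE.
Qed.

Lemma brk_mvec (P : mvec M 2) f h x : (forall p, alternating (P p)) ->
  brk (mx_in c P) f h x = mvec_in c P (args [:: grad_of f x; grad_of h x]) x.
Proof.
move=> aP; rewrite (bilinear_expand _ _ (mvec_in_alternating (aP (cinv c x)))).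
by apply: eq_bigr => i _; apply: eq_bigr => j _; rewrite !mxE.
Qed.

Lemma mx_anti (P : mvec M 2) : (forall p, alternating (P p)) ->
  \forall x \near x0, forall i j, mx_in c P i j x = - mx_in c P j i x.
Proof.
move=> aP; apply: near_forall => x i j.
by rewrite /mx_in (alternating2_flip _ _ (mvec_in_alternating (aP (cinv c x)))).
Qed.

(** r and t are the values of the two differentials on the horizontal frame. They enter through
    equations because each use substitutes something else: Kronecker deltas for y_j, A for z_k, and
    derivatives along h_i at p0 for a general function. *)
Lemma brk_Pi f h p r0 r1 t0 t1 : dom_cc c c' p ->
  (hc c c' p *m grad_of f (cfun c p)) i20 0 = r0 ->
  (hc c c' p *m grad_of f (cfun c p)) i21 0 = r1 ->
  (hc c c' p *m grad_of h (cfun c p)) i20 0 = t0 ->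
  (hc c c' p *m grad_of h (cfun c p)) i21 0 = t1 ->
  brk (mx_in c Pi) f h (cfun c p) =
  - (K (cfun c p) * F (cfun c p)) * (r0 * t1 - r1 * t0)
  + brk (mx_in c Pbeta) f h (cfun c p).
Proof.
move=> dp <- <- <- <-; rewrite (brk_mvec _ _ _ Pbeta_alt) (brk_mvec _ _ _ Pi_alt).
rewrite (Pi_in c) (QH_in2 ac' _ _ dp); congr (_ + _); rewrite mulNr; congr (- _).
by rewrite [RHS]mulrAC -mulrA.
Qed.

Lemma hgrad_y p i j : dom_cc c c' p ->
  (hc c c' p *m grad_of (y j) (cfun c p)) i 0 = (i == j)%:R.
Proof. by move=> dp; rewrite grad_y (dy_at ac ac' j dp) (hT_entry ac ac'). Qed.

Lemma hgrad_z p i k : dom_cc c c' p ->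
  (hc c c' p *m grad_of (z_in k) (cfun c p)) i 0 = A i k (cfun c p).
Proof.
move=> dp; rewrite grad_z (A_at ac ac' _ _ _ dp).
by rewrite colE mulmxA -colE [LHS]mxE.
Qed.

Lemma brk_Pbeta_y p j f : dom_cc c c' p ->
  brk (mx_in c Pbeta) (y j) f (cfun c p) = 0.
Proof.
move=> dp; rewrite brk_mvec; last exact: Pbeta_alt.
by rewrite grad_y (dy_at ac ac' j dp) (Pbeta_in_T ac ac').
Qed.

Lemma near_brk_Pbeta_y j f : {near x0, brk (mx_in c Pbeta) (y j) f =1 fun=> 0}.
Proof. by apply: filterS near_dom => x [p dp ->]; exact: brk_Pbeta_y. Qed.

Lemma near_brk_Pbeta_zz k l :
  {near x0, brk (mx_in c Pbeta) (z_in k) (z_in l) =1 vbracket q b k l}.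
Proof.
apply: filterS near_vertical => x [_ _ <-].
by rewrite brk_mvec ?grad_z//; exact: Pbeta_alt.
Qed.

(** P_beta only sees the vertical part of the gradient, and at p0 this is the combination of the
    dz_m with coefficients the derivatives along the dual frame v_m. *)
Lemma brk_Pbeta_z k f : differentiable f x0 ->
  brk (mx_in c Pbeta) (z_in k) f x0 = \sum_m vbracket q b k m x0 * Dv m f.
Proof.
move=> df; rewrite brk_mvec; last exact: Pbeta_alt.
rewrite grad_z at_mvec_in Pbeta_vertical.
have -> : g p0 *m col k N = col k N by rewrite colE mulmxA at_gN.
rewrite (alternating2_flip _ _ (Pbeta_alt p0)).
have -> : g p0 *m grad_of f x0 = \sum_m Dv m f *: col m N.
  rewrite -Nv -mulmxA; apply/matrixP => i j; rewrite (ord1 j) summxE [LHS]mxE.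
  apply: eq_bigr => m _; rewrite [RHS]mxE [X in _ = _ * X]mxE mulrC; congr (_ * _).
  by rewrite /Dv -pairing_grad// pairing_row.
rewrite -ins_args ins_sum; last exact: Pbeta_alt.
rewrite -sumrN; apply: eq_bigr => m _; rewrite ins_args -mulrN.
rewrite -(alternating2_flip _ _ (Pbeta_alt p0)) mulrC; congr (_ * _).
have [_ _ /(_ k m) <-] := nbhs_singleton near_vertical.
by rewrite at_mvec_in.
Qed.

Lemma near_brk_Pi_yy : {near x0, brk (mx_in c Pi) (y i20) (y i21) =1 fun x => - (K x * F x)}.
Proof.
apply: filterS near_dom => x [p dp ->].
apply: etrans (brk_Pi dp (hgrad_y _ _ dp) (hgrad_y _ _ dp) (hgrad_y _ _ dp) (hgrad_y _ _ dp)) _.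
by rewrite (brk_Pbeta_y _ _ dp) mulr1 mul0r subr0 mulr1 addr0.
Qed.

Lemma near_brk_Pi_y0z k : {near x0, brk (mx_in c Pi) (y i20) (z_in k) =1
  fun x => - (K x * F x) * A i21 k x}.
Proof.
apply: filterS near_dom => x [p dp ->].
apply: etrans (brk_Pi dp (hgrad_y _ _ dp) (hgrad_y _ _ dp) (hgrad_z _ _ dp) (hgrad_z _ _ dp)) _.
by rewrite (brk_Pbeta_y _ _ dp) mul1r mul0r subr0 addr0.
Qed.

Lemma near_brk_Pi_y1z k : {near x0, brk (mx_in c Pi) (y i21) (z_in k) =1
  fun x => - (- (K x * F x) * A i20 k x)}.
Proof.
apply: filterS near_dom => x [p dp ->].
apply: etrans (brk_Pi dp (hgrad_y _ _ dp) (hgrad_y _ _ dp) (hgrad_z _ _ dp) (hgrad_z _ _ dp)) _.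
by rewrite (brk_Pbeta_y _ _ dp) mul1r mul0r sub0r addr0 mulrN.
Qed.

Lemma near_brk_Pi_zz k l : {near x0, brk (mx_in c Pi) (z_in k) (z_in l) =1 fun x =>
  - (K x * F x) * (A i20 k x * A i21 l x + - (A i20 l x * A i21 k x)) + vbracket q b k l x}.
Proof.
apply: filterS2 near_dom (near_brk_Pbeta_zz k l) => x [p dp ->] <-.
apply: etrans (brk_Pi dp (hgrad_z _ _ dp) (hgrad_z _ _ dp) (hgrad_z _ _ dp) (hgrad_z _ _ dp)) _.
by rewrite [A i21 k _ * _]mulrC.
Qed.

Lemma at_hgrad i f : differentiable f x0 ->
  (hc c c' p0 *m grad_of f (cfun c p0)) i 0 = Dh i f.
Proof. by move=> df; rewrite at_hc -pairing_row -/x0 pairing_grad. Qed.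

Lemma brk_Pi_y0 f : differentiable f x0 ->
  brk (mx_in c Pi) (y i20) f x0 = - (K x0 * F x0) * Dh i21 f.
Proof.
move=> df; have dp := at_dom.
apply: etrans (brk_Pi dp (hgrad_y _ _ dp) (hgrad_y _ _ dp) (at_hgrad _ df) (at_hgrad _ df)) _.
by rewrite (brk_Pbeta_y _ _ dp) mul1r mul0r subr0 addr0.
Qed.

Lemma brk_Pi_y1 f : differentiable f x0 ->
  brk (mx_in c Pi) (y i21) f x0 = - (- (K x0 * F x0) * Dh i20 f).
Proof.
move=> df; have dp := at_dom.
apply: etrans (brk_Pi dp (hgrad_y _ _ dp) (hgrad_y _ _ dp) (at_hgrad _ df) (at_hgrad _ df)) _.
by rewrite (brk_Pbeta_y _ _ dp) mul1r mul0r sub0r addr0 mulrN.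
Qed.

Lemma brk_Pi_z k f : differentiable f x0 ->
  brk (mx_in c Pi) (z_in k) f x0 = \sum_m vbracket q b k m x0 * Dv m f.
Proof.
move=> df; rewrite -brk_Pbeta_z//; have dp := at_dom.
have A0' i : (hc c c' p0 *m grad_of (z_in k) (cfun c p0)) i 0 = 0.
  by apply: etrans (hgrad_z i k dp) _; exact: at_A0.
apply: etrans (brk_Pi dp (A0' _) (A0' _) (at_hgrad _ df) (at_hgrad _ df)) _.
by rewrite !mul0r subrr mulr0 add0r.
Qed.

Let derh i : derivation_at x0 (Dh i) := derivation_derive x0 (row i h0).
Let derv k : derivation_at x0 (Dv k) := derivation_derive x0 (row k v0).

Lemma d_mx_Pi i j : differentiable (mx_in c Pi i j) x0.
Proof. exact: chart_diff (Pi_smooth ac _). Qed.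

Lemma d_mx_Pbeta i j : differentiable (mx_in c Pbeta i j) x0.
Proof. exact: chart_diff (Pbeta_smooth ac _). Qed.

Lemma d2_z k : twice_diff (z_in k) x0.
Proof. exact: twice_diff_pairing. Qed.

Lemma mixed_zero i m : K x0 * liehor x0 Dh Dv q b A i m = 0.
Proof. by rewrite -(structure_mixed i m) /K /x0 /coord /= cfunK. Qed.

Lemma Pi_yyz k : jacobiator (mx_in c Pi) (y i20) (y i21) (z_in k) x0 = 0.
Proof.
exact: (jacobi_yyz derh derv d_kappa d_F d_A at_A0 at_q0 D_F structure_curvature
  d_mx_Pi (mx_anti Pi_alt) d2_y d2_z brk_Pi_y0 brk_Pi_y1 brk_Pi_z
  near_brk_Pi_yy near_brk_Pi_y0z near_brk_Pi_y1z).
Qed.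

Lemma Pi_yzz i (k l : 'I_3) : (k < l)%N ->
  jacobiator (mx_in c Pi) (y i) (z_in k) (z_in l) x0 = 0.
Proof.
exact: (jacobi_yzz derh derv d_kappa d_F d_q d_b d_A at_A0 at_q0
  d_mx_Pi (mx_anti Pi_alt) d2_y d2_z brk_Pi_y0 brk_Pi_y1 brk_Pi_z
  near_brk_Pi_y0z near_brk_Pi_y1z near_brk_Pi_zz mixed_zero).
Qed.

Lemma Pi_zzz : jacobiator (mx_in c Pi) (z_in i30) (z_in i31) (z_in i32) x0 = 0.
Proof.
exact: (jacobi_zzz derv d_kappa d_F d_q d_b d_A at_A0 structure_vertical
  d_mx_Pi d2_z brk_Pi_z near_brk_Pi_zz).
Qed.

Definition coordinates (i : 'I_5) : 'rV[R]_5 -> R :=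
  nth (y i20) [:: y i20; y i21; z_in i30; z_in i31; z_in i32] i.

Lemma coordinatesP (Q : ('rV[R]_5 -> R) -> Prop) :
  (forall j, Q (y j)) -> (forall k, Q (z_in k)) -> forall i, Q (coordinates i).
Proof.
by move=> hy hz [[|[|[|[|[|//]]]]] hi]; rewrite /coordinates /=;
  first [exact: hy|exact: hz].
Qed.

Lemma increasing_triples (V : Type) (J : ('rV[R]_5 -> R) -> ('rV[R]_5 -> R) ->
    ('rV[R]_5 -> R) -> V) (v : V) :
  (forall k, J (y i20) (y i21) (z_in k) = v) ->
  (forall i (k l : 'I_3), (k < l)%N -> J (y i) (z_in k) (z_in l) = v) ->
  J (z_in i30) (z_in i31) (z_in i32) = v ->
  forall i j k : 'I_5, (i < j)%N -> (j < k)%N ->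
    J (coordinates i) (coordinates j) (coordinates k) = v.
Proof.
move=> h1 h2 h3.
by move=> [[|[|[|[|[|//]]]]] hi] [[|[|[|[|[|//]]]]] hj] [[|[|[|[|[|//]]]]] hk] // _ _;
  rewrite /coordinates /=; first [exact: h1|exact: h2|exact: h3].
Qed.

Lemma d2_coordinates i : twice_diff (coordinates i) x0.
Proof.
by apply: (coordinatesP (Q := fun f => twice_diff f x0)); [exact: d2_y|exact: d2_z].
Qed.

(** The Jacobian is the block matrix with columns T and N; the block matrix with rows h and v is its
    inverse. *)
Lemma coordinates_unit : (\matrix_(i, j) pd i (coordinates j) x0) \in unitmx.
Proof.
have e : col_mx h0 v0 *m row_mx T N = 1%:M.
  rewrite mul_col_row (frame_hT fr) at_hN at_vT vN.
  by rewrite -scalar_mx_block.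
have -> : \matrix_(i, j) pd i (coordinates j) x0 = row_mx T N :> 'M[R]_(5, 2 + 3).
  have spi : smooth_map pi by case: hpi.
  apply/matrixP => i j; rewrite [LHS]mxE [RHS]mxE.
  have yE k : pd i (y k) x0 = T i k.
    by rewrite -(dymap_entry spi i k ac ac' cp0 at_dom.2).
  have zE k : pd i (z_in k) x0 = N i k by rewrite pd_pairing mxE.
  case: splitP => k jk; rewrite /coordinates jk.
    by move: k {jk}; apply: ord2P; rewrite /= yE.
  by move: k {jk}; apply: ord3P; rewrite /= zE.
exact: (mulmx1_unit e).2.
Qed.

Lemma Pi_jacobiator f h k : twice_diff f x0 -> twice_diff h x0 -> twice_diff k x0 ->
  jacobiator (mx_in c Pi) f h k x0 = 0.
Proof.
have h3 := increasing_triples (J := fun f h k => jacobiator (mx_in c Pi) f h k x0)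
  Pi_yyz Pi_yzz Pi_zzz.
move=> df dh dk; exact: (jacobi_from_coordinates d_mx_Pi (mx_anti Pi_alt)
  d2_coordinates coordinates_unit h3 df dh dk).
Qed.

Lemma Pi_jacobi (W : set M) f h k : open W -> W p0 ->
  smooth_fun W f -> smooth_fun W h -> smooth_fun W k ->
  bracket Pi f (bracket Pi h k) p0 + bracket Pi h (bracket Pi k f) p0 +
  bracket Pi k (bracket Pi f h) p0 = 0.
Proof.
move=> oW Wp sf sh sk.
have b0 f1 f2 : bracket Pi f1 f2 p0 = brk (mx_in c Pi) (f1 \o cinv c) (f2 \o cinv c) x0.
  rewrite (brk_mvec _ _ _ Pi_alt) at_mvec_in /bracket pair2E.
  by rewrite !covec_ext_d.
have bn f1 f2 : smooth_fun W f1 -> smooth_fun W f2 ->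
    {near x0, bracket Pi f1 f2 \o cinv c =1
              brk (mx_in c Pi) (f1 \o cinv c) (f2 \o cinv c)}.
  move=> s1 s2; apply: filterS (near_chart oW cp0 Wp) => x /cimgP[cx Wx ex].
  by rewrite /= (bracket_in_chart oW Wx s1 s2 ac cx (Pi_alt _)) ex.
have t2 f1 : smooth_fun W f1 -> twice_diff (f1 \o cinv c) x0.
  move=> s1; apply: (@Csmooth_twice_diff _ _ (cimg c W)).
  - exact: cimg_open.
  - exact: cimg_in.
  - exact: (s1 c ac).
rewrite !b0 (brk_near _ _ (bn _ _ sh sk)) (brk_near _ _ (bn _ _ sk sf)).
rewrite (brk_near _ _ (bn _ _ sf sh)).
exact: (Pi_jacobiator (t2 _ sf) (t2 _ sh) (t2 _ sk)).
Qed.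

(** * Invariance of P_beta under horizontal lifts *)

Section HorizontalLie.
Variable u : vfield B.
Hypotheses (su : smooth_vfield setT u) (kappa_neq0 : kappa p0 != 0).

Let X (k : 'I_5) (x : 'rV[R]_5) : R := vfield_in c (hor_vfield pi g u) x 0 k.
Let w (i : 'I_2) (x : 'rV[R]_5) : R := vfield_in c' u (ymap pi c c' x) 0 i.

Lemma d_base_component i :
  differentiable (fun y' => vfield_in c' u y' 0 i) (ymap pi c c' x0).
Proof.
rewrite /x0 /coord (ymap_at c' cp0).
exact: (Csmooth_chart_diff (su ac' i) at_dom.2).
Qed.

Lemma d_w i : differentiable (w i) x0.
Proof. exact: differentiable_comp d_ymap (d_base_component i). Qed.

Lemma Dv_w k i : Dv k (w i) = 0.
Proof. exact: D_basic (d_base_component i). Qed.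

Lemma horizontal_field_at p : dom_cc c c' p ->
  vfield_in c (hor_vfield pi g u) (cfun c p) =
  vfield_in c' u (ymap pi c c' (cfun c p)) *m hc c c' p.
Proof.
move=> [cp op]; rewrite /vfield_in (ymap_at c' cp) (cfunK cp) (cfunK op) /hor_vfield /hc.
have uK := jac_unit ac' op; move: (hor pi g p) => H.
by rewrite !mulmxA mulmxKV.
Qed.

(** Differentiability of the lift is read off here: its coordinates are those of [u], pulled back
    from B, times the differentiable functions [hcov_in]. *)
Lemma X_hcov : forall k, {near x0, X k =1 fun x => \sum_i w i x * hcov_in c c' i (ecovec R k) x}.
Proof.
move=> k; apply: filterS near_dom => x [p dp ->].
rewrite /X (horizontal_field_at dp) mxE; apply: eq_bigr => i _.
by rewrite (hcov_at ac ac' _ _ dp) -colE [X in _ = _ * X]mxE.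
Qed.

Lemma d_X k : differentiable (X k) x0.
Proof.
apply: (near_eq_differentiable (f := fun x => \sum_i w i x * hcov_in c c' i (ecovec R k) x)).
  by apply: filterS (X_hcov k) => x e; exact: esym e.
by apply: diff_sum => i _; apply: differentiableM; [exact: d_w|exact: d_hcov].
Qed.

Lemma vder_X f x : vder X f x = pairing (vfield_in c (hor_vfield pi g u) x) (grad_of f x).
Proof. by rewrite pairingE; apply: eq_bigr => k _; rewrite [Y in _ = _ * Y]mxE. Qed.

Lemma vder_X_at f p : dom_cc c c' p -> vder X f (cfun c p) =
  \sum_i w i (cfun c p) * (hc c c' p *m grad_of f (cfun c p)) i 0.
Proof.
by move=> dp; rewrite vder_X (horizontal_field_at dp) /pairing -mulmxA mxE.
Qed.

Lemma vder_X_x0 f : differentiable f x0 -> vder X f x0 = \sum_i w i x0 * Dh i f.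
Proof.
move=> df; apply: etrans (vder_X_at f at_dom) _; apply: eq_bigr => i _.
by rewrite at_hgrad.
Qed.

Lemma near_vder_y j : {near x0, vder X (y j) =1 w j}.
Proof.
apply: filterS near_dom => x [p dp ->]; rewrite (vder_X_at _ dp).
rewrite (bigD1 j)//= big1 ?addr0 => [|i ij]; rewrite (hgrad_y _ _ dp).
  by rewrite eqxx mulr1.
by rewrite (negPf ij) mulr0.
Qed.

Lemma near_vder_z k : {near x0, vder X (z_in k) =1 fun x => \sum_i w i x * A i k x}.
Proof.
apply: filterS near_dom => x [p dp ->]; rewrite (vder_X_at _ dp).
by apply: eq_bigr => i _; rewrite (hgrad_z _ _ dp).
Qed.

Lemma liehor0 i m : liehor x0 Dh Dv q b A i m = 0.
Proof. by apply: (mulfI kappa_neq0); rewrite structure_mixed mulr0. Qed.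

Lemma lie_Pbeta_zero f h : twice_diff f x0 -> twice_diff h x0 ->
  vder X (brk (mx_in c Pbeta) f h) x0 - brk (mx_in c Pbeta) (vder X f) h x0
  - brk (mx_in c Pbeta) f (vder X h) x0 = 0.
Proof.
have an := mx_anti Pbeta_alt.
pose L f h := vder X (brk (mx_in c Pbeta) f h) x0 - brk (mx_in c Pbeta) (vder X f) h x0
  - brk (mx_in c Pbeta) f (vder X h) x0.
have Lyy i j : L (y i) (y j) = 0 := lie_yy derh an near_brk_Pbeta_y vder_X_x0 i j.
have Lyz i k : L (y i) (z_in k) = 0 :=
  lie_yz derh an d_w Dv_w near_brk_Pbeta_y brk_Pbeta_z vder_X_x0 near_vder_y i k.
have Lzy i k : L (z_in k) (y i) = 0 :=
  lie_zy derh an d_w Dv_w near_brk_Pbeta_y brk_Pbeta_z vder_X_x0 near_vder_y i k.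
have Lzz k l : L (z_in k) (z_in l) = 0 :=
  lie_zz derh derv d_q d_b d_A at_A0 at_q0 an d_w brk_Pbeta_z near_brk_Pbeta_zz
    vder_X_x0 near_vder_z liehor0 k l.
have Lcc s t : L (coordinates s) (coordinates t) = 0.
  apply: (coordinatesP (Q := fun f => L f (coordinates t) = 0)) => [i|k].
    exact: (coordinatesP (Q := fun h => L (y i) h = 0) (Lyy i) (Lyz i)).
  exact: (coordinatesP (Q := fun h => L (z_in k) h = 0) (fun i => Lzy i k) (Lzz k)).
move=> df dh.
exact: (lie_zero d_X d_mx_Pbeta d2_coordinates coordinates_unit Lcc df dh).
Qed.

Lemma lie_hor_Pbeta xi : lie (hor_vfield pi g u) Pbeta p0 xi = 0.
Proof.
(* Covectors constant in the chart are gradients of linear functions, for which the definition of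
   [lie] is the Leibniz expression of [lie_Pbeta_zero]. *)
pose f x := pairing x (xi i20); pose h x := pairing x (xi i21).
rewrite -(lie_Pbeta_zero (twice_diff_pairing (xi i20) x0) (twice_diff_pairing (xi i21) x0)).
have gf x : grad_of f x = xi i20.
  by apply/matrixP => i j; rewrite [LHS]mxE pd_pairing (ord1 j).
have gh x : grad_of h x = xi i21.
  by apply/matrixP => i j; rewrite [LHS]mxE pd_pairing (ord1 j).
have xiE : xi = args [:: xi i20; xi i21] by exact: args2.
have bf : brk (mx_in c Pbeta) f h = mvec_in c Pbeta xi.
  by apply/funext => x; rewrite (brk_mvec _ _ _ Pbeta_alt) gf gh -xiE.
have lieE k F1 : (forall x, F1 x = pairing (vfield_in c (hor_vfield pi g u) x) (xi k)) ->
    \col_l 'D_(evec R l) (fun x => pairing (vfield_in c (hor_vfield pi g u) x) (xi k)) x0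
    = grad_of F1 x0.
  move=> e; have -> : F1 = fun x => pairing (vfield_in c (hor_vfield pi g u) x) (xi k).
    by apply/funext => x; exact: e.
  by [].
rewrite /lie sum2 opprD addrA -/c -/x0 -/f -/h bf.
congr (_ - _ - _).
- have dP : differentiable (mvec_in c Pbeta xi) x0 by exact: chart_diff (Pbeta_smooth ac xi).
  rewrite vder_X (pairing_grad _ dP); congr ('D_ _ _ _).
  rewrite /vfield_in /x0 /coord cfunK// jac_chart_at invmx1 mulmx1.
  by [].
- rewrite (brk_mvec _ _ _ Pbeta_alt) at_mvec_in (lieE i20 (vder X f)) => [|x]; last first.
    by rewrite vder_X gf.
  by rewrite gh; congr (Pbeta p0); exact: args2.
rewrite (brk_mvec _ _ _ Pbeta_alt) at_mvec_in (lieE i21 (vder X h)) => [|x]; last first.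
  by rewrite vder_X gh.
by rewrite gf; congr (Pbeta p0); exact: args2.
Qed.

End HorizontalLie.

End AtPoint.

(** * The coupling property, the connection and the coupling form *)

Let T p := tangent pi p.
Let h p := hor pi g p.

Lemma horizontal_part p (w : 'rV[R]_5) : w *m g p = 0 -> w = w *m T p *m h p.
Proof.
by move=> wg; rewrite -mulmxA (frame_Th (triple_frame p)) mulmxBr mulmx1 wg subr0.
Qed.

Lemma ann_verticalP p xi : ann_vertical pi p xi <-> g p *m xi = 0.
Proof.
have fr := triple_frame p; split=> [an|gx v vT].
  apply/row_matrixP => i; rewrite row_mul row0; apply/matrixP => k l.
  rewrite (ord1 k) (ord1 l) [RHS]mxE; apply: (an (row i (g p))).
  by rewrite /vertical/= -row_mul (frame_gT fr) row0.
have -> : v = v *m g p.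
  by rewrite -[LHS]mulmx1 -(frame_sum fr) mulmxDr mulmxA vT mul0mx add0r.
by rewrite /pairing -mulmxA gx mulmx0 mxE.
Qed.

Lemma pairing_sharp (P : mvec M 2) p xi ze : alternating (P p) ->
  pairing (sharp P p xi) ze = P p (args [:: xi; ze]).
Proof. by move=> aP; rewrite vecE ?ins_args//; exact: ins_alternating. Qed.

Lemma Pi_horizontal p xi ze : g p *m xi = 0 ->
  Pi p (args [:: xi; ze]) = - kappa p * QH_val p *
    ((h p *m xi) i20 0 * (h p *m ze) i21 0 - (h p *m xi) i21 0 * (h p *m ze) i20 0).
Proof.
move=> gx; pose r i := (h p *m xi) i 0; pose t i := (h p *m ze) i 0.
rewrite -!/(r _) -!/(t _) Pi_eq Pbeta_vertical gx.
have -> : Pbeta p (args [:: 0; g p *m ze]) = 0.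
  exact: (multilinear_zero (i := i20) (Pbeta_alt p)).
rewrite QH_det det2 !mxE !pairing_row /args /= -!/(r _) -!/(t _); ring.
Qed.

Lemma sharp_horizontal p xi : g p *m xi = 0 -> sharp Pi p xi =
  (- kappa p * QH_val p) *:
    ((h p *m xi) i20 0 *: row i21 (h p) - (h p *m xi) i21 0 *: row i20 (h p)).
Proof.
move=> gx; apply: row_pairing_eq => ze.
rewrite (pairing_sharp _ _ (Pi_alt p)) (Pi_horizontal ze gx).
rewrite /pairing -scalemxAl mulmxBl -!scalemxAl -!row_mul.
by rewrite [RHS]mxE [X in _ = _ * X]mxE [X in _ = _ * (_ + X)]mxE ![(_ *: row _ _) _ _]mxE ![row _ _ _ _]mxE.
Qed.

Lemma QH_val_neq0 p : QH_val p != 0.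
Proof.
by apply/eqP => e; have /eqP := QH_val_omega p; rewrite e mul0r eq_sym oppr_eq0 oner_eq0.
Qed.

Lemma image_annP p w : kappa p != 0 -> image_ann pi Pi p w <-> w *m g p = 0.
Proof.
move=> k0; have fr := triple_frame p; split=> [[xi /ann_verticalP gx <-]|wg].
  rewrite (sharp_horizontal gx) -scalemxAl mulmxBl -!scalemxAl -!row_mul.
  by rewrite (frame_hg fr) !row0 !scaler0 subrr scaler0.
pose u := w *m T p; pose a := - kappa p * QH_val p.
have a0 : a != 0 by rewrite mulf_neq0 ?oppr_eq0// QH_val_neq0.
(* On the annihilator of the vertical space, the sharp map is a times the quarter turn (r_1, r_2) ->
   r_1 h_2 - r_2 h_1; taking (u_2, - u_1) and dividing by a inverts it. *)
pose xi := T p *m (\col_i (if i == i20 then u 0 i21 else - u 0 i20) : 'cV[R]_2).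
have gx : g p *m (a^-1 *: xi) = 0.
  by rewrite -scalemxAr mulmxA (frame_gT fr) mul0mx scaler0.
exists (a^-1 *: xi); first exact/ann_verticalP.
rewrite (sharp_horizontal gx) -/a -scalemxAr mulmxA (frame_hT fr) mul1mx.
rewrite [X in X *: row i21 _]mxE [X in X *: row i20 _]mxE.
rewrite [X in (_ * X) *: row i21 _]mxE [X in (_ * X) *: row i20 _]mxE /=.
have aK (v : 'rV[R]_5) : a *: (a^-1 *: v) = v by rewrite scalerA divff// scale1r.
rewrite -![(a^-1 * _) *: _]scalerA -scalerBr aK scaleNr opprK addrC.
rewrite [RHS](horizontal_part wg) -/u mulmx_sum_row sum2.
by [].
Qed.

(** * Smoothness of the horizontal lift and of omega in charts *)

Section Smoothness.
Variables (c : chart R M 5) (c' : chart R B 2).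
Hypotheses (ac : atlas c) (ac' : atlas c').

Let spi : smooth_map pi. Proof. by case: hpi. Qed.
Let O := cimg c (over pi c').
Let oO : open O. Proof. exact: cimg_open (over_open spi _). Qed.

Lemma cimg_over x : O x -> exists2 p, dom_cc c c' p & x = cfun c p.
Proof. by move=> /cimgP[cx ox ex]; exists (cinv c x). Qed.

Lemma omega_smooth : Csmooth O
  (fun x => form_in c' omega (args [:: evec R i20; evec R i21]) (ymap pi c c' x)).
Proof.
move=> k; apply: (Ck_comp (W := cimg c' setT) oO).
- move=> _ /cimg_over[p [cp op] ->]; rewrite (ymap_at c' cp); exact: cimg_in.
- by move=> k' j; exact: (ymap_smooth spi ac ac').
- exact: homega.1.2.
Qed.

Lemma dy_smooth j a : Csmooth O (fun x => dy_in c c' j x a 0).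
Proof.
move=> k; rewrite (_ : (fun x => _) = pd a (y_in c c' j)); last first.
  by apply/funext => x; rewrite mxE.
by have [_] := ymap_smooth spi ac ac' j k.+1; exact.
Qed.

Lemma bil_smooth (xi ze : 'rV[R]_5 -> 'cV[R]_5) :
  (forall a, Csmooth O (fun x => xi x a 0)) ->
  (forall a, Csmooth O (fun x => ze x a 0)) ->
  Csmooth O (fun x => bil c QH (xi x) (ze x) x).
Proof.
move=> sxi sze k; apply: (@Ck_sum _ _ _ _ _ _ xpredT (fun a x => \sum_b mx_in c QH a b x * xi x a 0 * ze x b 0) oO) => a _.
apply: (@Ck_sum _ _ _ _ _ _ xpredT (fun b x => mx_in c QH a b x * xi x a 0 * ze x b 0) oO) => b _.
apply: Ck_mul => //; last exact: sze.
apply: Ck_mul => //; last exact: sxi.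
have := (QH_bideg hsplit).1.2 c ac (args [:: ecovec R a; ecovec R b]) k.
by apply: Ck_sub; exact: cimgS.
Qed.

Lemma hcov_smooth j xi : Csmooth O (hcov_in c c' j xi).
Proof.
have cst (ze : 'cV[R]_5) a : Csmooth O (fun=> ze a 0) by move=> k; exact: Ck_cst.
move=> k.
have e i x : hcov_in c c' i xi x =
  (-1) * ((if i == i20 then bil c QH xi (dy_in c c' i21 x) x
   else bil c QH (dy_in c c' i20 x) xi x) *
   form_in c' omega (args [:: evec R i20; evec R i21]) (ymap pi c c' x)).
  by rewrite /hcov_in /F_in invrN invrK mulrN mulN1r.
apply: (Ck_ext oO (fun x _ => esym (e j x))); apply: Ck_mul => //; first exact: Ck_cst.
apply: Ck_mul => //; last exact: omega_smooth.
case: (j == i20).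
  exact: (bil_smooth (cst xi) (dy_smooth i21)).
exact: (bil_smooth (dy_smooth i20) (cst xi)).
Qed.

End Smoothness.

Lemma subbundle_image (U : set M) : open U -> (forall p, U p -> kappa p != 0) ->
  subbundle U (image_ann pi Pi).
Proof.
move=> oU Uk; exists 2%N => p Up.
have spi : smooth_map pi by case: hpi.
have ac' := atlas_chart_at (pi p); set c' := chart_at (pi p) in ac'.
exists (U `&` over pi c'); split.
- exact: openI (over_open spi _).
- by split=> //; exact: over_chart_at.
- by move=> q [].
(* The frame consists of the horizontal lifts of the coordinate fields of the one chart c'. The
   Jacobian is needed because [hor] at q takes base vectors read in the chart at pi q. *)
exists (fun i q => row i (jac c' (pi q) *m h q)); split=> [i c ac j k|q [Uq oq]].
  apply: (Ck_ext _ (f' := hcov_in c c' i (ecovec R j))).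
  - exact/cimg_open/openI/over_open.
  - move=> x /cimgP[cx [_ ox] ex]; rewrite -{1}ex hcov_at//.
    by rewrite /vfield_in -colE [LHS]mxE -row_mul [RHS]mxE.
  - by apply: (Ck_sub (U := cimg c (over pi c'))) (hcov_smooth ac ac' _ _ k); apply: cimgS => ? [].
have fr := triple_frame q; have uK := jac_unit ac' oq.
have -> : \matrix_i row i (jac c' (pi q) *m h q) = jac c' (pi q) *m h q.
  by apply/row_matrixP => i; rewrite rowK.
split.
  apply/row_freeP; exists (T q *m invmx (jac c' (pi q))).
  by rewrite mulmxA -(mulmxA _ (h q)) (frame_hT fr) mulmx1 mulmxV.
move=> w; rewrite (image_annP w (Uk _ Uq)); split=> [wg|/submxP[D ->]].
  rewrite (horizontal_part wg) -(mulmxKV uK (w *m T q)) -(mulmxA _ _ (h q)).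
  exact: submxMl.
by rewrite -(mulmxA D) -(mulmxA _ (h q)) (frame_hg fr) !mulmx0.
Qed.

Lemma coupling_Pi (U : set M) : open U -> (forall p, U p -> kappa p != 0) ->
  coupling pi U Pi.
Proof.
move=> oU Uk; split; first exact: subbundle_image.
move=> p Up; have fr := triple_frame p; split=> [w /(image_annP w (Uk _ Up)) wg wT|w].
  rewrite (horizontal_part wg); have -> : w *m T p = 0 by exact: wT.
  by rewrite mul0mx.
exists (w *m T p *m h p), (w *m g p); split.
- by apply/(image_annP _ (Uk _ Up)); rewrite -mulmxA (frame_hg fr) mulmx0.
- by rewrite /vertical /= -mulmxA (frame_gT fr) mulmx0.
- by rewrite -mulmxA -mulmxDr (frame_sum fr) mulmx1.
Qed.

Lemma Pi20 p xi ze : mvec_comp (g p) 2 0 (Pi p) (args [:: xi; ze]) =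
  - kappa p * QH_val p *
    ((h p *m xi) i20 0 * (h p *m ze) i21 0 - (h p *m xi) i21 0 * (h p *m ze) i20 0).
Proof.
have fr := triple_frame p; rewrite /mvec_comp component_full.
have -> : (fun i : 'I_2 => (1%:M - g p) *m (args [:: xi; ze] : 'I_2 -> 'cV[R]_5) i) =
    args [:: (1%:M - g p) *m xi; (1%:M - g p) *m ze] by exact: args2.
have hxi (x : 'cV[R]_5) : h p *m ((1%:M - g p) *m x) = h p *m x.
  by rewrite mulmxA mulmxBr mulmx1 (frame_hg fr) subr0.
rewrite Pi_horizontal ?hxi// mulmxA mulmxBr mulmx1 (frame_gg fr) subrr.
by rewrite mul0mx.
Qed.

Lemma vec_Pi20 p xi : vec (ins xi (mvec_comp (g p) 2 0 (Pi p))) =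
  (- kappa p * QH_val p) *:
    ((h p *m xi) i20 0 *: row i21 (h p) - (h p *m xi) i21 0 *: row i20 (h p)).
Proof.
apply: row_pairing_eq => ze.
rewrite vecE; last first.
  exact: ins_alternating (@mvec_comp_alternating _ _ (g p) 2 0 _ (Pi_alt p)).
rewrite ins_args Pi20 /pairing -scalemxAl mulmxBl -!scalemxAl -!row_mul.
by rewrite [RHS]mxE [X in _ = _ * X]mxE [X in _ = _ * (_ + X)]mxE ![(_ *: row _ _) _ _]mxE ![row _ _ _ _]mxE.
Qed.

Let sigma : dform M 2 := fun p v => (kappa p)^-1 * pullback pi omega p v.

Lemma sigma_alt p : alternating (sigma p).
Proof.
have [lin alt] := alternating_mulmx (T p) (omega_alt (pi p)).
split=> [v i c x y|v i j ij e]; rewrite /sigma /pullback.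
  by rewrite lin mulrDr mulrCA.
by rewrite (alt v i j ij e) mulr0.
Qed.

Lemma sigma_comp p : form_comp (g p) 2 0 (sigma p) = sigma p.
Proof.
apply/funext => v; rewrite /form_comp component_full /sigma /pullback.
congr (_ * omega _ _); apply/funext => i.
by rewrite mulmxBr mulmx1 mulmxBl -(mulmxA _ (g p)) (frame_gT (triple_frame p)) mulmx0 subr0.
Qed.

Lemma sigma_in c c' p v : atlas c -> atlas c' -> dom_cc c c' p ->
  form_in c sigma v (cfun c p) = (kappa p)^-1 *
  ((pairing (v i20) (dy_in c c' i20 (cfun c p)) * pairing (v i21) (dy_in c c' i21 (cfun c p))
  - pairing (v i20) (dy_in c c' i21 (cfun c p)) * pairing (v i21) (dy_in c c' i20 (cfun c p)))
  * form_in c' omega (args [:: evec R i20; evec R i21]) (ymap pi c c' (cfun c p))).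
Proof.
move=> ac ac' dp; have [cp op] := dp.
rewrite (form_in_at _ _ cp) /sigma; congr (_ * _).
have e : (fun i => v i *m jac c p *m tangent pi p) =
    (fun i => v i *m Tc c c' p *m jac c' (pi p)).
  apply/funext => i; rewrite (Tc_eq ac ac' dp) -!mulmxA.
  by rewrite (mulVmx (jac_unit ac' op)) mulmx1.
rewrite /pullback e (plane_form _ (alternating_mulmx (jac c' (pi p)) (omega_alt (pi p)))).
have d w j : pairing w (dy_in c c' j (cfun c p)) = (w *m Tc c c' p) 0 j.
  by rewrite (dy_at ac ac' j dp) pairing_col.
rewrite (d _ i20) (d (v i21) i21) (d (v i20) i21) (d (v i21) i20).
apply: f_equal2; first by [].
by rewrite (ymap_at c' cp) /form_in (cfunK op).
Qed.

Lemma sigma_bideg (U : set M) : open U -> (forall p, U p -> kappa p != 0) ->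
  form_bideg U g 2 0 sigma.
Proof.
move=> oU Uk; split; last by move=> p _; exact: sigma_comp.
split=> [p _|c ac v k]; first exact: sigma_alt.
have spi : smooth_map pi by case: hpi.
(* One chart of B need not contain the image of the whole domain of c, so the formula is written
   over a base chart around the image of the given point. *)
apply: Ck_local => x /cimgP[cx Ux ex].
have ac' := atlas_chart_at (pi (cinv c x)); set c' := chart_at _ in ac'.
pose f i j z := pairing (v i) (dy_in c c' j z).
exists (cimg c (U `&` over pi c')), (fun z => (kappa (cinv c z))^-1 *
  ((f i20 i20 z * f i21 i21 z + (-1) * (f i20 i21 z * f i21 i20 z)) *
    form_in c' omega (args [:: evec R i20; evec R i21]) (ymap pi c c' z))).
have oW : open (cimg c (U `&` over pi c')) by exact/cimg_open/openI/over_open.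
have sO : cimg c (U `&` over pi c') `<=` cimg c (over pi c') by apply: cimgS => ? [].
have sU : cimg c (U `&` over pi c') `<=` cimg c setT by exact: cimgS.
split=> //.
- by rewrite -ex; apply: cimg_in => //; split=> //; exact: over_chart_at.
- move=> z /cimgP[cz [_ oz] ez]; rewrite -ez (sigma_in _ ac ac' (conj cz oz)).
  by rewrite (cfunK cz) mulN1r.
have sf i j : Ck k (cimg c (U `&` over pi c')) (f i j).
  apply: (Ck_ext oW (f' := fun z => \sum_a v i 0 a * dy_in c c' j z a 0)).
    by move=> z _; rewrite /f pairingE.
  apply: (@Ck_sum _ _ _ _ _ _ xpredT (fun a z => v i 0 a * dy_in c c' j z a 0) oW) => a _.
  by apply: Ck_mul => //; [exact: Ck_cst|exact: Ck_sub sO (dy_smooth ac ac' j a k)].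
apply: Ck_mul => //.
  apply: Ck_inv => //; first by move=> z /cimgP[_ [Uz _] _]; exact: Uk.
  exact: Ck_sub sU (triple_smooth htriple ac k).
apply: Ck_mul => //; last exact: Ck_sub sO (omega_smooth ac ac' k).
apply: Ck_add => //; first exact: Ck_mul.
by apply: Ck_mul => //; [exact: Ck_cst|exact: Ck_mul].
Qed.

Lemma coupling_form_sigma (U : set M) : open U -> (forall p, U p -> kappa p != 0) ->
  coupling_form pi U g Pi sigma.
Proof.
move=> oU Uk; split; first exact: sigma_bideg.
move=> p Up xi /ann_verticalP gx; have fr := triple_frame p.
apply: col_pairing_eq => w; rewrite (covecE _ (ins_alternating _ (sigma_alt p))) ins_args.
rewrite vec_Pi20 /sigma /pullback (plane_form _ (omega_alt (pi p))).
set X := _ *: _; rewrite -/(omega_val (pi p)).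
have -> : args [:: X; w] i20 = X by [].
have -> : args [:: X; w] i21 = w by [].
rewrite {}/X.
have -> : pairing w (- xi) = - ((w *m T p) 0 i20 * (h p *m xi) i20 0 +
    (w *m T p) 0 i21 * (h p *m xi) i21 0).
  have xiE : T p *m (h p *m xi) = xi.
    by rewrite mulmxA (frame_Th fr) mulmxBl mul1mx gx subr0.
  rewrite /pairing mulmxN -{1}xiE (mulmxA w); move: (w *m T p) (h p *m xi) => u r.
  by rewrite [LHS]mxE; congr (- _); rewrite [LHS]mxE sum2.
rewrite -scalemxAl mulmxBl -!scalemxAl -!row_mul (frame_hT fr).
rewrite -/(T p); move: (w *m T p) => u.
pose r i := (h p *m xi) i 0; rewrite -!/(r _).
rewrite !mxE /=.
have k0 := Uk _ Up; have qo := QH_val_omega p.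
have kk : (kappa p)^-1 * kappa p = 1 by rewrite mulVf.
move: qo kk; move: (kappa p)^-1 => k'.
move: (QH_val p) (omega_val (pi p)) (kappa p) (r i20) (r i21) (u 0 i20) (u 0 i21).
move=> q o k r0 r1 u0 u1 qo kk.
(* The relations kappa^-1 kappa = 1 and Q_H(dy_1, dy_2) omega_12 = -1 have to be isolated as
   factors; the second one yields the sign in the definition of the coupling form. *)
transitivity ((k' * k) * (q * o) * (u0 * r0 + u1 * r1)); first by ring.
by rewrite kk qo mul1r mulN1r.
Qed.

(** A form of bidegree (2, 0) is determined by its value on (h_1, h_2). The defining condition for
    the single covector dy_1, paired with h_1, fixes this value, since kappa and Q_H(dy_1, dy_2) are
    nonzero. *)
Lemma coupling_form_unique (U : set M) sigma' : open U -> (forall p, U p -> kappa p != 0) ->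
  coupling_form pi U g Pi sigma' -> forall p, U p -> sigma' p = sigma p.
Proof.
move=> oU Uk cf' p Up; have fr := triple_frame p; have k0 := Uk _ Up.
have gT0 : g p *m col i20 (T p) = 0 by rewrite colE mulmxA (frame_gT fr) mul0mx.
have hT i j : (h p *m col i (T p)) j 0 = (j == i)%:R.
  by rewrite colE mulmxA (frame_hT fr) mul1mx mxE eqxx andbT.
have val s : coupling_form pi U g Pi s -> [/\ alternating (s p),
    form_comp (g p) 2 0 (s p) = s p &
    kappa p * QH_val p * s p (args [:: row i20 (h p); row i21 (h p)]) = -1].
  move=> [[[al _] co] cond]; have a := al _ Up; split=> //; first exact: co.
  have := cond p Up _ (iffRL (ann_verticalP _ _) gT0); rewrite vec_Pi20 !hT.
  rewrite scale1r scale0r subr0 => /(congr1 (pairing (row i20 (h p)))).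
  rewrite (covecE _ (ins_alternating _ a)) ins_args pairing_row mulmxN.
  rewrite [X in _ = X -> _]mxE hT => <-.
  have -> : args [:: (- kappa p * QH_val p) *: row i21 (h p); row i20 (h p)] =
      upd (args [:: row i21 (h p); row i20 (h p)]) i20
        ((- kappa p * QH_val p) *: row i21 (h p) + 0) :> ('I_2 -> 'rV[R]_5).
    by apply/esym/args2; rewrite /upd /= ?addr0.
  rewrite a.1 (upd_id (args [:: row i21 (h p); row i20 (h p)])).
  rewrite (multilinear_zero (v := upd _ i20 0) (i := i20) a)//.
  by rewrite addr0 (alternating2_flip _ _ a) mulNr mulNr mulrN.
have [a1 c1 v1] := val _ cf'; have [a2 c2 v2] := val _ (coupling_form_sigma oU Uk).
have kq : kappa p * QH_val p != 0 by rewrite mulf_neq0// QH_val_neq0.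
apply/funext => w; rewrite (horizontal_2form fr a1 c1) (horizontal_2form fr a2 c2).
by congr (_ * _); apply: (mulfI kq); rewrite v1 v2.
Qed.

(** Both projections fix vertical vectors, and g' kills the range of T h = 1 - g, which lies in the
    image of the annihilator. *)
Lemma connection_unique (U : set M) g' : (forall p, U p -> kappa p != 0) ->
  connection pi U g' -> ker_is_image pi U g' Pi -> forall p, U p -> g' p = g p.
Proof.
move=> Uk [_ cg'] ker p Up; have fr := triple_frame p; have [_ vg'] := cg' _ Up.
have Thg : T p *m h p *m g' p = 0.
  apply/row_matrixP => i; rewrite row_mul row0; apply/(ker p Up).
  by apply/(image_annP _ (Uk _ Up)); rewrite -row_mul -mulmxA (frame_hg fr) mulmx0 row0.
have gg : g p *m g' p = g p.
  apply/row_matrixP => i; rewrite row_mul; apply: vg'.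
  by rewrite /vertical /= -row_mul (frame_gT fr) row0.
by rewrite -[LHS]mul1mx -(frame_sum fr) mulmxDl Thg add0r gg.
Qed.

Lemma connectionS (U V : set M) g' : U `<=` V -> connection pi V g' -> connection pi U g'.
Proof.
move=> UV [sg cg]; split=> [c ac i j k|p /UV]; last exact: cg.
by apply: Ck_sub (sg c ac i j k); exact: cimgS.
Qed.

Lemma geometric_data_Pi (U : set M) : open U -> (forall p, U p -> kappa p != 0) ->
  geometric_data pi U Pi g sigma Pbeta.
Proof.
move=> oU Uk; split.
- exact: connectionS (triple_connection htriple).
- by move=> p Up w; split=> [/(image_annP _ (Uk _ Up))|/(image_annP _ (Uk _ Up))].
- move=> p Up; have fr := triple_frame p; apply/funext => xi.
  rewrite /mvec_comp component_0 Pi_eq -(QH_comp p) /mvec_comp component_full.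
  have -> : (fun i => (1%:M - g p) *m (g p *m xi i)) = fun=> 0.
    by apply/funext => i; rewrite mulmxA mulmxBl mul1mx (frame_gg fr) subrr mul0mx.
  rewrite (multilinear_zero (i := i20) (QH_alt p))// mulr0 oppr0 add0r.
  have -> : xi = args [:: xi i20; xi i21] by exact: args2.
  rewrite [RHS]Pbeta_vertical; congr (Pbeta p _); exact: args2.
- exact: coupling_form_sigma.
Qed.

(** Supplies the constant covectors dz_k and the dual frame at p. The factorisation may be chosen
    independently at each point, as every later identity is checked at one point at a time. *)
Lemma vertical_factor p : exists (N : 'M[R]_(5, 3)) (v : 'M[R]_(3, 5)),
  N *m v = g p /\ v *m N = 1%:M.
Proof. exact: rank_factor (frame_gg (triple_frame p)) (triple_rank p). Qed.

Lemma poisson_tensor_Pi (U : set M) : poisson_tensor U Pi.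
Proof.
split.
  split=> [p _|c ac xi k]; first exact: Pi_alt.
  by apply: Ck_sub (Pi_smooth ac xi k); exact: cimgS.
move=> W f1 f2 f3 oW _ s1 s2 s3 p Wp; have [N [v [Nv vN]]] := vertical_factor p.
exact: (Pi_jacobi Nv vN oW Wp s1 s2 s3).
Qed.

Lemma poisson_connection_Pbeta (U : set M) : (forall p, U p -> kappa p != 0) ->
  poisson_connection pi U g Pbeta.
Proof.
move=> Uk; split; first exact: connectionS (triple_connection htriple).
move=> u su p Up xi; have [N [v [Nv vN]]] := vertical_factor p.
exact: (lie_hor_Pbeta Nv vN su (Uk _ Up)).
Qed.

Lemma Pbeta_bideg (U : set M) : mvec_bideg U g 0 2 Pbeta.
Proof.
split; first split=> [p _|c ac xi k].
- exact: Pbeta_alt.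
- by apply: Ck_sub (Pbeta_smooth ac xi k); exact: cimgS.
move=> p _; apply/funext => xi; rewrite /mvec_comp component_0.
have -> : xi = args [:: xi i20; xi i21] by exact: args2.
rewrite [RHS]Pbeta_vertical; congr (Pbeta p _); exact: args2.
Qed.

Lemma Pi_Pbeta p : kappa p = 0 -> Pi p = Pbeta p.
Proof. by move=> k0; apply/funext => xi; rewrite Pi_eq k0 mul0r oppr0 add0r. Qed.

Lemma closed_zeros : closed [set p | kappa p = 0].
Proof.
apply: (@closed_comp _ _ kappa [set 0]); last exact: closed_eq.
by move=> p _; exact: (smooth_fun_cont openT (triple_smooth htriple)).
Qed.

End TripleData.

Theorem proposition4p7 (R : realType) (M : manifold R 5) (B : manifold R 2)
    (pi : M -> B) (Omega : dform M 5) (omega : dform B 2)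
    (g : endo M) (kappa : M -> R) (beta : dform M 1)
    (OmegaV : dform M 3) (QH : mvec M 2) (QV : mvec M 3) (psi : mvec B 2)
    (hpi : fiber_bundle pi)
    (hOmega : volume_form Omega) (homega : volume_form omega)
    (hsplit : splitting pi Omega omega g OmegaV QH QV psi)
    (htriple : poisson_triple pi OmegaV QH QV g kappa beta) :
  let Pi := triple_tensor pi QV psi g kappa beta in
  let Pbeta := P_ QV beta in
  let Z := [set p : M | kappa p = 0] in
  let U := ~` Z in
  let sigma : dform M 2 := fun p v => (kappa p)^-1 * pullback pi omega p v in
  [/\ (* (i) *)
      [/\ open U,
          poisson_tensor U Pi /\ coupling pi U Pi,
          geometric_data pi U Pi g sigma Pbeta,
          poisson_connection pi U g Pbeta &
          (forall g' : endo M, connection pi U g' -> ker_is_image pi U g' Pi ->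
             forall p, U p -> g' p = g p) /\
          (forall sigma' : dform M 2, coupling_form pi U g Pi sigma' ->
             forall p, U p -> sigma' p = sigma p)],
      (* (ii) *)
      [/\ poisson_tensor (interior Z) Pbeta,
          mvec_bideg (interior Z) g 0 2 Pbeta &
          forall p, interior Z p -> Pi p = Pbeta p] &
      (* (iii) *)
      forall p, (closure Z `\` interior Z) p ->
        forall v, wedge (d01_fun g kappa p) (beta p) v = 0].
Proof.
move=> Pi Pbeta Z U sigma.
have oU : open U by rewrite openC; exact: (closed_zeros htriple).
have Uk p : U p -> kappa p != 0 by move=> Up; apply/eqP.
split.
- split=> //.
  + split; first exact: (poisson_tensor_Pi hpi homega hsplit htriple).
    exact: (coupling_Pi hpi homega hsplit htriple).
  + exact: (geometric_data_Pi hpi homega hsplit htriple).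
  + exact: (poisson_connection_Pbeta hpi homega hsplit htriple).
  + split=> [g' cg' kg'|sigma' cf'].
      exact: (connection_unique hpi homega hsplit htriple Uk cg' kg').
    exact: (coupling_form_unique hpi homega hsplit htriple oU Uk cf').
- have e p : interior Z p -> Pi p = Pbeta p.
    by move=> /interior_subset; exact: (Pi_Pbeta hpi homega hsplit htriple).
  split=> //; last exact: (Pbeta_bideg hpi hsplit htriple).
  apply: (poisson_tensor_local (open_interior _) e).
  exact: (poisson_tensor_Pi hpi homega hsplit htriple).
move=> p [cZ _] v.
have k0 : kappa p = 0.
  by have /closure_id e := closed_zeros htriple; move: cZ; rewrite -[closure _]e.
by have := triple_21 htriple p v; rewrite k0 expr0n /= mul0r subr0.
Qed.
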